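(* Let $\mathcal{H}$ be a separable infinite-dimensional Hilbert space and let $\mathfrak{A}\subset\mathcal{B}(\mathcal{H})$ be a unital transitive subalgebra that is closed in the weak operator topology. If $\mathfrak{A}$ has the left (resp. right) partial factorization property, then $\mathfrak{A}=\mathcal{B}(\mathcal{H})$.
   Context: $\mathcal{B}(\mathcal{H})$ is the algebra of all bounded linear operators on $\mathcal{H}$; unital means containing the identity $I$. The symbol $\subset$ does not mean proper inclusion here. A unital subalgebra $\mathfrak{A}\subseteq\mathcal{B}(\mathcal{H})$ has the left (resp. right) partial factorization property if for every invertible $S\in\mathcal{B}(\mathcal{H})$ there exists an isometry (resp. a co-isometry) $U\in\mathcal{B}(\mathcal{H})$ such that $U^*S\in\mathfrak{A}$ and $S^{-1}U\in\mathfrak{A}$. The invariant subspace lattice is $\operatorname{Lat}\mathfrak{A}=\{E\in\mathcal{B}(\mathcal{H}) \text{ a projection}: (I-E)AE=0 \text{ for all } A\in\mathfrak{A}\}$. The algebra $\mathfrak{A}$ is transitive if $\operatorname{Lat}\mathfrak{A}=\{0,I\}$. *)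

(* Defs.v *)
From HB Require Import structures.
From mathcomp Require Import all_boot all_order all_algebra.
From mathcomp Require Import complex.
From mathcomp Require Import all_classical all_reals all_analysis.

Set Implicit Arguments.
Unset Strict Implicit.
Unset Printing Implicit Defensive.

Import Order.TTheory GRing.Theory Num.Theory.
Import numFieldNormedType.Exports.

Local Open Scope classical_set_scope.
Local Open Scope ring_scope.
Local Open Scope complex_scope.

Definition separable_space (T : topologicalType) : Prop :=
  exists2 D : set T, countable D & dense D.

Definition finite_dimensional (K : nzRingType) (V : lmodType K) : Prop :=
  exists s : seq V, forall x : V, exists c : 'I_(size s) -> K,
    x = \sum_(i < size s) c i *: s`_i.

Section HilbertOperators.
Variables (R : realType) (H : completeNormedModType R[i]).
Variable dot : {dot H for Num.conj}.

(* [H] is complete for its norm, so this makes [(H, dot)] a complex Hilbert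
   space; [dot] is linear in its first argument and conjugate-linear in the
   second. *)
Definition induces_norm : Prop := forall x : H, dot x x = `|x| ^+ 2.

Definition bounded_operator : set (H -> H) :=
  [set T | linear T /\ exists M : R[i], forall x, `|T x| <= M * `|x|].

(* The adjoint of a bounded operator [T] is the unique [T'] related to it. *)
Definition is_adjoint (T T' : H -> H) : Prop :=
  forall x y, dot (T x) y = dot x (T' y).

Definition isometry_op (U : H -> H) : Prop :=
  bounded_operator U /\ forall x, `|U x| = `|x|.

Definition co_isometry_op (U : H -> H) : Prop :=
  bounded_operator U /\ exists2 U', is_adjoint U U' & isometry_op U'.

Definition projection (E : H -> H) : Prop :=
  [/\ bounded_operator E, E \o E = E & is_adjoint E E].

Definition unital_subalgebra (A : set (H -> H)) : Prop :=
  [/\ A `<=` bounded_operator,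
      A idfun,
      forall (c : R[i]) S T, A S -> A T -> A (c *: S + T) &
      forall S T, A S -> A T -> A (S \o T)].

Definition matrix_coefficients (T : H -> H) : {ptws (H * H)%type -> R[i]^o} :=
  fun p => dot (T p.1) p.2.

(* The coarsest topology making every [T |-> dot (T x) y] continuous. *)
Local Notation weak_operator_topology :=
  (initial_topology matrix_coefficients).

(* [subspace B] carries the topology induced on [B]; the points outside [B]
   are isolated, which is harmless for subsets of [B]. *)
Definition WOT_closed (A : set (H -> H)) : Prop :=
  closed (A : set (subspace (bounded_operator : set weak_operator_topology))).

Definition Lat (A : set (H -> H)) : set (H -> H) :=
  [set E | projection E /\ forall T, A T -> (idfun - E) \o T \o E = 0].

Definition transitive_algebra (A : set (H -> H)) : Prop :=
  Lat A = [set 0; idfun].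

Definition inverse_operators (S S' : H -> H) : Prop :=
  [/\ bounded_operator S, bounded_operator S', S \o S' = idfun & S' \o S = idfun].

Definition left_partial_factorization (A : set (H -> H)) : Prop :=
  forall S S', inverse_operators S S' ->
    exists U U', [/\ isometry_op U, is_adjoint U U', A (U' \o S) & A (S' \o U)].

Definition right_partial_factorization (A : set (H -> H)) : Prop :=
  forall S S', inverse_operators S S' ->
    exists U U', [/\ co_isometry_op U, is_adjoint U U', A (U' \o S) & A (S' \o U)].

End HilbertOperators.

(* Main.v *)
(* If A <> B(H), a normal functional T |-> \sum_i <T x_i, k_i> of minimal length
   vanishes on A but not on B(H); take the x_i orthonormal.  Minimality makes the
   annihilator rigid: up to a scalar, only the identity matrix a satisfies
   \sum_ij a_ij <X x_i, k_j> = 0 on A.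

   Right case.  Some X in A has (<X x_i, k_j>) = diag(n, -1, ..., -1).  For s > 0 an
   invertible finite-rank perturbation of I, factored as in the hypothesis, produces
   a unit vector v_s such that v_s and v_t are orthogonal for s <> t, which is
   impossible in a separable space.

   Left case.  Let Q_s be the projection on the span of the basis vectors e_n with
   s n = true, and factor the operators 1 + Q_s for s in the Cantor space.  By Baire's
   theorem and weak compactness, pairs of tails 000... and 111... yield contractions
   X = W1^* (1/2 P + 1/2) W2 in A, with P of finite rank, that almost fix a given unit
   vector x.  An infinite product of such operators is a compact contraction in A
   almost fixing x, so Lomonosov's fixed-point argument gives a compact T in A with
   eigenvalue 1.  The inverse of 1 - sT stays in A until it blows up for some s in
   [0, 1]; normalised, it tends to some L <> 0 in A with L = s T L, hence of finite
   rank.  An eigenvector of the map L X x_0 |-> L X x_1 then contradicts minimality.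

   Brouwer's theorem, needed for Lomonosov's argument, is obtained from Scarf's
   combinatorial lemma on the grid points of a simplex. *)

Require Import Defs.
From mathcomp Require Import all_boot zify.

Set Implicit Arguments.
Unset Strict Implicit.
Unset Printing Implicit Defensive.

(** * Scarf's lemma *)

(** Passing to adjoints in [A] and replacing [S] by the adjoint of its inverse turns each
    factorization property into itself, with the same [U], so neither case follows from the other.
    In the right case [U'] is isometric: the vectors [U' x_i] keep norm one, and too many
    orthogonality relations among them are absurd. In the left case [U'] may kill these vectors;
    only [U x] has a known norm, and the two memberships combine only into products
    [U1' S1 S2^-1 U2]. Such a product almost fixes [x] when [U1 x] and [U2 x] are close to one
    vector [y] that [S1 S2^-1] almost fixes. It has norm at most 1/2 modulo compact operators when
    [S1 S2^-1] is 1/2 on all but finitely many basis vectors. Density of a countable set of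
    candidates [y] gives the first condition, freedom in the tails of [s] the second. The eigenvalue
    1 of [T] is what prevents the inverse of [1 - sT] from existing up to [s = 1], hence forces the
    blow-up; the range of the limit [L] lies in the fixed space of the compact operator [sT], hence
    its finite rank. *)

Lemma imset_collision (T U : finType) (f : T -> U) (D : {set T}) :
  #|D| = #|f @: D|.+1 ->
  exists i j, [/\ i != j, i \in D, j \in D, f i = f j &
    forall k, k \in D -> (f @: (D :\ k) == f @: D) = (k \in [set i; j])].
Proof.
move=> cD.
have : ~~ [forall i in D, [forall j in D, (f i == f j) ==> (i == j)]].
  apply/negP => /forall_inP injD.
  suff /imset_injP/eqP cfD : {in D &, injective f} by move: cD; rewrite cfD => /n_Sn.
  move=> i j iD jD fij; apply/eqP.
  by have /forall_inP/(_ j jD)/implyP := injD i iD; apply; apply/eqP.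
case/forall_inPn => i iD /forall_inPn[j jD]; rewrite negb_imply => /andP[/eqP fij ij].
have sub k l : k \in D -> l \in D -> k != l -> f k = f l -> f @: (D :\ k) = f @: D.
  move=> kD lD kl fkl; apply/eqP; rewrite eqEsubset imsetS ?subsetDl //=.
  apply/subsetP => _ /imsetP[m mD ->]; have [->|mk] := eqVneq m k.
    by rewrite fkl imset_f // !inE eq_sym kl.
  by rewrite imset_f // !inE mk.
exists i, j; split=> // k kD; rewrite !inE.
have [->|ki] := eqVneq k i; first by rewrite (sub i j) ?eqxx.
have [->|kj] := eqVneq k j; first by rewrite (sub j i) ?eqxx // eq_sym.
apply/negbTE/eqP => E.
have /imset_injP inj : #|f @: (D :\ k)| == #|D :\ k|.
  by rewrite E; move: (cardsD1 k D); rewrite kD cD => -[->].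
by move/eqP: ij; apply; apply: inj; rewrite ?inE ?iD ?jD ?(eq_sym _ k) ?ki ?kj.
Qed.

Section Scarf.
Variables (V I : finType) (r : I -> V -> nat).
Hypothesis rI : forall i, injective (r i).
Implicit Types (S : {set V}) (C : {set I}).

(** No point lies above the minimum of [S] in all orders of [C] at once. On grid points this leaves
    no room above the coordinatewise minima of [S], which is what makes [S] small. *)
Definition dominant S C :=
  [forall y, [exists i in C, [forall x in S, r i y <= r i x]]]%N.

Lemma dominantP S C : reflect
  (forall y, exists2 i, i \in C & forall x, x \in S -> r i y <= r i x)%N
  (dominant S C).
Proof.
apply: (iffP forallP) => H y; first by have /exists_inP[i iC /forall_inP] := H y; exists i.
by apply/exists_inP; have [i iC h] := H y; exists i => //; apply/forall_inP.
Qed.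

Lemma dominantS S S' C C' : S' \subset S -> C \subset C' ->
  dominant S C -> dominant S' C'.
Proof.
move=> sS sC /dominantP d; apply/dominantP => y; have [i iC h] := d y.
by exists i => [|x xS]; [exact: (subsetP sC)|apply: h; exact: (subsetP sS)].
Qed.

Variable v0 : V.

Definition lowest S i :=
  odflt v0 [pick x in S | [forall y in S, r i x <= r i y]%N].

Lemma lowestP S i : S != set0 ->
  lowest S i \in S /\ forall y, y \in S -> (r i (lowest S i) <= r i y)%N.
Proof.
move=> /set0Pn[s sS]; rewrite /lowest; case: pickP => [x /andP[xS /forall_inP]//|].
case: (arg_minnP (r i) sS) => x xS xmin /(_ x) /= /negbT/negP[].
by apply/andP; split=> //; apply/forall_inP.
Qed.

Lemma lowest_eq S i x : x \in S -> (forall y, y \in S -> r i x <= r i y)%N ->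
  lowest S i = x.
Proof.
move=> xS xmin; have [|lS lmin] := @lowestP S i; first by apply/set0Pn; exists x.
by apply: (@rI i); apply/eqP; rewrite eqn_leq lmin // xmin.
Qed.

Lemma dominant_lowest S C : S != set0 -> reflect
  (forall y, exists2 i, i \in C & r i y <= r i (lowest S i))%N (dominant S C).
Proof.
move=> S0; apply: (iffP (dominantP _ _)) => d y; have [i iC h] := d y; exists i => //.
  by apply: h; case: (lowestP i S0).
by move=> x xS; apply: (leq_trans h); case: (lowestP i S0) => _; apply.
Qed.

(** Dominance tested at a point [x] of [S] itself says that [x] is the minimum of [S] for some order
    of [C]. Hence [#|S| <= #|C|]; rooms are the case of equality, doors the case of one extra
    order. *)
Lemma dominant_imset S C : S != set0 -> dominant S C -> lowest S @: C = S.
Proof.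
move=> S0 /dominantP d; apply/eqP; rewrite eqEsubset; apply/andP; split.
  by apply/subsetP => _ /imsetP[i _ ->]; case: (lowestP i S0).
apply/subsetP => x xS; have [i iC h] := d x; apply/imsetP; exists i => //.
by rewrite (@lowest_eq _ _ x).
Qed.

(* A dominant pair [(S, C)] with [#|C| = #|S|.+1] and [S] nonempty is adjacent
   to exactly two dominant pairs of equal cardinals. *)
Lemma door_rooms S C : S != set0 -> dominant S C -> #|C| = #|S|.+1 ->
  (#|[set x | (x \notin S) && dominant (x |: S) C]| +
   #|[set i | (i \in C) && dominant S (C :\ i)]| = 2)%N.
Proof.
move=> S0 d cC; have lC := dominant_imset S0 d.
have [|i [j [ij iC jC lij coll]]] := @imset_collision _ _ (lowest S) C; first by rewrite lC.
pose M k := [set y | [forall l in C :\ k, r l (lowest S l) < r l y]%N].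
have MP k y : reflect (forall l, l \in C -> l != k -> r l (lowest S l) < r l y)%N (y \in M k).
  rewrite inE; apply: (iffP forall_inP) => H l; last by rewrite !inE => /andP[lk lC']; exact: H.
  by move=> lC' lk; apply: H; rewrite !inE lk.
have M0 k : (M k == set0) = dominant S (C :\ k).
  apply/idP/(dominant_lowest _ S0) => [/eqP Mk y|dk].
    have : y \notin M k by rewrite Mk inE.
    by rewrite inE => /forall_inPn[l lC' h]; exists l => //; rewrite leqNgt.
  apply/eqP/setP => y; rewrite !inE; apply/negbTE/forall_inPn.
  by have [l lC' h] := dk y; exists l => //; rewrite -leqNgt.
pose X := [set x | (x \notin S) && dominant (x |: S) C].
pose K := [set k | (k \in C) && dominant S (C :\ k)].
have KE : K = [set k in [set i; j] | M k == set0].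
  apply/setP => k; rewrite !inE M0.
  have [kC|kC] /= := boolP (k \in C); last first.
    by apply/esym/negbTE; move: kC; apply: contra => /andP[/orP[]/eqP-> _].
  apply/idP/andP => [dk|[]//]; split=> //.
  by have := coll k kC; rewrite (dominant_imset S0 dk) lC eqxx !inE => <-.
have XM k x : x \in X -> x \in M k -> forall y, y \in M k -> (r k y <= r k x)%N.
  rewrite inE => /andP[xS /dominantP dx] /MP xM y /MP yM.
  have [l lC' h] := dx y; have [<-|lk] := eqVneq l k; first by apply: h; rewrite !inE eqxx.
  have := yM l lC' lk; rewrite ltnNge h // !inE; apply/orP; right.
  by case: (lowestP l S0).
have XIJ x : x \in X -> (x \in M i) || (x \in M j).
  rewrite inE => /andP[xS dx].
  have x0 : x |: S != set0 by apply/set0Pn; exists x; rewrite !inE eqxx.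
  have lxC := dominant_imset x0 dx.
  have /imset_injP linj : #|lowest (x |: S) @: C| == #|C| by rewrite lxC cardsU1 xS cC.
  have : x \in lowest (x |: S) @: C by rewrite lxC !inE eqxx.
  case/imsetP => k kC xk.
  have lS l : l \in C -> l != k -> lowest S l = lowest (x |: S) l /\ lowest (x |: S) l != x.
    move=> lC' lk; have [+ lmin] := lowestP l x0.
    have lx : lowest (x |: S) l != x.
      by apply: contra lk => /eqP E; apply/eqP; apply: linj => //; rewrite E.
    rewrite !inE (negPf lx) /= => lS; split=> //; apply: lowest_eq => // y yS.
    by apply: lmin; rewrite !inE yS orbT.
  have xM : x \in M k.
    apply/MP => l lC' lk; have [-> lx] := lS l lC' lk; have [_ lmin] := lowestP l x0.
    rewrite ltn_neqAle lmin ?inE ?eqxx // andbT; apply: contra lx => /eqP /rI ->.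
    exact: eqxx.
  have [<-|ki] := eqVneq k i; first by rewrite xM.
  have [<-|kj] := eqVneq k j; first by rewrite xM orbT.
  have [|E1 _] := lS i iC; first by rewrite eq_sym.
  have [|E2 _] := lS j jC; first by rewrite eq_sym.
  by move/eqP: ij; case; apply: linj => //; rewrite -E1 -E2.
have MIJ x : x \in M i -> x \in M j -> False.
  move=> /MP xi /MP xj; have /(dominant_lowest _ S0)/(_ x)[l lC'] := d.
  rewrite leqNgt => /negP; apply; have [E|li] := eqVneq l i; last exact: xi.
  by apply: xj => //; rewrite E.
have XMk k : k \in [set i; j] -> #|X :&: M k| = (M k != set0).
  move=> kij.
  have kC : k \in C by move: kij; rewrite !inE => /orP[]/eqP->.
  have lk : lowest S @: (C :\ k) = S by apply/eqP; rewrite -[X in _ == X]lC coll.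
  have [->|/set0Pn[y yM]] := eqVneq (M k) set0; first by rewrite setI0 cards0.
  case: (arg_maxnP (r k) yM) => x xM' xmax.
  have xM : x \in M k := xM'.
  suff -> : X :&: M k = [set x] by rewrite cards1.
  apply/setP => z; rewrite in_setI in_set1.
  have xX : x \in X.
    rewrite inE; apply/andP; split.
      apply/negP; rewrite -lk => /imsetP[l]; rewrite !inE => /andP[lk' lC'] E.
      by have /MP/(_ l lC' lk') := xM; rewrite -E ltnn.
    have xk s : s \in S -> (r k x <= r k s)%N.
      have /(dominant_lowest _ S0)/(_ x)[l lC' h] := d.
      have [E|lk'] := eqVneq l k; last by have /MP/(_ l lC' lk') := xM; rewrite ltnNge h.
      by move=> sS; subst l; apply: (leq_trans h); case: (lowestP k S0) => _; apply.
    apply/dominantP => w; have [wM|] := boolP (w \in M k).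
      exists k => // z'; rewrite !inE => /orP[/eqP->|z'S]; first exact: xmax.
      by apply: (@leq_trans (r k x)); [exact: xmax|exact: xk].
    rewrite inE => /forall_inPn[l]; rewrite !inE -leqNgt => /andP[lk' lC'] h.
    exists l => // z'; rewrite !inE => /orP[/eqP->|z'S].
      by apply: (leq_trans h); apply: ltnW; have /MP := xM; apply.
    by apply: (leq_trans h); case: (lowestP l S0) => _; apply.
  have [->|zx] := eqVneq z x; first by rewrite xX xM.
  apply/negbTE/negP => /andP[zX zM].
  have h1 := XM k z zX zM x xM; have h2 : (r k z <= r k x)%N := xmax z zM.
  by move/eqP: zx; apply; apply: (@rI k); apply/eqP; rewrite eqn_leq h2 h1.
rewrite -/X -/K.
have -> : #|X| = (#|X :&: M i| + #|X :&: M j|)%N.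
  have -> : #|X| = #|(X :&: M i) :|: (X :&: M j)|.
    congr #|pred_of_set _|; apply/setP => x; rewrite -setIUr in_setI in_setU.
    by case xX : (x \in X) => //=; rewrite XIJ.
  rewrite cardsU [X in (_ - X)%N](_ : _ = 0%N) ?subn0 //; apply: eq_card0 => x.
  rewrite !in_setI; apply/negP => /andP[/andP[_ xi] /andP[_ xj]]; exact: (MIJ x).
rewrite !XMk ?inE ?eqxx ?orbT // KE.
have -> : #|[set k in [set i; j] | M k == set0]| =
   ((M i == set0) + (M j == set0))%N.
  rewrite -sum1_card; rewrite (eq_bigl (fun k => (k \in [set i; j]) && (M k == set0))).
    by rewrite big_mkcondr big_setU1 ?inE //= big_set1; do 2 case: ifP.
  by move=> k; rewrite !inE.
by case: (M i == _); case: (M j == _).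
Qed.

Section Colour.
Variables (c : V -> I) (i0 : I).

(** The doors of the parity argument: of the colours in [C], only [i0] is missing. *)
Definition almost_coloured S C :=
  [&& i0 \in C, #|C| == #|S|.+1 & c @: S == C :\ i0].

Lemma imsetU1D S x : x \in S -> c @: S = c x |: c @: (S :\ x).
Proof. by move=> xS; rewrite -imsetU1 setD1K. Qed.

Lemma card_pred1 (T : finType) (P : pred T) x : P x -> (forall y, P y -> y = x) ->
  #|[set y | P y]| = 1.
Proof.
move=> Px Py; suff -> : [set y | P y] = [set x] by rewrite cards1.
by apply/setP => y; rewrite !inE; apply/idP/eqP => [/Py|->].
Qed.

Lemma card_pred0 (T : finType) (P : pred T) : (forall y, ~~ P y) -> #|[set y | P y]| = 0.
Proof. by move=> Py; apply: eq_card0 => y; rewrite inE; apply/negbTE. Qed.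

(** A fully coloured room has one door: drop the point of colour [i0], or add [i0] to [C] if it is
    absent. If the colours are [C :\ i0], two points share a colour and dropping either gives a
    door. If a colour [i] outside [C] replaces [i0], the two doors come from dropping its point or
    adding [i] to [C]. Every other room has none. *)
Lemma room_doors S C : #|S| = #|C| ->
  odd (#|[set x | (x \in S) && almost_coloured (S :\ x) C]| +
       #|[set i | (i \notin C) && almost_coloured S (i |: C)]|) = (c @: S == C).
Proof.
move=> cSC.
have cD x : x \in S -> (#|C| == #|S :\ x|.+1) = true.
  by move=> xS; rewrite -cSC (cardsD1 x S) xS eqxx.
have cU i : i \notin C -> (#|i |: C| == #|S|.+1) = true.
  by move=> iC; rewrite cardsU1 iC cSC eqxx.
have [cS|cSN] := eqVneq (c @: S) C.
  have /imset_injP cinj : #|c @: S| == #|S| by rewrite cS cSC.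
  have [iC|iC] := boolP (i0 \in C).
    rewrite (@card_pred0 _ (fun i => (i \notin C) && _)) => [|i]; last first.
      apply/negP => /and4P[_ _ _ /eqP E]; move: iC; rewrite -cS E.
      by rewrite !inE eqxx.
    move: (iC); rewrite -{1}cS => /imsetP[x xS xi].
    rewrite (@card_pred1 _ _ x) //.
      rewrite xS /almost_coloured iC cD //= -cS (imsetU1D xS) -xi setU1K ?eqxx //.
      apply/negP => /imsetP[y]; rewrite !inE => /andP[yx yS] E.
      by move/eqP: yx; apply; apply: cinj => //; rewrite -E.
    move=> y /and4P[yS _ _ /eqP E]; apply: cinj => //.
    apply/eqP; apply: contraT => cyx.
    suff : i0 \in C :\ i0 by rewrite !inE eqxx.
    by rewrite -E xi imset_f // !inE xS andbT; apply: contra cyx => /eqP ->.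
  rewrite card_pred0 => [|x]; last by rewrite /almost_coloured (negPf iC) andbF.
  rewrite (@card_pred1 _ _ i0) //.
    by rewrite iC /almost_coloured !inE eqxx cU //= setU1K // cS eqxx.
  move=> i /and4P[iC' + _ _]; rewrite !inE (negPf iC) orbF => /eqP //.
have [/andP[iC /eqP cS]|ncS] := boolP ((i0 \in C) && (c @: S == C :\ i0)).
  rewrite [X in odd (_ + X)]card_pred0 => [|i]; last first.
    apply/negP => /and4P[iC' _ _ /eqP]; rewrite cS => E.
    have : i \in C :\ i0.
      by rewrite E !inE eqxx andbT /=; apply: contraNneq iC' => ->.
    by rewrite !inE (negPf iC') andbF.
  have [|i [j [ij iS jS _ coll]]] := @imset_collision _ _ c S.
    by rewrite cS cSC (cardsD1 i0 C) iC.
  suff -> : [set x | (x \in S) && almost_coloured (S :\ x) C] = [set i; j].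
    by rewrite cards2 ij addn0.
  apply/setP => x; rewrite !inE; apply/andP/orP => [[xS /and3P[_ _ /eqP E]]|].
    by have := coll x xS; rewrite E cS eqxx !inE => /esym/orP.
  move=> xij; have xS : x \in S by case: xij => /eqP ->.
  split=> //; rewrite /almost_coloured iC cD //= -cS coll // !inE.
  exact/orP.
have [/exists_inP[i iC /andP[iC0 /eqP cS]]|ncS'] :=
  boolP [exists i in ~: C, (i0 \in C) && (c @: S == i |: C :\ i0)].
  rewrite inE in iC.
  have iC1 : i \notin C :\ i0 by rewrite !inE (negPf iC) andbF.
  have /imset_injP cinj : #|c @: S| == #|S|.
    by rewrite cS cardsU1 iC1 cSC [in X in _ == X](cardsD1 i0 C) iC0.
  have : i \in c @: S by rewrite cS !inE eqxx.
  case/imsetP => x xS xi.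
  rewrite (@card_pred1 _ _ x) ?(@card_pred1 _ _ i) //.
  - rewrite iC /almost_coloured !inE iC0 orbT cU //= cS.
    apply/eqP/setP => j; rewrite !inE; have [->|//] := eqVneq j i.
    by rewrite andbT; apply/esym; apply: contraNneq iC => ->.
  - move=> j /and4P[jC _ _ /eqP E].
    have : j \in c @: S.
      by rewrite E !inE eqxx andbT /=; apply: contraNneq jC => ->.
    by rewrite cS !inE (negPf jC) andbF orbF => /eqP.
  - rewrite xS /almost_coloured iC0 cD //=.
    rewrite -(setU1K iC1) -cS (imsetU1D xS) -xi setU1K ?eqxx //.
    apply/negP => /imsetP[y]; rewrite !inE => /andP[yx yS] E.
    by move/eqP: yx; apply; apply: cinj => //; rewrite -E.
  move=> y /and4P[yS _ _ /eqP E]; apply: cinj => //.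
  apply/eqP; apply: contraT => cyx.
  suff : i \in C :\ i0 by rewrite (negPf iC1).
  by rewrite -E xi imset_f // !inE xS andbT; apply: contra cyx => /eqP ->.
rewrite !card_pred0 ?(negPf cSN) // => [i|x]; apply/negP.
  move=> /and4P[iC iC0 _ /eqP E].
  have [ii|ii] := eqVneq i i0.
    by move/eqP: cSN; apply; rewrite E ii setU1K // -ii.
  move/negP: ncS'; apply; apply/exists_inP; exists i; first by rewrite inE.
  move: iC0; rewrite !inE eq_sym (negPf ii) /= => ->; rewrite E; apply/eqP/setP => j.
  by rewrite !inE; have [->|//] := eqVneq j i; rewrite ii.
move=> /and4P[xS iC _ /eqP E]; have := imsetU1D xS; rewrite E => cS.
have [cx|cx] := eqVneq (c x) i0.
  by move/eqP: cSN; apply; rewrite cS cx setD1K.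
have [cxC|cxC] := boolP (c x \in C).
  move/negP: ncS; apply; rewrite iC cS; apply/eqP/setP => j; rewrite !inE.
  by have [->|//] := eqVneq j (c x); rewrite cx cxC.
by move/negP: ncS'; apply; apply/exists_inP; exists (c x); rewrite ?inE // iC cS /=.
Qed.

Lemma sum_toggle (T : finType) (x : T) (F : {set T} -> {set T} -> nat) :
  \sum_(B : {set T} | x \notin B) F B (x |: B) = \sum_(B : {set T} | x \in B) F (B :\ x) B.
Proof.
rewrite (reindex_onto (fun B => B :\ x) (fun B => x |: B)) => [|B xS]; last exact: setU1K.
apply: eq_big => [B|B /andP[_ /eqP ->]//].
rewrite !inE eqxx /=; apply/eqP/idP => [<-|]; last exact: setD1K.
by rewrite !inE eqxx.
Qed.

Lemma card_sum (T : finType) (P : pred T) : #|[set x | P x]| = \sum_x P x.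
Proof. by rewrite -sum1_card big_mkcond; apply: eq_bigr => x _; rewrite inE; case: (P x). Qed.

(** Both sides count adjacent pairs of a door and a room. By [dominantS] a dominant room makes its
    doors dominant, so in each incidence only the dominance of the room has to be recorded. *)
Lemma double_counting :
  \sum_(S : {set V}) \sum_(C : {set I}) (almost_coloured S C && dominant S C) *
     (#|[set x | (x \notin S) && dominant (x |: S) C]| +
      #|[set i | (i \in C) && dominant S (C :\ i)]|) =
  \sum_(S : {set V}) \sum_(C : {set I}) ((#|S| == #|C|) && dominant S C) *
     (#|[set x | (x \in S) && almost_coloured (S :\ x) C]| +
      #|[set i | (i \notin C) && almost_coloured S (i |: C)]|).
Proof.
under eq_bigr do under eq_bigr do rewrite mulnDr !card_sum !big_distrr /=.
under [RHS]eq_bigr do under eq_bigr do rewrite mulnDr !card_sum !big_distrr /=.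
under eq_bigr do rewrite big_split /=.
under [RHS]eq_bigr do rewrite big_split /=.
rewrite !big_split /=; congr (_ + _).
  rewrite exchange_big [RHS]exchange_big; apply: eq_bigr => C _.
  rewrite exchange_big [RHS]exchange_big; apply: eq_bigr => x _.
  transitivity (\sum_(S : {set V} | x \notin S)
     (almost_coloured S C && dominant (x |: S) C : nat)).
    rewrite [RHS]big_mkcond; apply: eq_bigr => S _; case xS: (x \in S) => /=.
      by rewrite muln0.
    rewrite mulnb -andbA; congr (nat_of_bool (_ && _)); apply: andb_idl.
    by apply: dominantS => //; exact: subsetUr.
  rewrite (sum_toggle x (fun S S' => almost_coloured S C && dominant S' C : nat)).
  rewrite [LHS]big_mkcond; apply: eq_bigr => S _; case xS: (x \in S) => /=; last first.
    by rewrite muln0.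
  rewrite mulnb; case aS : (almost_coloured _ _); last by rewrite andbF.
  have /and3P[_ /eqP -> _] := aS; rewrite andbT [in RHS](cardsD1 x S) xS eqxx.
  by [].
apply: eq_bigr => S _; rewrite exchange_big [RHS]exchange_big; apply: eq_bigr => i _.
transitivity (\sum_(C : {set I} | i \in C)
   (almost_coloured S C && dominant S (C :\ i) : nat)).
  rewrite [RHS]big_mkcond; apply: eq_bigr => C _; case iC: (i \in C) => /=; last first.
    by rewrite muln0.
  rewrite mulnb -andbA; congr (nat_of_bool (_ && _)); apply: andb_idl.
  by apply: dominantS => //; exact: subD1set.
rewrite -(sum_toggle i (fun C C' => almost_coloured S C' && dominant S C : nat)).
rewrite [LHS]big_mkcond; apply: eq_bigr => C _; case iC: (i \in C) => /=.
  by rewrite muln0.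
rewrite mulnb; case aS : (almost_coloured _ _); last by rewrite andbF.
have /and3P[_ + _] := aS; rewrite cardsU1 iC eqSS eq_sym => ->.
by rewrite andbT.
Qed.

(* Scarf's lemma: mod 2, the incidences between doors and rooms are counted by
   the unique door [(set0, [set i0])] on one side, by the rooms with
   [c @: S = C] on the other. *)
Theorem coloured_room : exists S C, dominant S C /\ c @: S = C.
Proof.
case: (pickP (fun SC : {set V} * {set I} => dominant SC.1 SC.2 && (c @: SC.1 == SC.2))).
  by move=> [S C] /andP[d /eqP cS]; exists S, C.
move=> no.
have noSC S C : dominant S C -> (c @: S == C) = false.
  by move=> d; have := no (S, C); rewrite /= d.
have /(congr1 odd) := double_counting.
rewrite !(big_morph odd oddD (erefl (odd 0))) [RHS]big1 => [|S _]; last first.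
  rewrite (big_morph odd oddD (erefl (odd 0))); apply: big1 => C _.
  have [/andP[/eqP SC d]|_] := boolP ((#|S| == #|C|) && dominant S C) => //.
  by rewrite mul1n room_doors // noSC.
have d0 : dominant set0 [set i0].
  by apply/dominantP => y; exists i0 => [|x]; rewrite inE.
rewrite (bigD1 set0) //= [X in _ (+) X]big1 => [|S S0]; last first.
  rewrite (big_morph odd oddD (erefl (odd 0))); apply: big1 => C _.
  have [/andP[/and3P[_ /eqP cC _] d]|_] := boolP (almost_coloured S C && dominant S C) => //.
  by rewrite mul1n door_rooms.
rewrite addbF (big_morph odd oddD (erefl (odd 0))) (bigD1 [set i0]) //=.
rewrite [X in _ (+) X]big1 => [|C Ci]; last first.
  have [/andP[/and3P[iC /eqP cC _] d]|_] := boolP (almost_coloured set0 C && dominant set0 C) => //.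
  move: cC; rewrite cards0 => /eqP/cards1P[j jC]; move: iC Ci.
  by rewrite jC inE => /eqP ->; rewrite eqxx.
have -> : almost_coloured set0 [set i0].
  by rewrite /almost_coloured inE cards1 cards0 imset0 setDv !eqxx.
rewrite d0 addbF mul1n.
case: (arg_maxnP (r i0) (erefl true : xpredT v0)) => x _ xmax.
(* The only room next to this door is obtained by adding the [r i0]-maximal point [x], so the left
   side is odd. *)
rewrite (@card_pred1 _ _ x).
- rewrite card_pred0 // => i; apply/negP => /andP[]; rewrite inE => /eqP ->.
  by rewrite setDv => /dominantP/(_ v0)[j]; rewrite inE.
- rewrite inE; apply/dominantP => y; exists i0 => [|z]; first by rewrite inE.
  by rewrite !inE orbF => /eqP ->; apply: xmax.
- move=> y /andP[_ /dominantP/(_ x)[i]]; rewrite inE => /eqP -> /(_ y).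
  rewrite !inE eqxx => /(_ isT) h; apply: (@rI i0); apply/eqP.
  by rewrite eqn_leq h andbT; apply: xmax.
Qed.

End Colour.
End Scarf.

(** * Scarf's lemma for the grid points of a simplex *)

Section Grid.
Variables (I : finType) (p : nat).

Definition grid := {f : {ffun I -> 'I_p.+1} | \sum_i f i == p :> nat}.
Implicit Types x y z : grid.
Definition grid_coord (x : grid) (i : I) : nat := val x i.
(** The order by the [i]-th coordinate, with ties broken by enumeration: the factor exceeds every
    [enum_rank], so coordinates are compared first and the ranks are injective. *)
Definition grid_rank (i : I) (x : grid) := grid_coord x i * #|{: grid}| + enum_rank x.

Lemma sum_grid x : \sum_i grid_coord x i = p.
Proof. exact/eqP/(svalP x). Qed.

Lemma grid_rank_inj i : injective (grid_rank i).
Proof.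
move=> x y /(congr1 (modn^~ #|{: grid}|)); rewrite !modnMDl !modn_small //.
by move/ord_inj/enum_rank_inj.
Qed.

Lemma grid_rank_le i x y : grid_rank i x <= grid_rank i y -> grid_coord x i <= grid_coord y i.
Proof.
have K0 : 0 < #|{: grid}| by apply/card_gt0P; exists x.
by move=> /(leq_div2r #|{: grid}|); rewrite !divnMDl // !divn_small ?addn0.
Qed.

Lemma grid_make (f : I -> nat) : \sum_i f i = p -> exists x, grid_coord x =1 f.
Proof.
move=> fp; have fle i : f i < p.+1 by rewrite ltnS -fp (bigD1 i) //= leq_addr.
have sf : \sum_i [ffun i => Ordinal (fle i)] i == p :> nat.
  by rewrite -[X in _ == X]fp; apply/eqP; apply: eq_bigr => i _; rewrite ffunE.
by exists (Sub [ffun i => Ordinal (fle i)] sf : grid) => i; rewrite /grid_coord /= ffunE.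
Qed.

(** In a room [(S, C)] with [c @: S = C], the minima over [S] of the coordinates in [C] add up to
    almost [p]. The slack is below [#|C|], so all points of [S] agree up to [#|I|] in each
    coordinate, their coordinates outside [C] are small, and every colour of [C] occurs among
    them. *)
Theorem coloured_grid (i0 : I) (c : grid -> I) : exists x, forall l,
  grid_coord x l <= #|I| \/ exists2 y, c y = l &
    forall i, grid_coord y i <= grid_coord x i + #|I| /\ grid_coord x i <= grid_coord y i + #|I|.
Proof.
have [v0 _] : exists x, grid_coord x =1 (fun i => (i == i0) * p).
  by apply: grid_make; rewrite (bigD1 i0) //= eqxx mul1n big1 ?addn0 // => i /negPf->.
have [S [C [/dominantP d cS]]] := coloured_room grid_rank_inj v0 c i0.
have [i1 iC _] := d v0.
have S0 : S != set0 by apply: contraTneq iC => S0; rewrite -cS S0 imset0 inE.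
pose m i := grid_coord (lowest grid_rank v0 S i) i.
have mle i x : x \in S -> m i <= grid_coord x i.
  by move=> xS; apply: grid_rank_le; case: (lowestP grid_rank v0 i S0) => _; apply.
(* Otherwise some grid point exceeds every minimum [m i] with [i] in [C], against dominance; the
   mass left over is put on coordinate [i1]. *)
have pm : p < \sum_(i in C) (m i).+1.
  rewrite ltnNge; apply/negP => mp.
  pose f i := if i \in C then (m i).+1 + (i == i1) * (p - \sum_(i in C) (m i).+1) else 0.
  have [y yf] : exists y, grid_coord y =1 f.
    apply: grid_make; rewrite -big_mkcond big_split /= [X in _ + X](bigD1 i1 iC) /= eqxx mul1n.
    rewrite [X in _ + (_ + X)]big1 ?addn0 => [|i /andP[_ /negPf->]//].
    by rewrite subnKC.
  have [i iC' /(_ (lowest grid_rank v0 S i))] := d y.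
  case: (lowestP grid_rank v0 i S0) => lS _ /(_ lS)/grid_rank_le.
  by rewrite yf /f iC' -/(m i) addSn ltnNge leq_addr.
have CI : #|C| <= #|I| := max_card _.
have smC x : x \in S -> \sum_(i in C) m i <= \sum_(i in C) grid_coord x i.
  by move=> xS; apply: leq_sum => i _; exact: mle.
have sC x : \sum_(i in C) grid_coord x i + \sum_(i in ~: C) grid_coord x i = p.
  rewrite -[RHS](sum_grid x) [RHS](bigID (mem C)) /=; congr (_ + _).
  by apply: eq_bigl => i; rewrite inE.
have pm' : p < \sum_(i in C) m i + #|C|.
  by move: pm; under eq_bigr do rewrite -addn1; rewrite big_split /= sum1_card.
have inC x i : x \in S -> i \in C -> grid_coord x i < m i + #|C|.
  move=> xS iC'; move: pm' (sC x); rewrite !(bigD1 i iC') /=.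
  have : \sum_(j in C | j != i) m j <= \sum_(j in C | j != i) grid_coord x j.
    by apply: leq_sum => j _; exact: mle.
  have ar a b e g k q : a <= b -> p < q + a + k -> g + b + e = p -> g < q + k by lia.
  exact: ar.
have outC x i : x \in S -> i \notin C -> grid_coord x i < #|C|.
  move=> xS iC'; move: pm' (smC x xS) (sC x).
  rewrite [X in _ + X = _](bigD1 i) ?inE //=.
  have ar a b e g k : p < a + k -> a <= b -> b + (g + e) = p -> g < k by lia.
  exact: ar.
have /set0Pn[x xS] := S0.
exists x => l; have [lC|lC] := boolP (l \in C); last by left; have := outC x l xS lC; lia.
right; move: (lC); rewrite -cS => /imsetP[y yS ->]; exists y => // i.
have [iC'|iC'] := boolP (i \in C).
  have := inC x i xS iC'; have := inC y i yS iC'; have := mle i x xS; have := mle i y yS; lia.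
have := outC x i xS iC'; have := outC y i yS iC'; lia.
Qed.

End Grid.

From HB Require Import structures.
From mathcomp Require Import all_order all_algebra complex ring lra.
From mathcomp Require Import all_classical all_reals all_analysis.

Import Order.TTheory GRing.Theory Num.Theory.
Import numFieldNormedType.Exports.

Local Open Scope classical_set_scope.
Local Open Scope complex_scope.
Local Open Scope ring_scope.

(** * Inner products *)

Section RealNorm.
Variables (R : realType) (V : normedModType R[i]).
Implicit Types (x y : V) (c : R[i]).

(** Norms over [R[i]] take values in [R[i]]; this real-valued version gives access to the total
    order and to [lra] and [nra]. *)
Definition nrm (W : normedZmodType R[i]) (x : W) : R := complex.Re `|x|.

Lemma nrmE (W : normedZmodType R[i]) (x : W) : `|x| = (nrm x)%:C.
Proof. by rewrite /nrm RRe_real. Qed.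

Lemma nrm_ge0 (W : normedZmodType R[i]) (x : W) : 0 <= nrm x.
Proof. by rewrite -ler0c -nrmE. Qed.

Lemma nrmD (W : normedZmodType R[i]) (x y : W) : nrm (x + y) <= nrm x + nrm y.
Proof. by rewrite -lecR rmorphD /= -!nrmE ler_normD. Qed.

Lemma nrmN (W : normedZmodType R[i]) (x : W) : nrm (- x) = nrm x.
Proof. by rewrite /nrm normrN. Qed.

Lemma nrmB (W : normedZmodType R[i]) (x y : W) : nrm (x - y) <= nrm x + nrm y.
Proof. by rewrite -(nrmN y) nrmD. Qed.

Lemma nrmBC (W : normedZmodType R[i]) (x y : W) : nrm (x - y) = nrm (y - x).
Proof. by rewrite -nrmN opprB. Qed.

Lemma nrm_triangle (W : normedZmodType R[i]) (z x y : W) :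
  nrm (x - y) <= nrm (x - z) + nrm (z - y).
Proof. by rewrite -[x - y](subrKA z) nrmD. Qed.

Lemma nrm0 (W : normedZmodType R[i]) : nrm (0 : W) = 0.
Proof. by rewrite /nrm normr0. Qed.

Lemma nrm_eq0 (W : normedZmodType R[i]) (x : W) : (nrm x == 0) = (x == 0).
Proof. by rewrite -[in RHS]normr_eq0 nrmE eq_complex /= eqxx andbT. Qed.

Lemma nrm_gt0 (W : normedZmodType R[i]) (x : W) : (0 < nrm x) = (x != 0).
Proof. by rewrite lt_def nrm_ge0 andbT nrm_eq0. Qed.

Lemma nrmZ c x : nrm (c *: x) = nrm c * nrm x.
Proof. by apply: (@complexI R); rewrite rmorphM /= -!nrmE normrZ. Qed.

Lemma nrmM (a b : R[i]) : nrm (a * b) = nrm a * nrm b.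
Proof. by apply: (@complexI R); rewrite rmorphM /= -!nrmE normrM. Qed.

Lemma nrmC (r : R) : nrm r%:C = `|r|.
Proof. by rewrite /nrm normc_def /= expr0n /= addr0 sqrtr_sqr. Qed.

Lemma nrm_conj (a : R[i]) : nrm (Num.conj a) = nrm a.
Proof. by rewrite /nrm norm_conjC. Qed.

Lemma nrm_sum (W : normedZmodType R[i]) (I : Type) (r : seq I) (P : pred I)
    (F : I -> W) :
  nrm (\sum_(i <- r | P i) F i) <= \sum_(i <- r | P i) nrm (F i).
Proof.
elim/big_rec2: _ => [|i a b _ le_ab]; first by rewrite nrm0.
by rewrite (le_trans (nrmD _ _)) // lerD2l.
Qed.

Lemma gt0_realC (e : R[i]) : 0 < e -> exists2 r : R, 0 < r & e = r%:C.
Proof.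
move=> e0; have eR : e = (complex.Re e)%:C by rewrite RRe_real // gtr0_real.
by exists (complex.Re e); rewrite // -ltcR -eR.
Qed.

Lemma cvg_nrmP (W : normedModType R[i]) (I : Type) (F : set_system I)
   (u : I -> W) (l : W) : Filter F ->
  u @ F --> l <-> forall e : R, 0 < e -> F [set k | nrm (u k - l) < e].
Proof.
move=> FF; split=> [/cvgrPdist_lt cu e e0|cu].
  have := cu e%:C; rewrite ltcR => /(_ e0); apply: filterS => k /=.
  by rewrite distrC nrmE ltcR.
apply/cvgrPdist_lt => e e0.
have [r r0 ->] := gt0_realC e0.
by apply: filterS (cu _ r0) => k /=; rewrite distrC nrmE ltcR.
Qed.

Lemma cvgC_nrmP (I : Type) (F : set_system I) (u : I -> R[i]) (l : R[i]) :
  Filter F ->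
  u @ F --> (l : R[i]^o) <-> forall e : R, 0 < e -> F [set k | nrm (u k - l) < e].
Proof. exact: (@cvg_nrmP R[i]^o). Qed.

End RealNorm.

Lemma le_eps (R : realType) (a b : R) : (forall e : R, 0 < e -> a <= b + e) -> a <= b.
Proof. by move=> ab; apply/ler_addgt0Pr => e /ab. Qed.

Lemma archi_inv (R : realType) (e : R) : 0 < e ->
  exists N, forall n, (N <= n)%N -> n.+1%:R^-1 < e.
Proof.
move=> e0; exists (Num.truncn e^-1) => n Nn.
rewrite -[ltRHS]invrK ltf_pV2 ?posrE ?invr_gt0 //.
by apply: lt_le_trans (truncnS_gt _) _; rewrite ler_nat ltnS.
Qed.

Lemma nrm_cvg_le (R : realType) (W : normedModType R[i]) (I : Type) (F : set_system I)
    (u : I -> W) (l : W) (M : R) :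
  ProperFilter F -> u @ F --> l -> (forall k, nrm (u k) <= M) -> nrm l <= M.
Proof.
move=> FF /cvg_nrmP ul uM; apply: le_eps => e e0.
have /filter_ex [k /= uk] := ul _ e0.
rewrite -[l](subrK (u k)) (le_trans (nrmD _ _)) // addrC nrmBC.
by apply: lerD => //; exact: ltW.
Qed.

Section Inner.
Variables (R : realType) (H : completeNormedModType R[i]).
Variable dot : {dot H for Num.conj}.
Hypothesis dotN : induces_norm dot.
Implicit Types (x y z : H) (c : R[i]).

Lemma dotC x y : dot x y = Num.conj (dot y x).
Proof. by rewrite hermC /= expr0 mul1r. Qed.

Lemma dotDl x y z : dot (x + y) z = dot x z + dot y z.
Proof. exact: linearDl. Qed.
Lemma dotDr x y z : dot z (x + y) = dot z x + dot z y.
Proof. exact: linearDr. Qed.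
Lemma dotNl x z : dot (- x) z = - dot x z.
Proof. exact: linearNl. Qed.
Lemma dotNr x z : dot z (- x) = - dot z x.
Proof. exact: linearNr. Qed.
Lemma dotBl x y z : dot (x - y) z = dot x z - dot y z.
Proof. exact: linearBl. Qed.
Lemma dotBr x y z : dot z (x - y) = dot z x - dot z y.
Proof. exact: linearBr. Qed.
Lemma dotZl c x z : dot (c *: x) z = c * dot x z.
Proof. exact: linearZl_LR. Qed.
Lemma dotZr c x z : dot z (c *: x) = Num.conj c * dot z x.
Proof. exact: linearZr_LR. Qed.
Lemma dot0l x : dot 0 x = 0.
Proof. exact: linear0l. Qed.
Lemma dot0r x : dot x 0 = 0.
Proof. exact: linear0r. Qed.
Lemma dot_suml (I : Type) (r : seq I) (P : pred I) (F : I -> H) z :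
  dot (\sum_(i <- r | P i) F i) z = \sum_(i <- r | P i) dot (F i) z.
Proof. exact: linear_sumlz. Qed.
Lemma dot_sumr (I : Type) (r : seq I) (P : pred I) (F : I -> H) z :
  dot z (\sum_(i <- r | P i) F i) = \sum_(i <- r | P i) dot z (F i).
Proof. exact: linear_sumr. Qed.

Lemma dotxx x : dot x x = (nrm x ^+ 2)%:C.
Proof. by rewrite dotN nrmE rmorphXn. Qed.

Lemma dotxx_eq0 x : dot x x = 0 -> x = 0.
Proof.
rewrite dotxx => /(congr1 (@complex.Re R)) /= /eqP.
by rewrite sqrf_eq0 nrm_eq0 => /eqP.
Qed.

Lemma dot_inj x y : (forall z, dot x z = dot y z) -> x = y.
Proof.
move=> xy; apply/eqP; rewrite -subr_eq0; apply/eqP/dotxx_eq0.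
by rewrite dotBl xy subrr.
Qed.

Lemma dot_injr x y : (forall z, dot z x = dot z y) -> x = y.
Proof. by move=> xy; apply: dot_inj => z; rewrite dotC xy -dotC. Qed.

Lemma ReJ (a : R[i]) : complex.Re (Num.conj a) = complex.Re a.
Proof. by case: a. Qed.

Lemma ReD (a b : R[i]) : complex.Re (a + b) = complex.Re a + complex.Re b.
Proof. by case: a; case: b. Qed.

Lemma ReN (a : R[i]) : complex.Re (- a) = - complex.Re a.
Proof. by case: a. Qed.

Lemma nrmD2 x y :
  nrm (x + y) ^+ 2 = nrm x ^+ 2 + nrm y ^+ 2 + complex.Re (dot x y) *+ 2.
Proof.
have nE z : nrm z ^+ 2 = complex.Re (dot z z) by rewrite dotxx.
rewrite !nE dotDl !dotDr !ReD (dotC y x) ReJ; ring.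
Qed.

Lemma nrmB2 x y :
  nrm (x - y) ^+ 2 = nrm x ^+ 2 + nrm y ^+ 2 - complex.Re (dot x y) *+ 2.
Proof. by rewrite nrmD2 dotNr nrmN ReN mulNrn. Qed.

Lemma parallelogram x y :
  nrm (x + y) ^+ 2 + nrm (x - y) ^+ 2 = (nrm x ^+ 2 + nrm y ^+ 2) *+ 2.
Proof. by rewrite nrmD2 nrmB2 !mulr2n; ring. Qed.

Lemma pythagoras x y : dot x y = 0 -> nrm (x + y) ^+ 2 = nrm x ^+ 2 + nrm y ^+ 2.
Proof. by move=> xy; rewrite nrmD2 xy mul0rn addr0. Qed.

Lemma cauchy_schwarz x y : nrm (dot x y) <= nrm x * nrm y.
Proof.
have [->|y0] := eqVneq y 0; first by rewrite dot0r !nrm0 mulr0.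
pose a := dot x y / dot y y.
have yy0 : dot y y != 0 by apply/eqP => /dotxx_eq0/eqP; apply/negP.
have xay : dot (x - a *: y) (a *: y) = 0.
  by rewrite dotZr dotBl dotZl /a divfK // subrr mulr0.
have := pythagoras xay; rewrite subrK => xE.
have : nrm (a *: y) ^+ 2 <= nrm x ^+ 2 by rewrite xE lerDr sqr_ge0.
rewrite ler_pXn2r ?nnegrE ?nrm_ge0 // nrmZ /a nrmM.
have y1 : 0 < nrm y by rewrite nrm_gt0.
have -> : nrm (dot y y)^-1 = (nrm y ^+ 2)^-1.
  by rewrite dotxx -fmorphV nrmC ger0_norm // invr_ge0 sqr_ge0.
by rewrite expr2 invfM mulrA mulrVK ?unitfE ?gt_eqF // ler_pdivrMr.
Qed.

End Inner.

(** * Orthogonal projection *)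

Section Projection.
Variables (R : realType) (H : completeNormedModType R[i]).
Variable dot : {dot H for Num.conj}.
Hypothesis dotN : induces_norm dot.
Implicit Types (x y z : H) (c : R[i]) (L : set H) (T : H -> H).

Definition subspace_set L :=
  L 0 /\ forall (c : R[i]) x y, L x -> L y -> L (c *: x + y).

Definition nclosure L : set H :=
  [set x | forall e : R, 0 < e -> exists2 z, L z & nrm (x - z) < e].

Lemma dense_nclosure (D : set H) : dense D -> forall x, nclosure D x.
Proof.
move=> dD x e e0.
have [|z [Dz zD]] := dD (ball x e%:C) _ (ball_open x e%:C).
  by exists x; apply: ballxx; rewrite ltcR.
exists z => //; move: Dz; rewrite -ball_normE /= nrmE ltcR.
by [].
Qed.

Lemma cauchy_complete (u : nat -> H) :
  (forall e : R, 0 < e -> exists N, forall m n, (N <= m)%N -> (N <= n)%N ->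
     nrm (u m - u n) < e) -> exists l : H, u @ \oo --> l.
Proof.
move=> uc; suff : cvg (u @ \oo) by move=> /cvg_ex[l ul]; exists l.
apply/cauchy_cvgP/cauchy_exP => e e0.
have [r r0 ->] := gt0_realC e0; have [N uN] := uc _ r0.
exists (u N); exists N => // n /= Nn.
by rewrite -ball_normE /= nrmE ltcR uN.
Qed.

Lemma min_orth L x p : subspace_set L -> L p ->
  (forall z, L z -> nrm (x - p) <= nrm (x - z)) ->
  forall z, L z -> dot (x - p) z = 0.
Proof.
move=> [L0 Llin] Lp pmin z Lz.
have [->|z0] := eqVneq z 0; first exact: dot0r.
pose a := dot (x - p) z / dot z z.
have zz0 : dot z z != 0 by apply/eqP => /(dotxx_eq0 dotN)/eqP; apply/negP.
have o : dot (x - p - a *: z) (a *: z) = 0.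
  by rewrite dotZr dotBl dotZl /a divfK // subrr mulr0.
have := pythagoras dotN o; rewrite subrK => pE.
have : nrm (x - p) <= nrm (x - p - a *: z).
  by rewrite -addrA -opprD addrC -[p + _]addrC; rewrite addrC; apply: pmin; exact: Llin.
rewrite -(@ler_pXn2r _ 2) ?nnegrE ?nrm_ge0 // pE gerDl => az0.
have /eqP : nrm (a *: z) ^+ 2 = 0 by apply/eqP; rewrite eq_le az0 sqr_ge0.
rewrite sqrf_eq0 nrm_eq0 scaler_eq0 (negPf z0) orbF mulf_eq0 invr_eq0.
by rewrite (negPf zz0) orbF => /eqP.
Qed.

Lemma projection_exists L x : subspace_set L -> nclosure L `<=` L ->
  exists2 p, L p & forall z, L z -> dot (x - p) z = 0.
Proof.
move=> sL cL; have [L0 Llin] := sL.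
pose E := [set nrm (x - z) | z in L].
have E0 : E !=set0 by exists (nrm (x - 0)); exists 0.
have lbE : has_lbound E by exists 0 => _ [z _ <-]; exact: nrm_ge0.
have hE : has_inf E by split.
pose d := inf E.
have dle z : L z -> d <= nrm (x - z) by move=> Lz; apply: ge_inf => //; exists z.
have d0 : 0 <= d by apply: lb_le_inf => // _ [z _ <-]; exact: nrm_ge0.
have exz n : exists z, L z /\ nrm (x - z) < d + n.+1%:R^-1.
  have [_ [z Lz <-] zd] := @inf_adherent _ E n.+1%:R^-1 (ltac:(by rewrite invr_gt0)) hE.
  by exists z.
have [u uP] := boolp.choice exz.
have uL n := (uP n).1; have ud n := (uP n).2.
have par m n : nrm (u m - u n) ^+ 2 <=
    (nrm (x - u m) ^+ 2 + nrm (x - u n) ^+ 2) *+ 2 - 4 * d ^+ 2.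
  have := parallelogram dotN (x - u n) (x - u m).
  have -> : x - u n - (x - u m) = u m - u n by rewrite opprB addrC addrA subrK.
  have -> : x - u n + (x - u m) = (2 : R[i]) *: (x - 2^-1 *: (u n + u m)).
    rewrite scalerBr scalerA mulfV ?pnatr_eq0 // scale1r scaler_nat mulr2n.
    by rewrite opprD !addrA; congr (_ - _); rewrite addrAC.
  have Lmid : L (2^-1 *: (u n + u m)).
    rewrite -[_ *: _]addr0; apply: (Llin) => //.
    by rewrite -[u n]scale1r; exact: Llin.
  have := dle _ Lmid; set w := nrm (x - _) => dw.
  have n2 : nrm (2 : R[i]) = 2.
    by rewrite -[2 : R[i]](rmorph_nat (real_complex R)) nrmC ger0_norm.
  rewrite nrmZ n2 -/w exprMn => pE.
  have dw2 : d ^+ 2 <= w ^+ 2 by rewrite ler_pXn2r // ?nnegrE ?nrm_ge0.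
  move: pE; rewrite !mulr2n => pE; lra.
have [p up] : exists p : H, u @ \oo --> p.
  apply: cauchy_complete => e e0.
  have e20 : 0 < e ^+ 2 by rewrite exprn_gt0.
  have [N NP] := @archi_inv R (e ^+ 2 / 4 / (2 * d + 1)) (ltac:(by rewrite !divr_gt0 //; lra)).
  exists N => m n Nm Nn.
  have small k : (N <= k)%N -> nrm (x - u k) ^+ 2 < d ^+ 2 + e ^+ 2 / 4.
    move=> /NP; have := ud k.
    set b := nrm _; set t := _^-1 => bd; rewrite ltr_pdivlMr; last by lra.
    have b0 : 0 <= b by exact: nrm_ge0.
    have t0 : 0 < t by rewrite invr_gt0.
    have t1 : t <= 1 by rewrite invf_le1 // ler1n.
    have : b ^+ 2 < (d + t) ^+ 2 by rewrite ltr_pXn2r // nnegrE addr_ge0 // ltW.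
    nra.
  have := par m n; have := small m Nm; have := small n Nn => sn sm le.
  have : nrm (u m - u n) ^+ 2 < e ^+ 2 by lra.
  by rewrite ltr_pXn2r // nnegrE ?nrm_ge0 // ltW.
have Lp : L p.
  apply: cL => e e0; have /cvg_nrmP/(_ e e0) [N _ uN] := up.
  by exists (u N) => //; rewrite nrmBC; apply: uN => /=.
exists p => //; apply: min_orth => // z Lz.
apply: le_trans (dle _ Lz).
apply: le_eps => e e0.
have e20 : 0 < e / 2 by rewrite divr_gt0.
have /cvg_nrmP/(_ _ e20) [N _ uN] := up.
have [N' N'P] := archi_inv e20; pose n := maxn N N'.
have un : nrm (u n - p) < e / 2 by apply: uN; rewrite /= leq_maxl.
have nt : n.+1%:R^-1 < e / 2 by apply: N'P; rewrite leq_maxr.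
move: un nt (ud n) (nrm_triangle (u n) x p); clearbody n; set a := n.+1%:R^-1; lra.
Qed.

End Projection.

(** * Bounded operators and adjoints *)

Section Operators.
Variables (R : realType) (H : completeNormedModType R[i]).
Variable dot : {dot H for Num.conj}.
Hypothesis dotN : induces_norm dot.
Implicit Types (x y z : H) (c : R[i]) (L : set H) (T : H -> H).

Definition opbound T (M : R) := forall x, nrm (T x) <= M * nrm x.

Lemma bounded_operatorP T : bounded_operator T <->
  linear T /\ exists2 M : R, 0 <= M & opbound T M.
Proof.
split=> [[lT [M TM]]|[lT [M M0 TM]]]; split=> //; last first.
  by exists M%:C => x; rewrite !nrmE -rmorphM lecR.
exists `|complex.Re M| => // x; have := TM x.
rewrite !nrmE lecE => /andP[_].
case: (M) => a b /=; rewrite mulr0 subr0 => /le_trans -> //.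
by rewrite ler_wpM2r ?nrm_ge0 ?ler_norm.
Qed.

Lemma bounded_operatorI T M : linear T -> 0 <= M -> opbound T M -> bounded_operator T.
Proof. by move=> lT M0 TM; apply/bounded_operatorP; split => //; exists M. Qed.

Lemma lin0 T : linear T -> T 0 = 0.
Proof. by move=> lT; have := lT (-1) 0 0; rewrite !scaleN1r !addNr. Qed.

Lemma linDf T : linear T -> {morph T : x y / x + y}.
Proof. by move=> lT x y; have := lT 1 x y; rewrite !scale1r. Qed.

Lemma linZf T : linear T -> forall c, {morph T : x / c *: x}.
Proof. by move=> lT c x; have := lT c x 0; rewrite !addr0 (lin0 lT) addr0. Qed.

Lemma linBf T : linear T -> {morph T : x y / x - y}.
Proof. by move=> lT x y; rewrite -scaleN1r (linDf lT) (linZf lT) scaleN1r. Qed.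

Lemma linsumf T (I : Type) (r : seq I) (P : pred I) (f : I -> H) : linear T ->
  T (\sum_(i <- r | P i) f i) = \sum_(i <- r | P i) T (f i).
Proof.
by move=> lT; apply: (big_morph T); [exact: linDf|exact: lin0].
Qed.

Lemma lin_comp T1 T2 : linear T1 -> linear T2 -> linear (T1 \o T2).
Proof. by move=> l1 l2 c x y /=; rewrite l2 l1. Qed.

Lemma opbound_comp T1 T2 M1 M2 : 0 <= M1 -> opbound T1 M1 -> opbound T2 M2 ->
  opbound (T1 \o T2) (M1 * M2).
Proof.
move=> M10 b1 b2 x /=; rewrite (le_trans (b1 _)) // -mulrA.
by rewrite ler_wpM2l.
Qed.

Theorem riesz (f : H -> R[i]) (M : R) :
  (forall c x y, f (c *: x + y) = c * f x + f y) ->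
  (forall x, nrm (f x) <= M * nrm x) ->
  exists w, forall x, f x = dot x w.
Proof.
move=> flin fM.
have f0 : f 0 = 0.
  by have := flin (-1) 0 0; rewrite scaleN1r mulN1r !addNr.
have fB x y : f (x - y) = f x - f y.
  by rewrite [x - y]addrC -(scaleN1r y) flin mulN1r addrC.
have fZ c x : f (c *: x) = c * f x by rewrite -[c *: x]addr0 flin f0 addr0.
have [fz|] := pselect (forall x, f x = 0).
  by exists 0 => x; rewrite dot0r fz.
move=> /existsNP[x0 /eqP fx0].
pose L := [set x | f x = 0].
have sL : subspace_set L.
  by split=> // c x y; rewrite /L /= => fx fy; rewrite flin fx fy mulr0 addr0.
have cL : nclosure L `<=` L.
  move=> x xL /=; apply/eqP; rewrite -nrm_eq0; apply/eqP/le_anti.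
  rewrite nrm_ge0 andbT; apply: le_eps => e e0; rewrite add0r.
  have M1 : 0 < `|M| + 1 by rewrite ltr_wpDl.
  have [z /= fz xz] := xL (e / (`|M| + 1)) (divr_gt0 e0 M1).
  have -> : f x = f (x - z) by rewrite fB fz subr0.
  rewrite (le_trans (fM _)) //.
  have : M * nrm (x - z) <= (`|M| + 1) * nrm (x - z).
    by rewrite ler_wpM2r ?nrm_ge0 // (le_trans (ler_norm M)) // lerDl.
  move=> /le_trans -> //; rewrite ltW // mulrC -ltr_pdivlMr //.
have [p Lp px] := projection_exists dotN x0 sL cL.
pose n := x0 - p.
have fn : f n = f x0 by rewrite /n fB Lp subr0.
have n0 : n != 0 by apply: contra fx0 => /eqP n0; rewrite -fn n0 f0.
have nn0 : dot n n != 0 by apply/eqP => /(dotxx_eq0 dotN)/eqP; apply/negP.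
exists ((Num.conj (f n / dot n n)) *: n) => x.
rewrite dotZr conjCK.
have : dot (x - (f x / f n) *: n) n = 0.
  rewrite dotC px ?rmorph0 // /L /= fB fZ divfK ?subrr //.
  by rewrite fn.
rewrite dotBl dotZl => /eqP; rewrite subr_eq0 => /eqP ->.
by field; rewrite nn0 fn fx0.
Qed.

Lemma form_operator (b : H -> H -> R[i]) (M : R) : 0 <= M ->
  (forall c x x' y, b (c *: x + x') y = c * b x y + b x' y) ->
  (forall c x y y', b x (c *: y + y') = Num.conj c * b x y + b x y') ->
  (forall x y, nrm (b x y) <= M * nrm x * nrm y) ->
  exists T, [/\ linear T, opbound T M & forall x y, b x y = dot (T x) y].
Proof.
move=> M0 bl br bM.
have exw x : exists w, forall y, b x y = dot w y.
  have [||w wE] := @riesz (fun y => Num.conj (b x y)) (M * nrm x).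
  - by move=> c y y'; rewrite br rmorphD rmorphM /= conjCK.
  - by move=> y; rewrite nrm_conj.
  by exists w => y; rewrite dotC -wE conjCK.
have [T TE] := boolp.choice exw.
exists T; split; last by move=> x y; exact: TE.
  move=> c x y; apply: (dot_inj dotN) => z.
  by rewrite dotDl dotZl -!TE bl.
move=> x; have [->|Tx0] := eqVneq (T x) 0.
  by rewrite nrm0 mulr_ge0 ?nrm_ge0.
rewrite -(ler_pM2r (x := nrm (T x))) ?nrm_gt0 // -expr2.
apply: le_trans (bM _ _); rewrite TE dotxx // nrmC ger0_norm ?sqr_ge0 //.
Qed.

Lemma adjoint_exists T M : linear T -> 0 <= M -> opbound T M ->
  exists T', [/\ linear T', opbound T' M & is_adjoint dot T T'].
Proof.
move=> lT M0 TM.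
have [||x y|T' [lT' T'M T'E]] := @form_operator (fun x y => dot x (T y)) M M0.
- by move=> c x x' y; rewrite dotDl dotZl.
- by move=> c x y y'; rewrite lT dotDr dotZr.
- rewrite (le_trans (cauchy_schwarz dotN _ _)) // mulrC mulrAC.
  by rewrite ler_wpM2r ?nrm_ge0.
by exists T'; split=> // x y; rewrite dotC T'E -dotC.
Qed.

Lemma adjoint_linear T T' : is_adjoint dot T T' -> linear T'.
Proof.
move=> a c x y; apply: (dot_injr dotN) => z.
by rewrite -a !dotDr !dotZr -!a.
Qed.

(** Expanding the square turns a lower bound on an inner product into closeness in norm. *)
Lemma contraction_fixed T x : opbound T 1 ->
  nrm (T x - x) ^+ 2 <= (nrm x ^+ 2 - complex.Re (dot (T x) x)) *+ 2.
Proof.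
move=> /(_ x); rewrite mul1r => Tx; rewrite (nrmB2 dotN).
have : nrm (T x) ^+ 2 <= nrm x ^+ 2 by rewrite ler_pXn2r ?nnegrE ?nrm_ge0.
rewrite !mulr2n; lra.
Qed.

End Operators.

(** * Ultralimits *)

Section UltraLimits.
Variables (R : realType) (I : Type) (F : set_system I).
Hypothesis FU : UltraFilter F.
Let FP : ProperFilter F := ultra_proper.
Local Existing Instance FP.

(** The limit is the supremum of the numbers that are below [u] on a set of [F]; the ultrafilter
    decides about every number above it. *)
Lemma ultra_lim_real (u : I -> R) (M : R) : (forall k, `|u k| <= M) ->
  exists l, forall e, 0 < e -> F [set k | `|u k - l| < e].
Proof.
move=> uM.
pose S := [set r | F [set k | r <= u k]].
have FT (P : set I) : (forall k, P k) -> F P.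
  by move=> PT; apply: filterS filterT => k _.
have S0 : S !=set0.
  by exists (- M); apply: FT => k /=; have := uM k; rewrite ler_norml => /andP[].
have ubS : has_ubound S.
  exists M => r /filter_ex[k /= rk]; apply: le_trans rk _.
  by rewrite (le_trans (ler_norm _)).
have hS : has_sup S by split.
exists (sup S) => e e0.
have [r Sr rS] := sup_adherent e0 hS.
have nS : ~ S (sup S + e / 2).
  by move=> /(ub_le_sup ubS); rewrite gerDl leNgt divr_gt0.
have [//|Fn] := in_ultra_setVsetC [set k | sup S + e / 2 <= u k] FU.
apply: filterS (filterI Sr Fn) => k [/= rk /negP]; rewrite -ltNge => uk.
by rewrite ltr_norml; apply/andP; split; lra.
Qed.

Lemma nrm_le_ReIm (a : R[i]) : nrm a <= `|complex.Re a| + `|complex.Im a|.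
Proof.
have ni : nrm ('i%C : R[i]) = 1.
  by rewrite /nrm normc_def /= expr0n /= add0r expr1n sqrtr1.
rewrite {1}[a]complexE (le_trans (nrmD _ _)) // nrmM ni mul1r !nrmC //.
Qed.

Lemma Im_le_nrm (a : R[i]) : `|complex.Im a| <= nrm a.
Proof.
rewrite /nrm normc_def /= -[leLHS]ger0_norm ?normr_ge0 // normr_id.
by rewrite -sqrtr_sqr ler_wsqrtr // lerDr sqr_ge0.
Qed.

Lemma absRe_le_nrm (a : R[i]) : `|complex.Re a| <= nrm a.
Proof.
rewrite /nrm normc_def /= -[leLHS]ger0_norm ?normr_ge0 // normr_id.
by rewrite -sqrtr_sqr ler_wsqrtr // lerDl sqr_ge0.
Qed.

Lemma ultra_lim_complex (u : I -> R[i]) (M : R) : (forall k, nrm (u k) <= M) ->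
  exists l : R[i], u @ F --> (l : R[i]^o).
Proof.
move=> uM.
have [|a aP] := @ultra_lim_real (fun k => complex.Re (u k)) M.
  by move=> k; rewrite (le_trans (absRe_le_nrm _)).
have [|b bP] := @ultra_lim_real (fun k => complex.Im (u k)) M.
  by move=> k; rewrite (le_trans (Im_le_nrm _)).
exists (a +i* b); apply/cvgC_nrmP => e e0.
have e20 : 0 < e / 2 by rewrite divr_gt0.
apply: filterS (filterI (aP _ e20) (bP _ e20)) => k [/= ak bk].
apply: le_lt_trans (nrm_le_ReIm _) _.
by case: (u k) ak bk => c d /=; lra.
Qed.

End UltraLimits.

Lemma ucv_unique (R : realType) (I : Type) (F : set_system I) (f : I -> R[i]) (a b : R[i]) :
  ProperFilter F -> f @ F --> (a : R[i]^o) -> f @ F --> (b : R[i]^o) -> a = b.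
Proof.
move=> FF /cvgC_nrmP fa /cvgC_nrmP fb.
apply/eqP; rewrite -subr_eq0 -nrm_eq0; apply/eqP/le_anti; rewrite nrm_ge0 andbT.
apply: le_eps => e e0; rewrite add0r.
have e20 : 0 < e / 2 by rewrite divr_gt0.
have [k [/= ak bk]] := filter_ex (filterI (fa _ e20) (fb _ e20)).
have := nrm_triangle (f k) a b; rewrite (nrmBC a (f k)); lra.
Qed.

Lemma ucv_lin (R : realType) (I : Type) (F : set_system I) (f g : I -> R[i]) (c a b : R[i]) :
  Filter F -> f @ F --> (a : R[i]^o) -> g @ F --> (b : R[i]^o) ->
  (fun k => c * f k + g k) @ F --> (c * a + b : R[i]^o).
Proof.
move=> FF /cvgC_nrmP fa /cvgC_nrmP gb; apply/cvgC_nrmP => e e0.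
have c1 : 0 < nrm c + 1 by rewrite ltr_wpDl ?nrm_ge0.
have e20 : 0 < e / 2 by rewrite divr_gt0.
apply: filterS (filterI (fa _ (divr_gt0 e20 c1)) (gb _ e20)) => k [/=].
rewrite ltr_pdivlMr // => fk gk.
have -> : c * f k + g k - (c * a + b) = c * (f k - a) + (g k - b) by ring.
apply: le_lt_trans (nrmD _ _) _; rewrite nrmM [e]splitr ltrD //.
by apply: le_lt_trans fk; rewrite mulrC ler_wpM2l ?nrm_ge0 // lerDl.
Qed.

Section UltraOperators.
Variables (R : realType) (H : completeNormedModType R[i]).
Variable dot : {dot H for Num.conj}.
Hypothesis dotN : induces_norm dot.
Variables (I : Type) (F : set_system I).

Definition wot_cvg (X : I -> H -> H) (T : H -> H) :=
  forall x y, (fun k => dot (X k x) y) @ F --> (dot (T x) y : R[i]^o).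

Definition weak_cvg (u : I -> H) (x : H) :=
  forall y, (fun k => dot (u k) y) @ F --> (dot x y : R[i]^o).

Hypothesis FU : UltraFilter F.
Let FP : ProperFilter F := ultra_proper.
Local Existing Instance FP.

Lemma ucv_conj (f : I -> R[i]) (a : R[i]) : f @ F --> (a : R[i]^o) ->
  (fun k => Num.conj (f k)) @ F --> (Num.conj a : R[i]^o).
Proof.
move=> /cvgC_nrmP fa; apply/cvgC_nrmP => e /fa.
by apply: filterS => k /=; rewrite -rmorphB nrm_conj.
Qed.

Lemma ultra_weak (u : I -> H) (M : R) : (forall k, nrm (u k) <= M) ->
  exists x, weak_cvg u x.
Proof.
move=> uM.
have M0 : 0 <= M by have [k _] := @filter_ex _ _ FP _ filterT; apply: le_trans (uM k); exact: nrm_ge0.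
have bnd y k : nrm (dot (u k) y) <= M * nrm y.
  by rewrite (le_trans (cauchy_schwarz dotN _ _)) // ler_wpM2r ?nrm_ge0.
have exl y : exists l : R[i], (fun k => dot (u k) y) @ F --> (l : R[i]^o).
  exact: (ultra_lim_complex FU (bnd y)).
have [l lP] := boolp.choice exl.
have [|x|x xP] := @riesz R H dot dotN (fun y => Num.conj (l y)) M.
- move=> c y y'; rewrite -[c in RHS]conjCK -rmorphM -rmorphD /=; congr (Num.conj _).
  apply: (ucv_unique FP (lP _)).
  under eq_fun do rewrite dotDr dotZr.
  exact: (ucv_lin _ (lP _) (lP _)).
- rewrite nrm_conj; apply: (@nrm_cvg_le R R[i]^o) (lP x) (bnd x).
exists x => y; rewrite dotC -xP conjCK; exact: lP.
Qed.

Lemma weak_nrm_le (u : I -> H) (x : H) (M : R) : weak_cvg u x ->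
  F [set k | nrm (u k) <= M] -> nrm x <= M.
Proof.
move=> ux uM.
have [->|x0] := eqVneq x 0.
  by have [k /= uk] := filter_ex uM; rewrite nrm0 (le_trans _ uk) ?nrm_ge0.
rewrite -(ler_pM2r (x := nrm x)) ?nrm_gt0 // -expr2.
apply: le_eps => e e0.
have /cvgC_nrmP/(_ _ e0) uxe := ux x.
have [k [/= uk xk]] := filter_ex (filterI uM uxe).
have -> : nrm x ^+ 2 = nrm (dot x x).
  by rewrite dotxx // nrmC ger0_norm // sqr_ge0.
rewrite -[dot x x](subrK (dot (u k) x)) (le_trans (nrmD _ _)) //.
rewrite addrC lerD //; last by rewrite nrmBC ltW.
rewrite (le_trans (cauchy_schwarz dotN _ _)) //.
by rewrite ler_wpM2r ?nrm_ge0.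
Qed.

Lemma weak_cvgB (u v : I -> H) (x y : H) : weak_cvg u x -> weak_cvg v y ->
  weak_cvg (fun k => u k - v k) (x - y).
Proof.
move=> ux vy z; have := @ucv_lin _ _ _ _ _ (-1) _ _ (@filter_filter _ _ FP) (vy z) (ux z).
have -> : (fun k => -1 * dot (v k) z + dot (u k) z) = (fun k => dot (u k - v k) z).
  by apply/funext => k; rewrite mulN1r addrC -dotBl.
by rewrite mulN1r addrC -dotBl.
Qed.

Lemma cvg_weak (u : I -> H) (x : H) : u @ F --> x -> weak_cvg u x.
Proof.
move=> /cvg_nrmP ux y; apply/cvgC_nrmP => e e0.
have y1 : 0 < nrm y + 1 by rewrite ltr_wpDl ?nrm_ge0.
apply: filterS (ux _ (divr_gt0 e0 y1)) => k /=; rewrite ltr_pdivlMr // => uk.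
rewrite -dotBl; apply: le_lt_trans (cauchy_schwarz dotN _ _) _.
by apply: le_lt_trans uk; rewrite ler_wpM2l ?nrm_ge0 // lerDl.
Qed.

Lemma weak_cst (x : H) : weak_cvg (fun=> x) x.
Proof. by apply: cvg_weak; exact: cvg_cst. Qed.

Lemma weak_unique (u : I -> H) (x y : H) : weak_cvg u x -> weak_cvg u y -> x = y.
Proof. by move=> ux uy; apply: (dot_inj dotN) => z; apply: (ucv_unique FP (ux z) (uy z)). Qed.

(** One factor may converge only weakly if the other converges in norm. This is the situation of
    isometries, which have weak limits only, multiplied by strongly convergent diagonal
    operators. *)
Lemma weak_dot (u v : I -> H) (x y : H) (M : R) : (forall k, nrm (u k) <= M) ->
  weak_cvg u x -> v @ F --> y ->
  (fun k => dot (u k) (v k)) @ F --> (dot x y : R[i]^o).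
Proof.
move=> uM ux /cvg_nrmP vy; apply/cvgC_nrmP => e e0.
have e20 : 0 < e / 2 by rewrite divr_gt0.
have M1 : 0 < `|M| + 1 by rewrite ltr_wpDl.
have /cvgC_nrmP/(_ _ e20) uy := ux y.
apply: filterS (filterI uy (vy _ (divr_gt0 e20 M1))) => k [/= uk].
rewrite ltr_pdivlMr // => vk.
apply: le_lt_trans (nrm_triangle (dot (u k) y) _ _) _.
rewrite [e]splitr addrC ltrD // -dotBr.
apply: le_lt_trans (cauchy_schwarz dotN _ _) _; rewrite mulrC.
apply: le_lt_trans vk; rewrite ler_wpM2l ?nrm_ge0 // (le_trans (uM k)) //.
by rewrite (le_trans (ler_norm _)) // lerDl.
Qed.

Lemma ultra_wot (X : I -> H -> H) (M : R) : 0 <= M ->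
  (forall k, linear (X k)) -> (forall k, opbound (X k) M) ->
  exists T, [/\ linear T, opbound T M & wot_cvg X T].
Proof.
move=> M0 Xl XM.
have ext x : exists y, weak_cvg (X^~ x) y.
  by apply: (@ultra_weak _ (M * nrm x)) => k; exact: XM.
have [T TP] := boolp.choice ext; exists T; split=> [c x y|x|x y].
- apply: weak_unique (TP _) _ => z; rewrite dotDl dotZl.
  under eq_fun do rewrite Xl dotDl dotZl.
  by apply: ucv_lin; exact: TP.
- by apply: weak_nrm_le (TP x) _; apply: filterS filterT => k _; exact: XM.
- exact: TP.
Qed.

End UltraOperators.

Section WotClosed.
Variables (R : realType) (H : completeNormedModType R[i]).
Variable dot : {dot H for Num.conj}.
Hypothesis dotN : induces_norm dot.
Variable A : set (H -> H).
Hypothesis Acl : WOT_closed dot A.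
Hypothesis Ab : A `<=` @bounded_operator R H.

(** [A] is closed only relative to the bounded operators, so the limit has to be bounded before
    closedness applies; convergence in the initial topology is pointwise convergence of matrix
    coefficients. *)
Lemma wot_closed_lim (I : Type) (F : set_system I) (X : I -> H -> H) (T : H -> H) :
  ProperFilter F -> (forall k, A (X k)) -> bounded_operator T ->
  wot_cvg dot F X T -> A T.
Proof.
move=> FF AX Tb XT.
pose BB := (@bounded_operator R H : set (initial_topology (matrix_coefficients dot))).
apply: (@closed_cvg I (subspace BB) F FF X A Acl); first exact: nearW.
apply/(@subspace_cvgP (initial_topology (matrix_coefficients dot)) BB (X @ F) T _ Tb).
move=> U WU.
have : nbhs (T : initial_topology (matrix_coefficients dot)) [set g | BB g -> U g] := WU.
rewrite nbhsE => -[V [[B Bop <-] BT] VU].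
have : nbhs (matrix_coefficients dot T) B by apply: open_nbhs_nbhs.
have cv : {ptws, (matrix_coefficients dot \o X) @ F --> matrix_coefficients dot T}.
  by apply/pointwise_cvgP => -[x y]; exact: XT.
move=> /cv FB; have {}FB : F [set k | B (matrix_coefficients dot (X k))] := FB.
have : F [set k | U (X k)] by apply: filterS FB => k Bk; apply: VU => //; exact: Ab.
exact.
Qed.

End WotClosed.

(** * Fixed points in a simplex *)

Section Equilibrium.
Variables (R : realType) (I : finType).
Implicit Types b : I -> R.

Definition simplex b := (forall i, 0 <= b i) /\ \sum_i b i = 1.

Lemma sum_near (f g : I -> R) (d : R) : (forall i, `|f i - g i| <= d) ->
  `|\sum_i f i - \sum_i g i| <= #|I|%:R * d.
Proof.
move=> fg; rewrite -sumrB (le_trans (ler_norm_sum _ _ _)) //.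
by rewrite (le_trans (ler_sum _ (fun i _ => fg i))) // sumr_const mulr_natl.
Qed.

Lemma approx_equilibrium (i0 : I) (beta : I -> (I -> R) -> R) (n : nat) :
  (forall i b, simplex b -> 0 <= beta i b) ->
  exists b, simplex b /\ forall l, exists q, [/\ simplex q,
    forall i, `|q i - b i| <= #|I|%:R / n.+1%:R &
    (q l - #|I|%:R / n.+1%:R) * \sum_i beta i q <= beta l q].
Proof.
move=> beta0; pose N : R := #|I|%:R; pose p : R := n.+1%:R.
have p0 : 0 < p by rewrite ltr0n.
pose pt (x : grid I n.+1) i : R := (grid_coord x i)%:R / p.
have ptS x : simplex (pt x).
  split=> [i|]; first by rewrite divr_ge0 ?ler0n ?ltW.
  by rewrite -mulr_suml -natr_sum sum_grid mulfV ?gt_eqF.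
(* The coordinates of [pt x] add up to 1, so not every [beta l] can be below its share of the sum. A
   coordinate where it is not serves as the colour of [x]. *)
have ex x : exists l, pt x l * (\sum_i beta i (pt x)) <= beta l (pt x).
  apply: contrapT => no.
  have lt l : beta l (pt x) < pt x l * (\sum_i beta i (pt x)).
    by rewrite ltNge; apply/negP => h; apply: no; exists l.
  have : \sum_l beta l (pt x) < \sum_l pt x l * (\sum_i beta i (pt x)).
    by apply: ltr_sum => //; apply/hasP; exists i0; rewrite ?mem_index_enum.
  by rewrite -mulr_suml (ptS x).2 mul1r ltxx.
have [c cP] := boolp.choice ex.
have [x xP] := coloured_grid i0 c.
exists (pt x); split=> // l.
have sum0 y : 0 <= \sum_i beta i (pt y) by apply: sumr_ge0 => i _; exact: beta0.
have [xl|[y cy yx]] := xP l.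
  exists (pt x); split=> // [i|].
    by rewrite subrr normr0 divr_ge0 ?ler0n.
  rewrite (@le_trans _ _ 0) ?beta0 // mulr_le0_ge0 // subr_le0.
  by rewrite /pt ler_pM2r ?invr_gt0 // ler_nat.
exists (pt y); split=> // [i|].
  have [h1 h2] := yx i.
  rewrite -mulrBl normrM normfV (gtr0_norm p0) ler_pM2r ?invr_gt0 //.
  by move: h1 h2; rewrite -!(ler_nat R) !natrD ler_norml; lra.
rewrite -cy; apply: le_trans (cP y).
by rewrite ler_wpM2r // gerBl divr_ge0 ?ler0n.
Qed.

(** Brouwer's theorem for [b |-> beta b / \sum_i beta i b], written without division so that the sum
    may vanish. Approximate equilibria yield only [b l * \sum_i beta i b <= beta l b] in the limit;
    both sides have the same sum over [l], so all are equalities. *)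
Theorem simplex_equilibrium (i0 : I) (beta : I -> (I -> R) -> R) :
  (forall i b, simplex b -> 0 <= beta i b) ->
  (forall i b (e : R), simplex b -> 0 < e -> exists2 d : R, 0 < d &
     forall b', simplex b' -> (forall j, `|b' j - b j| < d) -> `|beta i b' - beta i b| < e) ->
  exists b, simplex b /\ forall l, beta l b = b l * \sum_i beta i b.
Proof.
move=> beta0 betac.
have [u uP] := boolp.choice (fun n => approx_equilibrium i0 n beta0).
have [F [FU subF]] := @ultraFilterLemma nat \oo _.
have FP := @ultra_proper _ F FU.
have Fex P : F P -> exists k, P k by move=> /filter_ex.
have small (e : R) : 0 < e -> F [set k | #|I|%:R / k.+1%:R < e].
  move=> e0; apply: subF; have [|N NP] := @archi_inv _ (e / (#|I|%:R + 1)).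
    by rewrite divr_gt0 // ltr_wpDl.
  exists N => // k /= /NP; rewrite ltr_pdivlMr ?ltr_wpDl // mulrDr mulr1.
  have : 0 < k.+1%:R^-1 :> R by rewrite invr_gt0 ltr0n.
  by rewrite [#|I|%:R / _]mulrC => k0; apply: le_lt_trans; rewrite lerDl ltW.
have exb i : exists l : R, forall e, 0 < e -> F [set k | `|u k i - l| < e].
  apply: (ultra_lim_real FU (M := 1)) => k; have [[u0 u1] _] := uP k.
  by rewrite ger0_norm // -u1 (bigD1 i) //= lerDl sumr_ge0.
have [b bP] := boolp.choice exb.
have near (e : R) : 0 < e -> F [set k | forall i, `|u k i - b i| < e].
  by move=> e0; apply: (@filter_forall _ _ (fun i => [set k | `|u k i - b i| < e])) => i; exact: bP.
have I1 : 0 < #|I|%:R + 1 :> R by rewrite ltr_wpDl.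
have bS : simplex b.
  split=> [i|].
    apply: (@le_eps R) => e e0; have [k kb] := Fex _ (bP i e e0).
    by have [[u0 _] _] := uP k; have := u0 i; move: kb; rewrite /= ltr_norml; lra.
  have H (e : R) : 0 < e -> `|\sum_i b i - 1| <= e.
    move=> e0; have [|k kb] := Fex _ (near (e / (#|I|%:R + 1)) _); first exact: divr_gt0.
    have [[_ <-] _] := uP k; rewrite distrC.
    apply: (le_trans (sum_near (fun i => ltW (kb i)))).
    by rewrite mulrA ler_pdivrMr //; nra.
  by apply/eqP; rewrite -subr_eq0 -normr_le0; apply: (@le_eps R) => e /H; rewrite add0r.
exists b; split=> //.
have exq k : exists q : I -> I -> R, forall l, [/\ simplex (q l),
    forall i, `|q l i - u k i| <= #|I|%:R / k.+1%:R &
    (q l l - #|I|%:R / k.+1%:R) * \sum_i beta i (q l) <= beta l (q l)].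
  by have [q qP] := boolp.choice (uP k).2; exists q.
have [q qP] := boolp.choice exq.
have key l : b l * \sum_i beta i b <= beta l b.
  have s0 : 0 <= \sum_i beta i b by apply: sumr_ge0 => i _; exact: beta0.
  pose s := \sum_i beta i b.
  have bl1 : b l <= 1 by rewrite -bS.2 (bigD1 l) //= lerDl sumr_ge0 // => i _; exact: bS.1.
  (* [q k l l] is within [2 e] of [b l] and the grid error costs another [e], whence the 3;
     replacing [beta] at [q k l] by [beta] at [b] costs [e] for one term and [#|I| e] for the
     sum. *)
  have H (e : R) : 0 < e -> e <= 1 -> b l * s <= beta l b + e * (1 + 3 * s + 4 * #|I|%:R).
    move=> e0 e1.
    have qb i : F [set k | `|beta i (q k l) - beta i b| < e].
      have [d d0 db] := betac i b e bS e0.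
      have d2 : 0 < d / 2 by rewrite divr_gt0.
      apply: filterS (filterI (near _ d2) (small _ d2)) => k [/= kb kd].
      have [qS qu _] := qP k l.
      apply: db => // j; move: (kb j) (qu j) kd.
      set r := #|I|%:R / _; move: (r) => {}r.
      by rewrite !ltr_norml !ler_norml => /andP[h1 h2] /andP[h3 h4] h5; apply/andP; split; lra.
    have allb : F [set k | forall i, `|beta i (q k l) - beta i b| < e].
      exact: (@filter_forall _ _ (fun i => [set k | `|beta i (q k l) - beta i b| < e])).
    have [k [[/= kb kq] ke]] := Fex _ (filterI (filterI (near _ e0) allb) (small _ e0)).
    have [qS qu qle] := qP k l.
    have := sum_near (fun i => ltW (kq i)); rewrite -/s ler_norml.
    have := kq l; rewrite ltr_norml; move: qle ke (kb l) (qu l).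
    have : 0 <= \sum_i beta i (q k l) by apply: sumr_ge0 => i _; exact: beta0.
    have := bS.1 l; move: bl1 s0; rewrite -/s.
    set N := #|I|%:R / _; have N0 : 0 <= #|I|%:R :> R by rewrite ler0n.
    move: N0; set M := #|I|%:R; rewrite ltr_norml ler_norml.
    set sq := \sum_i _; set t := q k l l; set bq := beta l _; set v := u k l.
    move=> M0 bl1 s0 b0 sq0 qle Ne /andP[v1 v2] /andP[v3 v4] /andP[h1 h2] /andP[h3 h4].
    have t1 : (b l - 3 * e) * sq <= (t - N) * sq by apply: ler_wpM2r => //; lra.
    have Me : M * e <= M by rewrite ler_piMr.
    have t2 : e * sq <= e * (s + M) by rewrite ler_pM2l //; lra.
    have t3 : b l * s <= b l * (sq + M * e) by rewrite ler_wpM2l //; lra.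
    have t4 : b l * (M * e) <= M * e by rewrite ler_piMl // mulr_ge0 // ltW.
    nra.
  apply: (@le_eps R) => e e0.
  pose M := 1 + 3 * s + 4 * #|I|%:R.
  have M0 : 0 < M by rewrite /M; have : 0 <= #|I|%:R :> R by []; move: s0; rewrite -/s; lra.
  have [eM|eM] := leP (e / M) 1.
    have := H (e / M) (divr_gt0 e0 M0) eM.
    by rewrite -/M divfK // gt_eqF.
  have := H 1 ltr01 (lexx _); rewrite -/M -/s; move: eM; rewrite ltr_pdivlMr // !mul1r.
  lra.
have /psumr_eq0P eq0 : forall l, true -> 0 <= beta l b - b l * \sum_i beta i b.
  by move=> l _; rewrite subr_ge0.
move=> l; apply/eqP; rewrite -subr_eq0; apply/eqP/eq0 => //.
by rewrite sumrB -mulr_suml bS.2 mul1r subrr.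
Qed.

End Equilibrium.

(** * Transitive algebras *)

Section ProjOp.
Variables (R : realType) (H : completeNormedModType R[i]).
Variable dot : {dot H for Num.conj}.
Hypothesis dotN : induces_norm dot.
Implicit Types (x y z : H) (L : set H).

Lemma nclosure_sub L : L `<=` nclosure L.
Proof. by move=> x Lx e e0; exists x => //; rewrite subrr nrm0. Qed.

Lemma nclosureK L : nclosure (nclosure L) `<=` nclosure L.
Proof.
move=> x Lx e e0; have e20 : 0 < e / 2 by rewrite divr_gt0.
have [y Ly xy] := Lx _ e20; have [z Lz yz] := Ly _ e20.
by exists z => //; have := nrm_triangle y x z; lra.
Qed.

Lemma nclosure_subspace L : subspace_set L -> subspace_set (nclosure L).
Proof.
move=> [L0 Ll]; split; first exact: nclosure_sub.
move=> c x y Lx Ly e e0.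
have c1 : 0 < nrm c + 1 by rewrite ltr_wpDl ?nrm_ge0.
have e20 : 0 < e / 2 by rewrite divr_gt0.
have [x' Lx' xx] := Lx _ (divr_gt0 e20 c1); have [y' Ly' yy] := Ly _ e20.
exists (c *: x' + y'); first exact: Ll.
rewrite opprD addrACA -scalerBr (le_lt_trans (nrmD _ _)) // [e]splitr ltrD //.
rewrite nrmZ mulrC; apply: le_lt_trans (_ : _ <= nrm (x - x') * (nrm c + 1)) _.
  by rewrite ler_wpM2l ?nrm_ge0 // lerDl.
by rewrite -ltr_pdivlMr.
Qed.

Lemma proj_op L : subspace_set L -> nclosure L `<=` L ->
  exists E, [/\ linear E, opbound E 1, E \o E = E & is_adjoint dot E E] /\
    (forall x, L (E x)) /\ (forall x, L x -> E x = x).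
Proof.
move=> sL cL; have [L0 Ll] := sL.
have exE x : exists p, L p /\ forall z, L z -> dot (x - p) z = 0.
  by have [p Lp px] := projection_exists dotN x sL cL; exists p.
have [E EP] := boolp.choice exE.
have LE x : L (E x) := (EP x).1; have Eo x := (EP x).2.
have uniq x p : L p -> (forall z, L z -> dot (x - p) z = 0) -> E x = p.
  move=> Lp px; apply/eqP; rewrite -subr_eq0; apply/eqP/(dotxx_eq0 dotN).
  have Ld : L (E x - p) by rewrite addrC -scaleN1r; exact: Ll.
  rewrite -[E x - p in X in dot X](subrKA x) dotDl px // addr0.
  by rewrite -[E x - x]opprB dotNl Eo // oppr0.
have EK x : L x -> E x = x.
  by move=> Lx; apply: uniq => // z _; rewrite subrr dot0l.
have Elin : linear E.
  move=> c x y; apply: uniq; first exact: Ll.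
  move=> z Lz; rewrite opprD addrACA -scalerBr dotDl dotZl !Eo //.
  by rewrite mulr0 addr0.
exists E; split; last by split.
split=> //.
- move=> x; rewrite mul1r -(@ler_pXn2r _ 2) ?nnegrE ?nrm_ge0 //.
  have : dot (x - E x) (E x) = 0 by apply: Eo.
  by move=> /(pythagoras dotN); rewrite subrK => ->; rewrite lerDr sqr_ge0.
- by apply/funext => x /=; exact: EK.
- have sym x y : dot x (E y) = dot (E x) (E y).
    by apply/eqP; rewrite -subr_eq0 -dotBl Eo.
  by move=> x y; rewrite dotC (sym y x) (sym x y) -dotC.
Qed.

End ProjOp.

Section Algebra.
Variables (R : realType) (H : completeNormedModType R[i]).
Variable dot : {dot H for Num.conj}.
Hypothesis dotN : induces_norm dot.
Variable A : set (H -> H).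
Hypothesis Aalg : unital_subalgebra A.
Hypothesis Atr : transitive_algebra dot A.
Hypothesis Acl : WOT_closed dot A.
Implicit Types (x y z : H) (X Y : H -> H).

Lemma alg_bounded X : A X -> bounded_operator X.
Proof. by have [/(_ X)] := Aalg. Qed.

Lemma alg_linear X : A X -> linear X.
Proof. by move=> /alg_bounded []. Qed.

Lemma alg_opbound X : A X -> exists2 M : R, 0 <= M & opbound X M.
Proof. by move=> /alg_bounded /bounded_operatorP[]. Qed.

Lemma alg_id : A idfun. Proof. by have [] := Aalg. Qed.

Lemma alg_lin (c : R[i]) X Y : A X -> A Y -> A (fun x => c *: X x + Y x).
Proof. by have [_ _ + _] := Aalg; apply. Qed.

Lemma alg_comp X Y : A X -> A Y -> A (X \o Y).
Proof. by have [_ _ _] := Aalg; apply. Qed.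

Lemma alg0 : A (fun=> 0).
Proof.
have := alg_lin (-1) alg_id alg_id; congr (A _); apply/funext => x /=.
by rewrite scaleN1r addNr.
Qed.

Lemma algZ (c : R[i]) X : A X -> A (fun x => c *: X x).
Proof.
move=> AX; have := alg_lin c AX alg0; congr (A _).
by apply/funext => x /=; rewrite addr0.
Qed.

Lemma algD X Y : A X -> A Y -> A (fun x => X x + Y x).
Proof.
move=> AX AY; have := alg_lin 1 AX AY; congr (A _).
by apply/funext => x /=; rewrite scale1r.
Qed.

Lemma algB X Y : A X -> A Y -> A (fun x => X x - Y x).
Proof.
move=> AX AY; have := alg_lin (-1) AY AX; congr (A _).
by apply/funext => x /=; rewrite scaleN1r addrC.
Qed.

Lemma alg_sum (I : Type) (r : seq I) (c : I -> R[i]) (X : I -> H -> H) :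
  (forall i, A (X i)) -> A (fun x => \sum_(i <- r) c i *: X i x).
Proof.
move=> AX; elim: r => [|i r IH].
  by have := alg0; congr (A _); apply/funext => x; rewrite big_nil.
have := algD (algZ (c i) (AX i)) IH; congr (A _).
by apply/funext => x; rewrite big_cons.
Qed.

(** The projection onto the closure of the orbit belongs to [Lat A] and fixes [x], so transitivity
    makes it the identity. *)
Lemma orbit_dense x : x != 0 -> forall z (e : R), 0 < e ->
  exists2 X, A X & nrm (X x - z) < e.
Proof.
move=> x0.
pose L := [set X x | X in A].
have sL : subspace_set L.
  split; first by exists (fun=> 0); [exact: alg0|].
  move=> c _ _ [X AX <-] [Y AY <-].
  by exists (fun x => c *: X x + Y x); first exact: alg_lin.
have [E [[El E1 EE Ea] [LE EK]]] := proj_op dotN (nclosure_subspace sL) (@nclosureK _ _ L).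
have LatE : Lat dot A E.
  split; first by split=> //; exact: (bounded_operatorI El _ E1).
  move=> T AT; apply/funext => y; rewrite !fctE /=.
  apply/eqP; rewrite subr_eq0; apply/eqP/esym/EK.
  have [M M0 TM] := alg_opbound AT.
  move=> e e0; have M1 : 0 < M + 1 by rewrite ltr_wpDl.
  have [_ [X AX <-] EX] := LE y _ (divr_gt0 e0 M1).
  exists (T (X x)); first by exists (T \o X) => //; exact: alg_comp.
  rewrite -(linBf (alg_linear AT)) (le_lt_trans (TM _)) // mulrC.
  move: EX; rewrite ltr_pdivlMr //; apply: le_lt_trans.
  by rewrite ler_wpM2l ?nrm_ge0 // lerDl.
have Ex : E x = x by apply: EK; apply: nclosure_sub; exists idfun; first exact: alg_id.
move: LatE; rewrite Atr => -[E0|E1'].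
  by move: x0; rewrite -Ex E0 eqxx.
move=> z e e0; have : nclosure L z by have := LE z; rewrite E1'.
by move=> /(_ e e0)[_ [X AX <-]]; rewrite nrmBC => Xx; exists X.
Qed.

Lemma orbit_orth0 x y : x != 0 -> (forall X, A X -> dot (X x) y = 0) -> y = 0.
Proof.
move=> x0 Xy; apply/(dotxx_eq0 dotN)/eqP; rewrite -nrm_eq0; apply/eqP/le_anti.
rewrite nrm_ge0 andbT; apply: le_eps => e e0; rewrite add0r.
have y1 : 0 < nrm y + 1 by rewrite ltr_wpDl ?nrm_ge0.
have [X AX Xe] := orbit_dense x0 y (divr_gt0 e0 y1).
rewrite -[dot y y]subr0 -(Xy X AX) -dotBl (le_trans (cauchy_schwarz dotN _ _)) //.
move: Xe; rewrite nrmBC ltr_pdivlMr // => /ltW; apply: le_trans.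
by rewrite ler_wpM2l ?nrm_ge0 // lerDl.
Qed.

Lemma alg_wot_lim (I : Type) (F : set_system I) (T : H -> H) (Y : I -> H -> H) :
  ProperFilter F -> (forall k, A (Y k)) -> bounded_operator T ->
  wot_cvg dot F Y T -> A T.
Proof. by apply: wot_closed_lim => // T' /alg_bounded. Qed.

End Algebra.

(** * Gram-Schmidt *)

(** [L] is a mere set closed under combinations; a matrix of maximal rank with rows in [L] has row
    space containing [L], and a column of its cokernel separates [v]. *)
Lemma row_space_separation (K : fieldType) (m : nat) (L : set 'rV[K]_m) (v : 'rV[K]_m) :
  L 0 -> (forall c w w', L w -> L w' -> L (c *: w + w')) -> ~ L v ->
  exists2 c : 'cV[K]_m, forall w, L w -> w *m c = 0 & v *m c != 0.
Proof.
move=> L0 Ll nLv.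
pose P r := `[< exists k (B : 'M[K]_(k, m)), (forall i, L (row i B)) /\ \rank B = r >].
have exP : exists r, P r.
  by exists 0%N; apply/asboolP; exists 0%N, 0; split=> [[]//|]; rewrite mxrank0.
have Pm r : P r -> (r <= m)%N.
  by move=> /asboolP[k [B [_ <-]]]; exact: rank_leq_col.
have [r /asboolP[k [B [BL rB]]] rmax] := ex_maxnP exP Pm.
have sumL (u : 'rV[K]_k) : L (u *m B).
  rewrite mulmx_sum_row; elim/big_rec: _ => // i w _ Lw.
  exact: Ll.
have LB w : L w -> (w <= B)%MS.
  move=> Lw; apply: contraT => nwB.
  have : (\rank (col_mx B w) <= r)%N.
    apply: rmax; apply/asboolP; exists (k + 1)%N, (col_mx B w); split=> // i.
    case: (split_ordP i) => j ->; rewrite ?rowKu ?rowKd; first exact: BL.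
    by rewrite row_id.
  rewrite -rB leqNgt; case/negP.
  rewrite -addsmxE; apply: rank_ltmx.
  by rewrite /ltmx addsmxSl addsmx_sub submx_refl.
have nvB : ~~ (v <= B)%MS by apply/negP => /submxP[u vE]; apply: nLv; rewrite vE.
have [j vj] : exists j, (v *m cokermx B) 0 j != 0.
  apply/existsP; apply: contraT; rewrite negb_exists => /forallP v0.
  move: nvB; rewrite submxE; case/negP; apply/eqP/matrixP => i j.
  by rewrite !mxE ord1; have := v0 j; rewrite negbK mxE => /eqP.
exists (col j (cokermx B)).
  move=> w /LB; rewrite submxE => /eqP w0.
  by rewrite colE mulmxA w0 mul0mx.
apply: contra vj; rewrite colE mulmxA => /eqP v0.
by have := congr1 (fun M : 'M[K]_(1, 1) => M 0 0) v0; rewrite -colE !mxE => ->.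
Qed.

Section GramSchmidt.
Variables (R : realType) (H : completeNormedModType R[i]).
Variable dot : {dot H for Num.conj}.
Hypothesis dotN : induces_norm dot.
Variable u : nat -> H.

Definition unit_of (v : H) : H := ((nrm v)^-1)%:C *: v.

(** Since [unit_of 0] is 0, a vector depending on its predecessors yields a zero entry instead of
    being skipped. Indices are thus preserved, and each [gs n] has norm 0 or 1. *)
Fixpoint gs_seq (n : nat) : seq H :=
  if n is m.+1 then
    let s := gs_seq m in
    rcons s (unit_of (u m - \sum_(e <- s) dot (u m) e *: e))
  else [::].

Definition gs n : H := nth 0 (gs_seq n.+1) n.

Lemma size_gs_seq n : size (gs_seq n) = n.
Proof. by elim: n => //= n IH; rewrite size_rcons IH. Qed.

Lemma gs_seqE n : gs_seq n = mkseq gs n.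
Proof.
elim: n => // n IH; rewrite /mkseq -addn1 iotaD map_cat /= cats1 -/(mkseq gs n) -IH.
rewrite addn1 /= /gs /= nth_rcons size_gs_seq ltnn eqxx //.
Qed.

Let res n := u n - \sum_(i < n) dot (u n) (gs i) *: gs i.

Lemma gsE n : gs n = unit_of (res n).
Proof.
rewrite {1}/gs /= nth_rcons size_gs_seq ltnn eqxx gs_seqE /mkseq big_map.
by rewrite /res -(big_mkord xpredT (fun i => dot (u n) (gs i) *: gs i)) /index_iota subn0.
Qed.

Lemma unit_ofK v : (nrm v)%:C *: unit_of v = v.
Proof.
have [->|v0] := eqVneq v 0; first by rewrite nrm0 scale0r.
by rewrite scalerA -rmorphM mulfV ?nrm_eq0 // scale1r.
Qed.

Lemma nrm_unit_of v : nrm (unit_of v) = (v != 0)%:R.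
Proof.
have [->|v0] := eqVneq v 0; first by rewrite /unit_of scaler0 nrm0.
rewrite nrmZ nrmC ger0_norm ?invr_ge0 ?nrm_ge0 //.
by rewrite mulVf // nrm_eq0.
Qed.

Lemma gs_proj n : dot (gs n) (gs n) *: gs n = gs n.
Proof.
rewrite dotxx // gsE nrm_unit_of; have [->|_] := eqVneq (res n) 0.
  by rewrite /unit_of scaler0 scaler0.
by rewrite expr1n scale1r.
Qed.

Lemma gs_orth i j : i != j -> dot (gs i) (gs j) = 0.
Proof.
have main n : forall m, (m < n)%N -> dot (gs n) (gs m) = 0.
  elim/ltn_ind: n => n IH m mn.
  rewrite gsE /unit_of dotZl dotBl dot_suml (bigD1 (Ordinal mn)) //= big1; last first.
    move=> l lm; rewrite dotZl; have [lt|lt|eq] := ltngtP l m.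
    - by rewrite (dotC _ (gs l)) (IH m mn l lt) rmorph0 mulr0.
    - by rewrite (IH l (ltn_ord l) m lt) mulr0.
    - by move: lm; rewrite -val_eqE /= eq eqxx.
  have dE : dot (u n) (gs m) * dot (gs m) (gs m) = dot (u n) (gs m).
    by rewrite -[in RHS](gs_proj m) dotZr -dotC mulrC.
  by rewrite addr0 dotZl dE subrr mulr0.
move=> ij; have [lt|lt|eq] := ltngtP i j; last by rewrite eq eqxx in ij.
- by rewrite dotC main ?rmorph0.
- exact: main.
Qed.

Lemma gs_expand n N : (n < N)%N -> u n = \sum_(i < N) dot (u n) (gs i) *: gs i.
Proof.
move=> nN.
have uE : u n = \sum_(i < n.+1) dot (u n) (gs i) *: gs i.
  rewrite big_ord_recr /= -[LHS](subrK (\sum_(i < n) dot (u n) (gs i) *: gs i)).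
  rewrite addrC -/(res n); congr (_ + _).
  have rE : res n = dot (res n) (gs n) *: gs n.
    rewrite -{1}[res n]unit_ofK -gsE -{1}(gs_proj n) scalerA; congr (_ *: _).
    by rewrite -dotZl [in X in dot X]gsE unit_ofK.
  rewrite {1}rE; congr (_ *: _).
  rewrite /res dotBl dot_suml big1 ?subr0 // => i _.
  by rewrite dotZl gs_orth ?mulr0 // neq_ltn ltn_ord.
rewrite -(subnKC nN) big_split_ord /= -uE big1 ?addr0 // => i _.
rewrite [X in dot X]uE dot_suml big1 ?scale0r // => j _.
by rewrite dotZl gs_orth ?mulr0 // neq_ltn ltn_addr.
Qed.

End GramSchmidt.

(** * Minimal annihilating functionals *)

Section Annihilator.
Variables (R : realType) (H : completeNormedModType R[i]).
Variable dot : {dot H for Num.conj}.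
Hypothesis dotN : induces_norm dot.
Variable A : set (H -> H).
Hypothesis Aalg : unital_subalgebra A.
Hypothesis Atr : transitive_algebra dot A.
Hypothesis Acl : WOT_closed dot A.
Implicit Types (x y z : H) (X Y T : H -> H).

(** Otherwise operators of [A] that match [T] on finite lists of pairs, up to [1 / (N + 1)], form a
    net indexed by lists and precisions. It converges to [T], which closedness then puts in [A]. *)
Lemma wot_finite_sep T : bounded_operator T -> ~ A T ->
  exists m (x y : 'I_m -> H) (e : R), 0 < e /\
    forall X, A X -> exists i, e <= nrm (dot (X (x i)) (y i) - dot (T (x i)) (y i)).
Proof.
move=> Tb nAT; apply: contrapT => nex; apply: nAT.
pose I := (seq (H * H) * nat)%type.
have exX (k : I) : exists X, A X /\ forall p, p \in k.1 ->
    nrm (dot (X p.1) p.2 - dot (T p.1) p.2) < k.2.+1%:R^-1.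
  apply: contrapT => nX; apply: nex.
  exists (size k.1), (fun i => (tnth (in_tuple k.1) i).1), (fun i => (tnth (in_tuple k.1) i).2).
  exists k.2.+1%:R^-1; split; first by rewrite invr_gt0.
  move=> X AX; apply: contrapT => nX'; apply: nX; exists X; split=> // p /(tnthP (in_tuple _))[i ->].
  by rewrite ltNge; apply/negP => le; apply: nX'; exists i.
have [X XP] := boolp.choice exX.
pose B (k : I) : set I := [set k' : I | {subset k.1 <= k'.1} /\ (k.2 <= k'.2)%N].
pose F := filter_from [set: I] B.
have FF : ProperFilter F.
  apply: filter_from_proper; last by move=> k _; exists k; split.
  apply: filter_from_filter; first by exists ([::], 0%N).
  move=> k k' _ _; exists (k.1 ++ k'.1, maxn k.2 k'.2) => // l [/= sl nl].
  split; split.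
  - by move=> p pk; apply: sl; rewrite mem_cat pk.
  - by apply: leq_trans nl; rewrite leq_maxl.
  - by move=> p pk; apply: sl; rewrite mem_cat pk orbT.
  - by apply: leq_trans nl; rewrite leq_maxr.
apply: (alg_wot_lim Aalg Acl (F := F) (T := T) (Y := X)) => //.
  by move=> k; have [] := XP k.
move=> x y; apply/cvgC_nrmP => e /archi_inv[N NP].
exists ([:: (x, y)], N) => // k [/= sk Nk].
have [_ /(_ (x, y)) /=] := XP k.
by move=> /(_ (sk _ (mem_head _ _)))/lt_trans; apply; exact: NP.
Qed.

Definition pairing n (x k : 'I_n -> H) T := \sum_i dot (T (x i)) (k i).

Definition annihilable n := exists x k : 'I_n -> H,
  (forall X, A X -> pairing x k X = 0) /\
  exists2 T, bounded_operator T & pairing x k T != 0.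

Lemma annihilable_exists : A <> @bounded_operator R H -> exists n, annihilable n.
Proof.
move=> algB.
have [T Tb nAT] : exists2 T, bounded_operator T & ~ A T.
  apply: contrapT => nT; apply: algB; apply/seteqP; split=> [X|T Tb].
    exact: alg_bounded.
  by apply: contrapT => nAT; apply: nT; exists T.
have [m [x [y [e [e0 eP]]]]] := wot_finite_sep Tb nAT.
pose row_of X : 'rV[R[i]]_m := \row_i dot (X (x i)) (y i).
pose L : set 'rV[R[i]]_m := [set row_of X | X in A].
have [|||c cL cT] := @row_space_separation _ m L (row_of T).
- exists (fun=> 0); first exact: alg0.
  by apply/rowP => i; rewrite !mxE dot0l.
- move=> c _ _ [X AX <-] [Y AY <-].
  exists (fun x => c *: X x + Y x); first exact: alg_lin.
  by apply/rowP => i; rewrite !mxE dotDl dotZl.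
- move=> [X AX XT]; have [l] := eP X AX.
  have /rowP/(_ l) := XT; rewrite !mxE => ->.
  by rewrite subrr nrm0 leNgt e0.
have prE X : pairing x (fun i => Num.conj (c i 0) *: y i) X = (row_of X *m c) 0 0.
  rewrite mxE; apply: eq_bigr => i _.
  by rewrite dotZr conjCK mxE mulrC.
exists m, x, (fun i => Num.conj (c i 0) *: y i); split.
  by move=> X AX; rewrite prE cL ?mxE //; exists X.
exists T => //; rewrite prE; apply: contra cT => /eqP c0.
by apply/eqP/matrixP => i j; rewrite !ord1 c0 mxE.
Qed.

Lemma dependent_solve n (z : 'I_n.+1 -> H) (c : 'I_n.+1 -> R[i]) j : c j != 0 ->
  \sum_i c i *: z i = 0 -> z j = - \sum_i (c (lift j i) / c j) *: z (lift j i).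
Proof.
move=> cj; rewrite (bigD1_ord j) //= => cz.
have -> : \sum_i (c (lift j i) / c j) *: z (lift j i) =
    (c j)^-1 *: (\sum_i c (lift j i) *: z (lift j i)).
  by rewrite scaler_sumr; apply: eq_bigr => i _; rewrite scalerA mulrC.
move/eqP: cz; rewrite addrC addr_eq0 => /eqP ->.
by rewrite scalerN scalerA mulVf // scale1r opprK.
Qed.

Section Minimal.
Variable n : nat.
Hypothesis minn1 : ~ annihilable n.

Lemma pairing_min (z k : 'I_n -> H) : (forall X, A X -> pairing z k X = 0) ->
  forall T, bounded_operator T -> pairing z k T = 0.
Proof.
move=> zk T Tb; apply: contrapT => /eqP zkT; apply: minn1.
by exists z, k; split => //; exists T.
Qed.

(** The relation eliminates [z j], which shortens the functional to length [n], where minimality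
    applies. *)
Lemma pairing_min_left (z k : 'I_n.+1 -> H) (c : 'I_n.+1 -> R[i]) j :
  c j != 0 -> \sum_i c i *: z i = 0 -> (forall X, A X -> pairing z k X = 0) ->
  forall T, bounded_operator T -> pairing z k T = 0.
Proof.
move=> cj cz zk.
pose k' i := k (lift j i) - Num.conj (c (lift j i) / c j) *: k j.
have zj := dependent_solve cj cz.
have pE T : linear T -> pairing z k T = pairing (fun i => z (lift j i)) k' T.
  move=> lT; rewrite /pairing (bigD1_ord j) //= zj -scaleN1r (linZf lT) (linsumf _ _ _ lT).
  rewrite dotZl dot_suml mulN1r -sumrN -big_split /=; apply: eq_bigr => i _.
  by rewrite (linZf lT) dotZl /k' dotBr dotZr conjCK addrC.
move=> T Tb; rewrite pE; last by case: Tb.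
apply: pairing_min => // X AX; rewrite -pE ?zk //; exact: alg_linear AX.
Qed.

Lemma pairing_min_right (z k : 'I_n.+1 -> H) (c : 'I_n.+1 -> R[i]) j :
  c j != 0 -> \sum_i c i *: k i = 0 -> (forall X, A X -> pairing z k X = 0) ->
  forall T, bounded_operator T -> pairing z k T = 0.
Proof.
move=> cj ck zk.
pose z' i := z (lift j i) - Num.conj (c (lift j i) / c j) *: z j.
have kj := dependent_solve cj ck.
have pE T : linear T -> pairing z k T = pairing z' (fun i => k (lift j i)) T.
  move=> lT; rewrite /pairing (bigD1_ord j) //= kj dotNr dot_sumr -sumrN -big_split /=.
  apply: eq_bigr => i _.
  by rewrite /z' (linBf lT) (linZf lT) dotBl dotZl dotZr addrC.
move=> T Tb; rewrite pE; last by case: Tb.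
apply: pairing_min => // X AX; rewrite -pE ?zk //; exact: alg_linear AX.
Qed.

End Minimal.

Lemma rank_one_bounded (a b : H) : bounded_operator (fun u => dot u a *: b).
Proof.
apply: (@bounded_operatorI _ _ _ (nrm a * nrm b)).
- by move=> c x y; rewrite dotDl dotZl scalerDl scalerA.
- by rewrite mulr_ge0 ?nrm_ge0.
- move=> x; rewrite nrmZ mulrAC ler_wpM2r ?nrm_ge0 // mulrC.
  exact: cauchy_schwarz.
Qed.

(** The last clause is the form in which minimality of the length is used. It is applied to tuples
    made from [x] by linear combinations or by operators of [A], whose pairing with [k] vanishes on
    [A]. *)
Definition minimal_pair n (x k : 'I_n.+1 -> H) :=
  [/\ forall i j, dot (x i) (x j) = (i == j)%:R,
      forall X, A X -> pairing x k X = 0,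
      forall (c : 'I_n.+1 -> R[i]) l, \sum_i c i *: k i = 0 -> c l = 0 &
      forall (z : 'I_n.+1 -> H) (c : 'I_n.+1 -> R[i]) j, c j != 0 ->
        \sum_i c i *: z i = 0 -> (forall X, A X -> pairing z k X = 0) ->
        forall i, z i = 0].

Lemma minimal_pair_exists : A <> @bounded_operator R H ->
  exists n (x k : 'I_n.+1 -> H), minimal_pair x k.
Proof.
move=> /annihilable_exists exn.
pose P m := `[< annihilable m >].
have exP : exists m, P m by have [m am] := exn; exists m; apply/asboolP.
have [[|n] /asboolP an nmin] := ex_minnP exP.
  have [x [k [_ [T _]]]] := an.
  by rewrite /pairing big_ord0 eqxx.
have nan : ~ annihilable n by move=> /asboolP/nmin; rewrite ltnn.
have [x [k [xk [T0 T0b xkT0]]]] := an.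
pose u (m : nat) := x (inord m).
(* Orthonormalising the [x i] is a change of basis that is compensated on the [k i]. A zero
   Gram-Schmidt vector would make the new tuple dependent, which minimality excludes. *)
pose e := gs dot u.
pose f (i : 'I_n.+1) := e i.
have xE i : x i = \sum_(j < n.+1) dot (x i) (f j) *: f j.
  by have := gs_expand dotN u (ltn_ord i); rewrite /u inord_val.
pose k' (j : 'I_n.+1) := \sum_i Num.conj (dot (x i) (f j)) *: k i.
have pE T : linear T -> pairing x k T = pairing f k' T.
  move=> lT; rewrite /pairing.
  under [RHS]eq_bigr do rewrite dot_sumr.
  rewrite exchange_big /=; apply: eq_bigr => i _.
  rewrite {1}xE (linsumf _ _ _ lT) dot_suml; apply: eq_bigr => j _.
  by rewrite (linZf lT) dotZl dotZr conjCK.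
have fk X : A X -> pairing f k' X = 0.
  by move=> AX; rewrite -pE ?xk //; exact: alg_linear AX.
have fkT0 : pairing f k' T0 != 0 by rewrite -pE //; case: T0b.
have f1 i : dot (f i) (f i) = 1.
  rewrite /f /e dotxx // gsE nrm_unit_of; case: eqP => /= [r0|_]; last by rewrite expr1n.
  case/eqP: fkT0; apply: (pairing_min_left nan (c := fun l => (l == i)%:R) (j := i)) => //.
    by rewrite eqxx oner_eq0.
  rewrite (bigD1 i) //= eqxx scale1r big1 ?addr0.
    by rewrite /f /e gsE r0 /unit_of scaler0.
  by move=> l /negPf ->; rewrite scale0r.
have k0 (c' : 'I_n.+1 -> R[i]) l : \sum_i c' i *: k' i = 0 -> c' l = 0.
  move=> ck; apply/eqP; apply: contraNT fkT0 => cl; apply/eqP.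
  exact: (pairing_min_right nan cl ck).
exists n, f, k'; split=> // [i j|z c j cj cz zk i].
  by have [->|ij] := eqVneq i j; [exact: f1|rewrite gs_orth].
(* On the rank-one operator [dot _ a *: b] the vanishing pairing is a linear relation between the
   independent [k i] with coefficients given by [dot (z i) a]. *)
have pz := pairing_min_left nan cj cz zk.
apply: (dot_inj dotN) => a; rewrite dot0l.
apply: (can_inj conjCK); rewrite rmorph0.
apply: (k0 (fun i => Num.conj (dot (z i) a))).
apply: (dot_injr dotN) => b; rewrite dot0r dot_sumr.
rewrite -[RHS](pz _ (rank_one_bounded a b)); apply: eq_bigr => l _.
by rewrite dotZr conjCK dotZl.
Qed.

Section MinimalPair.
Variables (n : nat) (x k : 'I_n.+1 -> H).
Hypothesis xk : minimal_pair x k.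

(** Orbits are dense, so a single term [dot (X x_0) k_0] vanishes on [A] only if [k_0 = 0]. *)
Lemma minimal_pair_gt0 : (0 < n)%N.
Proof.
rewrite lt0n; apply/eqP => n0; move: x k xk; rewrite n0 => x' k' [x1 xk' k0 _].
have x00 : x' ord0 != 0.
  apply/eqP => x0; have := x1 ord0 ord0; rewrite x0 dot0l eqxx => /eqP.
  by rewrite eq_sym oner_eq0.
have k00 : k' ord0 = 0.
  apply: (orbit_orth0 dotN Aalg Atr x00) => X /xk'.
  by rewrite /pairing big_ord1.
have := k0 (fun=> 1) ord0; rewrite big_ord1 k00 scaler0 => /(_ erefl)/eqP.
by rewrite oner_eq0.
Qed.

(** For an eigenvalue [l] of the transpose of [a], the columns of [a - l%:M] are dependent, hence so
    are the vectors [z j] that they form from the [x i]. Their pairing with [k] vanishes on [A], so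
    minimality makes them 0, and the [x i] are orthonormal. *)
Lemma minimal_pair_scalar (a : 'M[R[i]]_n.+1) :
  (forall X, A X -> \sum_i \sum_j a i j * dot (X (x i)) (k j) = 0) ->
  exists l, a = l%:M.
Proof.
move=> aX; have [x1 xk' _ kmin] := xk.
have [l ev] : exists l, root (char_poly a^T) l.
  by apply: closed_rootP; rewrite size_char_poly.
move: ev; rewrite -eigenvalue_root_char => /eigenvalueP[v av v0].
exists l.
have [j vj] : exists j, v 0 j != 0.
  apply/existsP; apply: contraT; rewrite negb_exists => /forallP v00.
  case/eqP: v0; apply/rowP => j; rewrite mxE.
  by have := v00 j; rewrite negbK => /eqP.
pose b := a - l%:M.
have bE i j' : b i j' = a i j' - l * (i == j')%:R by rewrite !mxE mulr_natr.
pose z j := \sum_i b i j *: x i.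
have z0 : forall i, z i = 0.
  apply: (kmin z (fun i => v 0 i) j vj).
    rewrite /z; under eq_bigr do rewrite scaler_sumr.
    rewrite exchange_big big1 //= => i _.
    under eq_bigr do rewrite scalerA.
    rewrite -scaler_suml; set s := \sum__ _; suff -> : s = 0 by rewrite scale0r.
    have := congr1 (fun M : 'rV_n.+1 => M 0 i) av; rewrite !mxE => avi.
    have -> : s = \sum_j v 0 j * a i j - l * v 0 i.
      rewrite /s; under eq_bigr do rewrite bE mulrBr.
      rewrite big_split /= sumrN.
      have -> : \sum_j v 0 j * (l * (i == j)%:R) = l * v 0 i.
        rewrite (bigD1 i) //= eqxx mulr1 mulrC big1 ?addr0 // => m mi.
        by rewrite eq_sym (negPf mi) !mulr0.
      by [].
    rewrite -avi; apply/eqP; rewrite subr_eq0; apply/eqP/eq_bigr => m _.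
    by rewrite mxE.
  move=> X AX; have lX := alg_linear Aalg AX; rewrite /pairing.
  have E j' : dot (X (z j')) (k j') =
      \sum_i a i j' * dot (X (x i)) (k j') - l * dot (X (x j')) (k j').
    rewrite (linsumf _ _ _ lX) dot_suml.
    under eq_bigr do rewrite (linZf lX) dotZl bE mulrBl.
    rewrite big_split /= sumrN.
    have -> : \sum_i l * (i == j')%:R * dot (X (x i)) (k j') = l * dot (X (x j')) (k j').
      rewrite (bigD1 j') //= eqxx mulr1 big1 ?addr0 // => m mj.
      by rewrite (negPf mj) mulr0 mul0r.
    by [].
  under eq_bigr do rewrite E.
  rewrite big_split /= sumrN -mulr_sumr [\sum_i dot _ _](xk' X AX) mulr0 subr0 exchange_big.
  exact: aX.
apply/eqP; rewrite -subr_eq0 -/b; apply/eqP/matrixP => i m; rewrite [RHS]mxE.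
have := congr1 (fun y => dot y (x i)) (z0 m); rewrite dot0l dot_suml (bigD1 i) //=.
rewrite dotZl x1 eqxx mulr1 big1 ?addr0 // => i' ii'.
by rewrite dotZl x1 (negPf ii') mulr0.
Qed.

End MinimalPair.
End Annihilator.

(** * Right factorization *)

Section Right.
Variables (R : realType) (H : completeNormedModType R[i]).
Variable dot : {dot H for Num.conj}.
Hypothesis dotN : induces_norm dot.
Implicit Types (x y z : H) (X Y T : H -> H).

Lemma bounded_unital : unital_subalgebra (@bounded_operator R H).
Proof.
split=> //.
- apply: (@bounded_operatorI _ _ _ 1); [by move=> c x y|exact: ler01|].
  by move=> x; rewrite mul1r.
- move=> c S T /bounded_operatorP[lS [M M0 SM]] /bounded_operatorP[lT [N N0 TN]].
  apply: (@bounded_operatorI _ _ _ (nrm c * M + N)).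
  + move=> a x y; rewrite !fctE lS lT !scalerDr !scalerA [c * a]mulrC.
    by rewrite -!scalerA addrACA.
  + by rewrite addr_ge0 // mulr_ge0 ?nrm_ge0.
  + move=> x; rewrite !fctE (le_trans (nrmD _ _)) // mulrDl lerD //.
    by rewrite nrmZ -mulrA ler_wpM2l ?nrm_ge0.
- move=> S T /bounded_operatorP[lS [M M0 SM]] /bounded_operatorP[lT [N N0 TN]].
  apply: (@bounded_operatorI _ _ _ (M * N)); last exact: opbound_comp.
    exact: lin_comp.
  exact: mulr_ge0.
Qed.

Variable A : set (H -> H).
Hypothesis Aalg : unital_subalgebra A.
Hypothesis Atr : transitive_algebra dot A.
Hypothesis Acl : WOT_closed dot A.

Section Pair.
Variables (n : nat) (x k : 'I_n.+1 -> H).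
Hypothesis xk : minimal_pair dot A x k.

(** A linear form that separates [D] from the matrices of [A] would be given by a matrix that
    annihilates [A], hence by a scalar one. It would be a multiple of the trace, which is 0 on
    [D]. *)
Lemma minimal_pair_trace0 (D : 'M[R[i]]_n.+1) : \tr D = 0 ->
  exists2 X, A X & forall i j, dot (X (x i)) (k j) = D i j.
Proof.
move=> trD.
pose M X : 'M[R[i]]_n.+1 := \matrix_(i, j) dot (X (x i)) (k j).
pose L : set 'rV[R[i]]_(n.+1 * n.+1) := [set mxvec (M X) | X in A].
have [[X AX XD]|nLD] := pselect (L (mxvec D)).
  exists X => // i j; have := congr1 (fun v => vec_mx v i j) XD.
  by rewrite !mxvecK mxE.
have [||c cL] := @row_space_separation _ _ L (mxvec D) _ _ nLD.
- exists (fun=> 0); first exact: alg0.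
  by apply/rowP => i; case/mxvec_indexP: i => i j; rewrite mxvecE !mxE dot0l.
- move=> c _ _ [X AX <-] [Y AY <-].
  exists (fun x => c *: X x + Y x); first exact: alg_lin.
  rewrite -linearZ -raddfD; congr mxvec; apply/matrixP => i j.
  by rewrite !mxE dotDl dotZl.
pose a : 'M[R[i]]_n.+1 := \matrix_(i, j) c (mxvec_index i j) 0.
have cE (N : 'M[R[i]]_n.+1) : (mxvec N *m c) 0 0 = \sum_i \sum_j a i j * N i j.
  rewrite mxE (reindex _ (curry_mxvec_bij n.+1 n.+1)) pair_bigA /=.
  by apply: eq_bigr => -[i j] _ /=; rewrite mxvecE !mxE mulrC.
have [l al] : exists l, a = l%:M.
  apply: (minimal_pair_scalar Aalg xk) => X AX.
  have : (mxvec (M X) *m c) 0 0 = 0 by rewrite cL ?mxE //; exists X.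
  rewrite cE => E; rewrite -[RHS]E; apply: eq_bigr => i _; apply: eq_bigr => j _.
  by rewrite [M X i j]mxE.
case/eqP; apply/matrixP => i j; rewrite !ord1 cE mxE al.
transitivity (l * \tr D); last by rewrite trD mulr0.
rewrite /mxtrace mulr_sumr; apply: eq_bigr => i' _.
rewrite (bigD1 i') //= !mxE eqxx mulr1n big1 ?addr0 // => j' jj.
by rewrite !mxE eq_sym (negPf jj) mul0r.
Qed.

Section Scale.
Variable kk : 'I_n.+1 -> H.
Hypothesis kA : forall Y, A Y -> \sum_i dot (Y (x i)) (kk i) = 0.
Hypothesis kx : forall i j, dot (x i) (kk j) =
  if i == j then (if i == ord0 then n%:R else -1) else 0.
Hypothesis Aright : right_partial_factorization dot A.

Let n0 : (0 < n)%N := minimal_pair_gt0 dotN Aalg Atr xk.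

(** [S] is built so that [S x_i = r_i x_i] and its adjoint sends [x_i] to [h_i / r_i], with [h_i] a
    multiple of [kk i]. Factor it by [U] and put [V = U']. The first membership gives [B = U' S];
    the second, composed with [Y] and paired with [kk], gives the last relation. *)
Lemma right_family (s : R) : 0 < s ->
  exists (r : R) (B V : H -> H), [/\ 0 < r, A B, forall y, nrm (V y) = nrm y,
    forall i, B (x i) = (if i == ord0 then r else 1)%:C *: V (x i) &
    forall Y, A Y -> s%:C * r%:C * dot (Y (x ord0)) (V (x ord0)) =
       \sum_(i < n) dot (Y (x (lift ord0 i))) (V (x (lift ord0 i)))].
Proof.
move=> s0.
(* The factors [g] make the diagonal [n, -1, ..., -1] positive, as the square roots [r] and the
   invertibility of [S] require. The parameter [s] enters only through the entry at [ord0]. *)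
pose d (j : 'I_n.+1) : R := if j == ord0 then n%:R / s else 1.
have d0 j : 0 < d j.
  by rewrite /d; case: ifP => // _; rewrite divr_gt0 // ltr0n.
pose g (j : 'I_n.+1) : R := if j == ord0 then s^-1 else -1.
pose h j := (g j)%:C *: kk j.
have [x1 xk' _ _] := xk.
have xh i j : dot (x i) (h j) = (i == j)%:R * (d j)%:C.
  rewrite /h dotZr kx; have [->|ij] := eqVneq i j; last by rewrite mulr0 mul0r.
  rewrite mul1r conj_Creal ?complex_real // /g /d; case: ifP => _.
    by rewrite -(rmorph_nat (real_complex R)) -rmorphM mulrC.
  by rewrite -(rmorph1 (real_complex R)) -!rmorphN -rmorphM mulrNN mulr1.
pose r j := Num.sqrt (d j).
have r0 j : 0 < r j by rewrite sqrtr_gt0.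
have rC j : (r j)%:C != 0 by rewrite -(rmorph0 (real_complex R)) (inj_eq (@complexI R)) gt_eqF.
have rr j : (d j)%:C = (r j)%:C * (r j)%:C by rewrite -rmorphM -expr2 sqr_sqrtr ?ltW.
pose P u := u - \sum_j 1 *: (dot u (x j) *: x j).
pose S u := \sum_j (r j)%:C^-1 *: (dot u (h j) *: x j) + P u.
(* Coefficients of the inverse: [u = S' v] has to satisfy [dot u (h j) = r_j * dot v (x j)], and the
   part [P v] already contributes [dot (P v) (h j)]. *)
pose b v j := (dot v (x j) * (r j)%:C - dot (P v) (h j)) / (d j)%:C.
pose S' v := P v + \sum_j b v j *: x j.
have dsum (c : 'I_n.+1 -> R[i]) j : dot (\sum_i c i *: x i) (x j) = c j.
  rewrite dot_suml (bigD1 j) //= dotZl x1 eqxx mulr1 big1 ?addr0 // => i ij.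
  by rewrite dotZl x1 (negPf ij) mulr0.
have hsum (c : 'I_n.+1 -> R[i]) j : dot (\sum_i c i *: x i) (h j) = c j * (d j)%:C.
  rewrite dot_suml (bigD1 j) //= dotZl xh eqxx mul1r big1 ?addr0 // => i ij.
  by rewrite dotZl xh (negPf ij) mul0r mulr0.
have PE u : P u = u - \sum_j dot u (x j) *: x j.
  by rewrite /P; under eq_bigr do rewrite scale1r.
have uE u : u = \sum_j dot u (x j) *: x j + P u by rewrite PE addrC subrK.
have Px u j : dot (P u) (x j) = 0 by rewrite PE dotBl dsum subrr.
have PP u : P (P u) = P u.
  by rewrite PE big1 ?subr0 // => j _; rewrite Px scale0r.
have Psum (c : 'I_n.+1 -> R[i]) : P (\sum_i c i *: x i) = 0.
  by rewrite PE; under [X in _ - X]eq_bigr do rewrite dsum; rewrite subrr.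
have PD u v : P (u + v) = P u + P v.
  rewrite !PE; under eq_bigr do rewrite dotDl scalerDl.
  by rewrite big_split /= opprD addrACA.
have SE u : S u = \sum_j ((r j)%:C^-1 * dot u (h j)) *: x j + P u.
  by rewrite /S; under eq_bigr do rewrite scalerA.
have Sx u j : dot u (h j) = (r j)%:C * dot (S u) (x j).
  by rewrite SE dotDl dsum Px addr0 mulrA mulfV // mul1r.
have SS' v : S (S' v) = v.
  rewrite SE /S' PD PP Psum addr0 [RHS]uE.
  congr (_ + _); apply: eq_bigr => j _; congr (_ *: _).
  rewrite dotDl hsum /b divfK; last by rewrite rr mulf_neq0.
  by rewrite addrC subrK mulrCA mulVf ?mulr1.
have S'S u : S' (S u) = u.
  have PS : P (S u) = P u by rewrite SE PD Psum add0r PP.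
  rewrite /S' PS [RHS]uE addrC.
  congr (_ + _); apply: eq_bigr => j _; congr (_ *: _).
  rewrite /b PS [X in X - _]mulrC -Sx.
  by rewrite -dotBl {1}[u]uE addrK hsum mulfK // rr mulf_neq0.
have BU := bounded_unital.
have Pb : bounded_operator P.
  apply: (algB BU); first exact: (alg_id BU).
  by apply: (alg_sum BU) => j; exact: rank_one_bounded.
have Sb : bounded_operator S.
  by apply: (algD BU) => //; apply: (alg_sum BU) => j; exact: rank_one_bounded.
have S'b : bounded_operator S'.
  apply: (algD BU) => //.
  have : bounded_operator (fun v => \sum_j (d j)%:C^-1 *:
      ((r j)%:C *: (dot v (x j) *: x j) - dot (P v) (h j) *: x j)).
    apply: (alg_sum BU) => j; apply: (algB BU).
      by apply: (algZ BU); exact: rank_one_bounded.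
    exact: (alg_comp BU (rank_one_bounded dotN (h j) (x j)) Pb).
  congr bounded_operator; apply/funext => v; apply: eq_bigr => j _.
  by rewrite /b mulrC -scalerA scalerBl [dot v _ * _]mulrC scalerA.
have Sinv : inverse_operators S S' by split=> //; apply/funext => u; rewrite /= ?SS' ?S'S.
have [U [U' [[Ub [U'' U''a [_ U''iso]]] U'a AUS AS'U]]] := Aright Sinv.
have U'E : U' = U''.
  by apply/funext => y; apply: (dot_injr dotN) => z; rewrite -U'a -U''a.
have Sxi i : S (x i) = (r i)%:C *: x i.
  rewrite SE (bigD1 i) //= big1 ?addr0 => [|j ji]; last first.
    by rewrite xh eq_sym (negPf ji) mul0r mulr0 scale0r.
  rewrite xh eqxx mul1r rr mulrA mulVf // mul1r.
  have -> : P (x i) = 0; last by rewrite addr0.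
  rewrite PE (bigD1 i) //= x1 eqxx scale1r big1 ?addr0 ?subrr // => j ji.
  by rewrite x1 eq_sym (negPf ji) scale0r.
have r1 i : r (lift ord0 i) = 1 by rewrite /r /d /= sqrtr1.
have lU' : linear U' := adjoint_linear dotN U'a.
exists (r ord0), (U' \o S), U'; split=> //.
- by move=> y; rewrite U'E /nrm U''iso.
- move=> i; rewrite /= Sxi (linZf lU').
  by case: (unliftP ord0 i) => [j|] -> //=; rewrite r1.
move=> Y AY.
have := kA (alg_comp Aalg AS'U AY); rewrite big_ord_recl.
have key i : dot (S' (U (Y (x i)))) (h i) = (r i)%:C * dot (Y (x i)) (U' (x i)).
  by rewrite Sx SS' U'a.
have kh0 : kk ord0 = s%:C *: h ord0.
  by rewrite /h /g eqxx scalerA -rmorphM mulfV ?gt_eqF // scale1r.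
have khj i : kk (lift ord0 i) = - h (lift ord0 i).
  by rewrite /h /g /= rmorphN rmorph1 scaleN1r opprK.
rewrite /= {1}kh0 dotZr key conj_Creal ?complex_real // mulrA => /eqP.
rewrite addr_eq0 => /eqP ->; rewrite -sumrN; apply: eq_bigr => i _.
by rewrite khj dotNr key r1 mul1r opprK.
Qed.

Hypothesis Hsep : separable_space H.

Lemma right_contradiction : False.
Proof.
have [x1 _ _ _] := xk.
have exf (s : {s : R | 0 < s}) := right_family (svalP s).
have [r exB] := boolp.choice exf.
have [B exV] := boolp.choice exB.
have [V VP] := boolp.choice exV.
pose v s := V s (x ord0).
have v1 s : nrm (v s) = 1.
  have [_ _ Viso _ _] := VP s; rewrite /v Viso.
  apply/eqP; rewrite -(@eqrXn2 _ 2) ?nrm_ge0 // expr1n.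
  by rewrite -(inj_eq (@complexI R)) -(dotxx dotN) x1 eqxx.
(* Apply the relation for [s] to [B t] and the one for [t] to [B s]. The right sides are conjugate
   to each other, so [(s - t) r_s r_t] times the inner product vanishes. *)
have vo s t : sval s != sval t -> dot (v s) (v t) = 0.
  move=> st.
  have [rs ABs _ Bs Es] := VP s; have [rt ABt _ Bt Et] := VP t.
  have := Es _ ABt; have := Et _ ABs.
  rewrite !Bs !Bt /= !dotZl -/(v s) -/(v t).
  have -> : \sum_(i < n) dot (B t (x (lift ord0 i))) (V s (x (lift ord0 i))) =
            Num.conj (\sum_(i < n) dot (B s (x (lift ord0 i))) (V t (x (lift ord0 i)))).
    rewrite rmorph_sum; apply: eq_bigr => i _ /=.
    by rewrite Bs Bt /= !scale1r -dotC.
  move=> <- /eqP.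
  have cR (q : R) : Num.conj q%:C = q%:C by rewrite conj_Creal ?complex_real.
  rewrite !rmorphM /= !cR -dotC.
  set p := dot (v t) (v s).
  have -> : (sval s)%:C * (r s)%:C * ((r t)%:C * p) = (sval s)%:C * ((r s)%:C * (r t)%:C * p).
    by ring.
  have -> : (sval t)%:C * (r t)%:C * ((r s)%:C * p) = (sval t)%:C * ((r s)%:C * (r t)%:C * p).
    by ring.
  rewrite -subr_eq0 -mulrBl -rmorphB !mulf_eq0.
  rewrite !(inj_eq (@complexI R) _ 0) subr_eq0 (negPf st).
  rewrite (gt_eqF (_ : 0 < r s)) // (gt_eqF (_ : 0 < r t)) //=.
  by move=> /eqP p0; rewrite dotC -/p p0 rmorph0.
have [D cD dD] := Hsep.
(* Orthogonal unit vectors are at distance [sqrt 2 > 1], so a point of [D] within 1/2 of [v s]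
   determines [s]. The interval from 0 to 1 would then be countable, against its Lebesgue
   measure. *)
have exd s : exists d, D d /\ nrm (v s - d) < 2^-1.
  by have [d Dd vd] := dense_nclosure dD (v s) (ltac:(by rewrite invr_gt0) : 0 < 2^-1); exists d.
have [d dP] := boolp.choice exd.
have dinj s t : d s = d t -> sval s = sval t.
  move=> dst; apply/eqP; apply: contraT => st.
  have := nrmB2 dotN (v s) (v t); rewrite vo // !v1 /= mul0rn subr0 expr1n.
  have := nrm_triangle (d s) (v s) (v t).
  have := (dP s).2; have := (dP t).2; rewrite -dst (nrmBC (v t)).
  have := nrm_ge0 (v s - v t); nra.
pose P : set R := [set s | 0 < s].
have : countable P.
  pose w (s : R) : H := if pselect (0 < s) is left p then d (exist _ s p) else 0.
  have winj : {in P &, injective w}.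
    move=> s t; rewrite !inE /P /= => s0 t0; rewrite /w.
    case: pselect => // p; case: pselect => // q.
    by move=> /dinj.
  have wD s : P s -> D (w s).
    by rewrite /P /w /= => s0; case: pselect => // p; have [] := dP (exist _ s p).
  have [f finj] := countable_injP _ cD.
  apply/countable_injP; exists (f \o w) => s t sP tP /= /finj wst.
  by apply: winj => //; apply: wst; rewrite inE; apply: wD; rewrite -inE.
move=> cP.
have : countable (`]0, 1[%classic : set R).
  apply: (@sub_countable _ _ _ P) => //; apply: subset_card_le => s /=.
  by rewrite in_itv /= => /andP[].
move=> /(@countable_lebesgue_measure0 R).
rewrite lebesgue_measure_itv /= lte_fin ltr01 oppr0 adde0 => /eqP.
by rewrite eqe oner_eq0.
Qed.

End Scale.

End Pair.

Lemma right_case : separable_space H -> right_partial_factorization dot A ->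
  A = @bounded_operator R H.
Proof.
move=> Hsep Aright; apply: contrapT => algB.
have [n [x [k xk]]] := minimal_pair_exists dotN Aalg Acl algB.
pose D : 'M[R[i]]_n.+1 :=
  \matrix_(i, j) (if i == j then (if i == ord0 then n%:R else -1) else 0).
have [|X AX XD] := minimal_pair_trace0 xk (D := D).
  rewrite /mxtrace big_ord_recl mxE eqxx.
  under eq_bigr do rewrite mxE eqxx /=.
  by rewrite sumr_const card_ord mulNrn subrr.
have [M M0 XM] := alg_opbound Aalg AX.
have [X' [_ _ X'a]] := adjoint_exists dotN (alg_linear Aalg AX) M0 XM.
(* Composing the annihilating functional with [X] replaces [k] by [X' \o k], whose inner products
   with the [x i] are the entries of [D]. *)
apply: (@right_contradiction n x k xk (X' \o k)) => //.
- move=> Y AY; have [_ kA _ _] := xk.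
  by rewrite -[RHS](kA _ (alg_comp Aalg AX AY)); apply: eq_bigr => i _; rewrite -X'a.
- by move=> i j; rewrite /= -X'a XD mxE.
Qed.

End Right.

(** * Diagonal projections *)

Definition agree_below (l : nat) (s t : nat -> bool) := forall i, (i < l)%N -> s i = t i.

(* Baire category: otherwise a nested sequence of cylinders would leave every
   [G ^~ m], whereas their common point satisfies one of them. *)
Lemma cylinder_pigeonhole (G : (nat -> bool) -> nat -> Prop) :
  (forall s, exists m, G s m) ->
  exists m l s0, forall l' s', (l <= l')%N -> agree_below l s0 s' ->
    exists2 s, agree_below l' s' s & G s m.
Proof.
move=> Gex; apply: contrapT => no.
have step (m : nat) (p : nat * (nat -> bool)) : exists q : nat * (nat -> bool),
    [/\ (p.1 < q.1)%N, agree_below p.1 p.2 q.2 & forall s, agree_below q.1 q.2 s -> ~ G s m].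
  apply: contrapT => nq; apply: no; exists m, p.1, p.2 => l' s' ll' ps'.
  apply: contrapT => ns; apply: nq; exists (l'.+1, s'); split=> //.
  move=> s s's Gsm; apply: ns; exists s => // i il'; apply: s's.
  exact: ltnW.
have [f fP] := boolp.choice (fun mp => step mp.1 mp.2).
pose st := fix st m : nat * (nat -> bool) :=
  if m is m'.+1 then f (m', st m') else (0%N, fun=> false).
have stP m : [/\ ((st m).1 < (st m.+1).1)%N, agree_below (st m).1 (st m).2 (st m.+1).2 &
    forall s, agree_below (st m.+1).1 (st m.+1).2 s -> ~ G s m] := fP (m, st m).
have stl m k : ((st m).1 <= (st (m + k)%N).1)%N /\ agree_below (st m).1 (st m).2 (st (m + k)%N).2.
  elim: k => [|k [IH1 IH2]]; first by rewrite addn0.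
  have [h1 h2 _] := stP (m + k)%N; rewrite addnS; split; first exact: leq_trans IH1 (ltnW h1).
  by move=> j jm; rewrite IH2 // h2 // (leq_trans jm IH1).
have stg m : (m <= (st m).1)%N.
  by elim: m => // m IH; have [h _ _] := stP m; exact: leq_ltn_trans IH h.
(* Lengths increase strictly, so stage [i.+1] already fixes coordinate [i]; [s] lies in every
   cylinder. *)
pose s i := (st i.+1).2 i.
have sP m : agree_below (st m).1 (st m).2 s.
  move=> i im; rewrite /s; have [mi|im'] := leqP m i.+1.
    by have [_ h] := stl m (i.+1 - m)%N; rewrite h ?subnKC.
  have [_ h] := stl i.+1 (m - i.+1)%N; rewrite subnKC in h; last exact: ltnW.
  by rewrite -h //; exact: stg.
have [m Gm] := Gex s.
by have [_ _] := stP m; move/(_ s); apply.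
Qed.

Section Diagonal.
Variables (R : realType) (H : completeNormedModType R[i]).
Variable dot : {dot H for Num.conj}.
Hypothesis dotN : induces_norm dot.
Implicit Types (x y z : H) (X Y T : H -> H).

Lemma dense_sequence : separable_space H ->
  exists d : nat -> H, forall x (e : R), 0 < e -> exists n, nrm (x - d n) < e.
Proof.
case=> D /countable_injP[f finj] dD.
pose d n := if pselect (exists2 x, D x & f x = n) is left p then s2val (cid2 p) else 0.
exists d => x e e0; have [z Dz zx] := dense_nclosure dD x e0.
exists (f z); rewrite /d; case: pselect => [p|[]]; last by exists z.
case: (cid2 p) => w /= Dw fw; suff -> : w = z by [].
by apply: finj; rewrite ?inE.
Qed.

Variable d : nat -> H.
Hypothesis dd : forall x (e : R), 0 < e -> exists n, nrm (x - d n) < e.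

Notation e := (gs dot d).

Definition partial_proj (N : nat) z := \sum_(i < N) dot z (e i) *: e i.

Lemma partial_proj_linear N : linear (partial_proj N).
Proof.
move=> c x y; rewrite /partial_proj scaler_sumr -big_split; apply: eq_bigr => i _ /=.
by rewrite dotDl dotZl scalerDl scalerA.
Qed.

Lemma partial_proj_gs N i : partial_proj N (e i) = if (i < N)%N then e i else 0.
Proof.
rewrite /partial_proj; case: ifPn => [iN|]; last rewrite -leqNgt => iN.
  rewrite (bigD1 (Ordinal iN)) //= gs_proj // big1 ?addr0 // => j ji.
  rewrite gs_orth ?scale0r //; apply: contra ji => /eqP ij.
  by apply/eqP/val_inj; rewrite /= ij.
apply: big1 => j _; rewrite gs_orth ?scale0r //.
by apply: contraTneq iN => ->; rewrite -ltnNge.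
Qed.

Lemma partial_proj_orth_gs N z (i : nat) : (i < N)%N ->
  dot (z - partial_proj N z) (e i) = 0.
Proof.
move=> iN; rewrite dotBl /partial_proj dot_suml (bigD1 (Ordinal iN)) //= big1 => [|j ji].
  rewrite addr0 dotZl [X in _ - X](_ : _ = dot z (e i)) ?subrr //.
  by rewrite -[in RHS](gs_proj dotN d i) dotZr -dotC mulrC.
by rewrite dotZl gs_orth ?mulr0.
Qed.

Lemma partial_proj_orth N z : dot (z - partial_proj N z) (partial_proj N z) = 0.
Proof.
rewrite {2}/partial_proj dot_sumr big1 // => i _.
by rewrite dotZr partial_proj_orth_gs ?mulr0.
Qed.

Lemma partial_proj_pyth N z :
  nrm z ^+ 2 = nrm (z - partial_proj N z) ^+ 2 + nrm (partial_proj N z) ^+ 2.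
Proof. by rewrite -(pythagoras dotN) ?partial_proj_orth // subrK. Qed.

Lemma partial_proj_compl_le N z : nrm (z - partial_proj N z) <= nrm z.
Proof.
rewrite -(@ler_pXn2r _ 2) ?nnegrE ?nrm_ge0 // [leRHS](partial_proj_pyth N) lerDl.
exact: sqr_ge0.
Qed.

Lemma partial_proj_d n N : (n < N)%N -> partial_proj N (d n) = d n.
Proof. by move=> nN; rewrite /partial_proj -gs_expand. Qed.

Lemma partial_proj_approx z (r : R) : 0 < r ->
  exists N, forall M, (N <= M)%N -> nrm (z - partial_proj M z) < r.
Proof.
move=> r0; have [n zn] := dd z r0; exists n.+1 => M nM.
apply: le_lt_trans zn; have -> : z - partial_proj M z = (z - d n) - partial_proj M (z - d n).
  by rewrite (linBf (partial_proj_linear M)) (partial_proj_d nM) opprB addrA subrK.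
exact: partial_proj_compl_le.
Qed.

(** Identities between diagonal operators can thus be checked on the vectors [e n]. *)
Lemma gs_total T (M : R) : linear T -> opbound T M -> (forall n, T (e n) = 0) -> T =1 (fun=> 0).
Proof.
move=> lT TM Te z; apply/eqP; rewrite -nrm_eq0; apply/eqP/le_anti; rewrite nrm_ge0 andbT.
have M0 : 0 <= `|M| by [].
apply: (@le_eps R) => r r0; rewrite add0r.
have [|N /(_ N (leqnn _)) zN] := @partial_proj_approx z (r / (`|M| + 1)).
  by rewrite divr_gt0 // ltr_wpDl.
have -> : T z = T (z - partial_proj N z).
  rewrite (linBf lT) (linsumf _ _ _ lT) big1 ?subr0 // => i _.
  by rewrite (linZf lT) Te scaler0.
move: zN; rewrite ltr_pdivlMr ?ltr_wpDl //.
have := TM (z - partial_proj N z); have := ler_norm M; have := nrm_ge0 (z - partial_proj N z).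
nra.
Qed.

Definition gs_span (s : nat -> bool) : set H :=
  [set z | exists N (c : nat -> R[i]), z = \sum_(i < N | s i) c i *: e i].

Lemma gs_span_subspace s : subspace_set (gs_span s).
Proof.
split; first by exists 0%N, (fun=> 0); rewrite big_ord0.
move=> c _ _ [N [a ->]] [N' [b ->]].
pose ext M (f : nat -> R[i]) i := if (i < M)%N then f i else 0.
exists (N + N')%N, (fun i => c * ext N a i + ext N' b i).
have extE M M' (f : nat -> R[i]) : (M <= M')%N ->
    \sum_(i < M | s i) f i *: e i = \sum_(i < M' | s i) ext M f i *: e i.
  move=> MM'; rewrite -(big_mkord s (fun i => f i *: e i)).
  rewrite -(big_mkord s (fun i => ext M f i *: e i)) (big_cat_nat (leq0n M) MM') /=.
  rewrite [X in _ + X]big_nat_cond [X in _ + X]big1 ?addr0; last first.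
    by move=> i /andP[/andP[Mi _] _]; rewrite /ext ltnNge Mi scale0r.
  rewrite !big_mkord; apply: eq_bigr => i _; by rewrite /ext ltn_ord.
rewrite (extE N (N + N')%N) ?leq_addr // (extE N' (N + N')%N) ?leq_addl //.
rewrite scaler_sumr -big_split; apply: eq_bigr => i _ /=.
by rewrite scalerDl scalerA.
Qed.

Lemma diag_proj_exists s : exists Q, [/\ linear Q, opbound Q 1, is_adjoint dot Q Q &
  forall n, Q (e n) = if s n then e n else 0].
Proof.
have [Q [[lQ Q1 diag_projK Qa] [QL Qid]]] :=
  proj_op dotN (nclosure_subspace (gs_span_subspace s)) (@nclosureK _ _ _).
exists Q; split=> // n; case: ifPn => sn.
  apply/Qid/nclosure_sub; exists n.+1, (fun i => (i == n)%:R).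
  rewrite (bigD1 ord_max) //= eqxx scale1r big1 ?addr0 // => i /andP[_ ni].
  by rewrite (_ : (val i == n) = false) ?scale0r //; apply: contraNF ni => /eqP ni; apply/eqP/val_inj.
apply: (dotxx_eq0 dotN); rewrite Qa -Qa.
have orth w : nclosure (gs_span s) w -> dot (e n) w = 0.
  move=> wL; apply/eqP; rewrite -nrm_eq0; apply/eqP/le_anti; rewrite nrm_ge0 andbT.
  apply: (@le_eps R) => r r0; rewrite add0r.
  have [|v [N [c vE]] wv] := wL (r / (nrm (e n) + 1)).
    by rewrite divr_gt0 // ltr_wpDl // nrm_ge0.
  have -> : dot (e n) w = dot (e n) (w - v).
    rewrite dotBr [X in _ - X](_ : _ = 0) ?subr0 // vE dot_sumr big1 // => i si.
    by rewrite dotZr gs_orth ?mulr0 //; apply: contraNneq sn => ->.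
  move: wv; rewrite ltr_pdivlMr ?ltr_wpDl ?nrm_ge0 //.
  have := cauchy_schwarz dotN (e n) (w - v).
  have := nrm_ge0 (w - v); nra.
by rewrite Qa orth // !Qid //; apply: QL.
Qed.

End Diagonal.

(** * Compact operators and almost fixed vectors *)

Section Compact.
Variables (R : realType) (H : completeNormedModType R[i]).
Variable dot : {dot H for Num.conj}.
Hypothesis dotN : induces_norm dot.
Implicit Types (x y z : H) (X Y T K : H -> H).

(** Complete continuity: bounded weak limits are sent to norm limits. On a Hilbert space this is
    compactness, because balls are weakly compact. Arbitrary index types are allowed since the
    finite covers below use nets of finite families. *)
Definition compact_op K := forall (I : Type) (F : set_system I) (u : I -> H) x (M : R),
  UltraFilter F -> (forall k, nrm (u k) <= M) -> weak_cvg dot F u x ->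
  forall e : R, 0 < e -> F [set k | nrm (K (u k) - K x) < e].

Lemma compact_rank_one a b : compact_op (fun u => dot u a *: b).
Proof.
move=> I F u x M FU uM ux e e0.
have FP := @ultra_proper _ F FU.
have b1 : 0 < nrm b + 1 by rewrite ltr_wpDl // nrm_ge0.
have /cvgC_nrmP/(_ (e / (nrm b + 1)) (divr_gt0 e0 b1)) := ux a.
apply: filterS => k /=; rewrite -scalerBl nrmZ ltr_pdivlMr //.
have := nrm_ge0 (dot (u k) a - dot x a); have := nrm_ge0 b; nra.
Qed.

Lemma compact_add K K' : compact_op K -> compact_op K' -> compact_op (fun x => K x + K' x).
Proof.
move=> cK cK' I F u x M FU uM ux e e0.
have FP := @ultra_proper _ F FU.
have e2 : 0 < e / 2 by rewrite divr_gt0.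
apply: filterS (filterI (cK _ _ _ _ _ FU uM ux _ e2) (cK' _ _ _ _ _ FU uM ux _ e2)) => k [/=].
rewrite opprD addrACA => h1 h2; apply: (le_lt_trans (nrmD _ _)); lra.
Qed.

Lemma compact_compl T K : bounded_operator T -> compact_op K -> compact_op (T \o K).
Proof.
move=> /bounded_operatorP[lT [N N0 TN]] cK I F u x M FU uM ux e e0.
have FP := @ultra_proper _ F FU.
have N1 : 0 < N + 1 by rewrite ltr_wpDl.
apply: filterS (cK _ _ _ _ _ FU uM ux _ (divr_gt0 e0 N1)) => k /=.
rewrite -(linBf lT) ltr_pdivlMr //; have := TN (K (u k) - K x).
have := nrm_ge0 (K (u k) - K x); nra.
Qed.

Lemma compact_compr T K : bounded_operator T -> compact_op K -> compact_op (K \o T).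
Proof.
move=> /bounded_operatorP[lT [N N0 TN]] cK I F u x M FU uM ux e e0.
have [T' [_ _ Ta]] := adjoint_exists dotN lT N0 TN.
have TuM k : nrm (T (u k)) <= N * M by rewrite (le_trans (TN _)) // ler_wpM2l.
have Tux : weak_cvg dot F (T \o u) (T x).
  by move=> y; rewrite Ta (_ : (fun k => _) = (fun k => dot (u k) (T' y))) //; apply/funext => k; rewrite /= Ta.
exact: (cK I F (T \o u) (T x) (N * M) FU TuM Tux e e0).
Qed.

Lemma compact_scale c K : compact_op K -> compact_op (fun x => c *: K x).
Proof.
move=> cK; apply: (@compact_compl (fun x => c *: x) K) => //.
apply: (@bounded_operatorI _ _ _ (nrm c)); last by move=> x; rewrite nrmZ.
  by move=> a x y; rewrite scalerDr !scalerA mulrC.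
exact: nrm_ge0.
Qed.

Lemma compact_0 : compact_op (fun=> 0).
Proof.
move=> I F u x M FU uM ux e e0; have FP := @ultra_proper _ F FU.
by apply: filterS filterT => k _ /=; rewrite subrr nrm0.
Qed.

Lemma compact_sum (J : Type) (r : seq J) (c : J -> R[i]) (K : J -> H -> H) :
  (forall j, compact_op (K j)) -> compact_op (fun x => \sum_(j <- r) c j *: K j x).
Proof.
move=> cK; elim: r => [|j r IH].
  by under eq_fun do rewrite big_nil; exact: compact_0.
by under eq_fun do rewrite big_cons; apply: compact_add => //; apply: compact_scale.
Qed.

Lemma compact_approx T : linear T -> (forall e : R, 0 < e -> exists K, compact_op K /\
  opbound (fun x => T x - K x) e) -> compact_op T.
Proof.
move=> lT Tap I F u x M FU uM ux e e0.
have FP := @ultra_proper _ F FU.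
have M1 : 0 < 3 * (`|M| + 1) by rewrite mulr_gt0 // ltr_wpDl.
have xM : nrm x <= M by apply: (weak_nrm_le dotN FU ux); apply: filterS filterT => k _; apply: uM.
have [K [cK TK]] := Tap _ (divr_gt0 e0 M1).
have e3 : 0 < e / 3 by rewrite divr_gt0.
have small z : nrm z <= M -> nrm (T z - K z) < e / 3.
  move=> zM; apply: (le_lt_trans (TK z)); rewrite mulrAC ltr_pdivrMr //.
  by have := ler_norm M; have := nrm_ge0 z; nra.
apply: filterS (cK _ _ _ _ _ FU uM ux _ e3) => k /= Kk.
have := nrm_triangle (K (u k)) (T (u k)) (T x).
have := nrm_triangle (K x) (K (u k)) (T x); have := small _ xM; have := small _ (uM k).
by rewrite (nrmBC (T x)); lra.
Qed.

End Compact.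

(** * Contractions in [A] that are close to compact ones and almost fix a vector *)

Section NearFixed.
Variables (R : realType) (H : completeNormedModType R[i]).
Variable dot : {dot H for Num.conj}.
Hypothesis dotN : induces_norm dot.
Implicit Types (x y z : H) (X Y T K : H -> H).
Variable A : set (H -> H).
Hypothesis Aalg : unital_subalgebra A.
Hypothesis Acl : WOT_closed dot A.
Hypothesis Aleft : left_partial_factorization dot A.
Variable d : nat -> H.
Hypothesis dd : forall x (e : R), 0 < e -> exists n, nrm (x - d n) < e.
Notation e := (gs dot d).

Variable Q : (nat -> bool) -> H -> H.
Hypothesis QP : forall s, [/\ linear (Q s), opbound (Q s) 1, is_adjoint dot (Q s) (Q s) &
  forall n, Q s (e n) = if s n then e n else 0].

(** Continuity of [s |-> Q s z] on the Cantor space: both projections agree on a finite section that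
    approximates [z]. *)
Lemma diag_proj_agree z (r : R) : 0 < r ->
  exists N, forall s t, agree_below N s t -> nrm (Q s z - Q t z) < r.
Proof.
move=> r0; have r2 : 0 < r / 2 by rewrite divr_gt0.
have [N /(_ N (leqnn _)) zN] := partial_proj_approx dotN dd z r2.
exists N => s t st.
have [lQs Qs1 _ Qse] := QP s; have [lQt Qt1 _ Qte] := QP t.
have E : Q s (partial_proj dot d N z) = Q t (partial_proj dot d N z).
  rewrite (linsumf _ _ _ lQs) (linsumf _ _ _ lQt); apply: eq_bigr => i _.
  by rewrite (linZf lQs) (linZf lQt) Qse Qte st.
have -> : Q s z - Q t z = Q s (z - partial_proj dot d N z) - Q t (z - partial_proj dot d N z).
  by rewrite (linBf lQs) (linBf lQt) E opprB addrA subrK.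
apply: (le_lt_trans (nrmB _ _)).
have := Qs1 (z - partial_proj dot d N z); have := Qt1 (z - partial_proj dot d N z).
by rewrite !mul1r; lra.
Qed.

Let S s z := z + Q s z.
Let S' s z := z - 2^-1%:C *: Q s z.

Lemma diag_projK s z : Q s (Q s z) = Q s z.
Proof.
have [lQ Q1 _ Qe] := QP s.
apply/eqP; rewrite -subr_eq0; apply/eqP.
apply: (@gs_total _ _ _ dotN d dd (fun z => Q s (Q s z) - Q s z) 2) => [c x y|x|n].
- rewrite !(linDf lQ) !(linZf lQ) scalerBr.
  by rewrite opprD addrACA.
- apply: (le_trans (nrmB _ _)); have := Q1 (Q s x); have := Q1 x; rewrite !mul1r; lra.
- by rewrite Qe; case: ifP => sn; rewrite ?Qe ?sn ?subrr // (lin0 lQ) subrr.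
Qed.

Lemma diag_inverse_operators s : inverse_operators (S s) (S' s).
Proof.
have [lQ Q1 _ Qe] := QP s.
have BU := @bounded_unital R H.
have Qb : bounded_operator (Q s) by apply: (@bounded_operatorI _ _ _ 1).
have half : (2^-1%:C + 2^-1%:C : R[i]) = 1.
  by rewrite -rmorphD -(rmorph1 (real_complex R)); congr (_ %:C); lra.
have QS' z : Q s (S' s z) = 2^-1%:C *: Q s z.
  rewrite /S' (linBf lQ) (linZf lQ) diag_projK -[X in X - _]scale1r -half scalerDl addrK //.
split.
- by apply: (algD BU) => //; exact: (alg_id BU).
- by apply: (algB BU); [exact: (alg_id BU)|exact: (algZ BU)].
- by apply/funext => z; rewrite /= {1}/S QS' /S' subrK.
- apply/funext => z; rewrite /= /S' /S (linDf lQ) diag_projK scalerDr -scalerDl half scale1r.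
  by rewrite addrK.
Qed.

Theorem near_fixed x (r : R) : nrm x = 1 -> 0 < r -> exists X, [/\ A X, opbound X 1,
  nrm (X x - x) <= r & exists K, [/\ linear K, compact_op dot K & opbound (fun x => X x - K x) 2^-1]].
Proof.
move=> x1 r0.
have [U UP] := boolp.choice (fun s => Aleft (diag_inverse_operators s)).
have [U' UP'] := boolp.choice UP.
have UU s : [/\ linear (U s), opbound (U s) 1, forall z, nrm (U s z) = nrm z &
    is_adjoint dot (U s) (U' s)].
  have [[Ub Uiso] Ua _ _] := UP' s.
  have iso z : nrm (U s z) = nrm z by rewrite /nrm Uiso.
  have [lU _] := Ub; split=> // z.
  by rewrite iso mul1r.
have r2 : 0 < r ^+ 2 / 10 by rewrite divr_gt0 // exprn_gt0.
(* The last estimate bounds the squared displacement of [x] by [10 q]; [q <= 1/10] keeps [1 - 3 q]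
   positive, so that squares can be compared. *)
pose q := Num.min (10^-1) (r ^+ 2 / 10).
have q0 : 0 < q by rewrite lt_min r2 invr_gt0 ltr0n.
have q1 : q <= 10^-1 by rewrite ge_min lexx.
have qr : q <= r ^+ 2 / 10 by rewrite ge_min lexx orbT.
(* Countably many balls around the [d m] receive all vectors [U s x], so one of them does so for a
   set of [s] dense in some cylinder. *)
have [m [l [s0 Gs]]] := @cylinder_pigeonhole (fun s m => nrm (U s x - d m) < q)
  (fun s => dd (U s x) q0).
set y := d m in Gs.
have [N0 yP] := partial_proj_approx dotN dd y q0.
pose l' := maxn l N0; have {}yP := yP l' (leq_maxr _ _).
(* The two sequences share a head, long enough for [P] to almost fix [y], and differ everywhere
   beyond it. Each is a limit of indices [s] with [U s x] near [y]. *)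
pose z b i := if (i < l')%N then s0 i else b.
have exs b (k : nat) : exists s, agree_below (l' + k) (z b) s /\ nrm (U s x - y) < q.
  have [||s zs Us] := Gs (l' + k)%N (z b); last by exists s.
    by rewrite (leq_trans (leq_maxl l N0)) // leq_addr.
  by move=> j jl; rewrite /z (leq_trans jl) // leq_maxl.
have [sg sgP] := boolp.choice (fun bk : bool * nat => exs bk.1 bk.2).
have [F [FU subF]] := @ultraFilterLemma nat \oo _.
have FP := @ultra_proper _ F FU.
have W_ex b : exists W, [/\ linear W, opbound W 1 & wot_cvg dot F (fun k => U (sg (b, k))) W].
  by apply: (ultra_wot dotN FU) => // k; have [] := UU (sg (b, k)).
have Qlim b v (c : R) : 0 < c -> F [set k | nrm (Q (sg (b, k)) v - Q (z b) v) < c].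
  move=> c0; have [N NP] := diag_proj_agree v c0; apply: subF; exists N => // k /= Nk.
  rewrite nrmBC; apply: NP => j jN; have [h _] := sgP (b, k); apply: h => /=.
  by rewrite (leq_trans jN) // (leq_trans Nk) // leq_addl.
have Slim b v : (fun k => S (sg (b, k)) v) @ F --> S (z b) v.
  apply/cvg_nrmP => c c0; apply: filterS (Qlim b v c c0) => k /=.
  by rewrite /S opprD addrACA subrr add0r.
have S'lim b v : (fun k => S' (sg (b, k)) v) @ F --> S' (z b) v.
  apply/cvg_nrmP => c c0; apply: filterS (Qlim b v c c0) => k /=.
  rewrite /S' opprD addrACA subrr add0r opprK addrC -scalerBr nrmZ nrmBC => h.
  by rewrite nrmC ger0_norm ?invr_ge0 // ; move: (nrm_ge0 (Q (sg (b, k)) v - Q (z b) v)); lra.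
have SB s := diag_inverse_operators s.
have [W1 [lW1 W11 cW1]] := W_ex false.
have [W2 [lW2 W21 cW2]] := W_ex true.
have [W1' [lW1' W1'1 W1a]] := adjoint_exists dotN lW1 ler01 W11.
have Ux1 b k v : nrm (U (sg (b, k)) v) <= nrm v by have [_ _ -> _] := UU (sg (b, k)).
have bW1' : bounded_operator W1' by apply: (@bounded_operatorI _ _ _ 1).
have bW2 : bounded_operator W2 by apply: (@bounded_operatorI _ _ _ 1).
have BU := @bounded_unital R H.
(* [S s] converges strongly and [U s] weakly. Moving [U' s] across the inner product reduces the
   limit of [U' s \o S s] to the mixed case. *)
have AX1 : A (W1' \o S (z false)).
  have [Sb _ _ _] := SB (z false).
  apply: (alg_wot_lim Aalg Acl FP (Y := fun k => U' (sg (false, k)) \o S (sg (false, k)))).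
  - by move=> k; have [_ _ ? _] := UP' (sg (false, k)).
  - exact: (alg_comp BU bW1' Sb).
  move=> u v /=.
  have E k : dot (U' (sg (false, k)) (S (sg (false, k)) u)) v =
      Num.conj (dot (U (sg (false, k)) v) (S (sg (false, k)) u)).
    by have [_ _ _ ->] := UU (sg (false, k)); rewrite -dotC.
  rewrite (funext E) dotC -W1a; apply: (ucv_conj FU).
  by apply: (weak_dot dotN FU (M := nrm v)) => [k||]; [exact: Ux1|exact: cW1|exact: Slim].
have AX2 : A (S' (z true) \o W2).
  have [_ Sb _ _] := SB (z true).
  apply: (alg_wot_lim Aalg Acl FP (Y := fun k => S' (sg (true, k)) \o U (sg (true, k)))).
  - by move=> k; have [_ _ _ ?] := UP' (sg (true, k)).
  - exact: (alg_comp BU Sb bW2).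
  have S'a s u v : dot (S' s u) v = dot u (S' s v).
    have [_ _ Qa _] := QP s.
    by rewrite /S' dotBl dotBr dotZl dotZr Qa conj_Creal ?complex_real.
  move=> u v /=; rewrite S'a; under eq_fun do rewrite S'a.
  by apply: (weak_dot dotN FU (M := nrm u)) => [k||]; [exact: Ux1|exact: cW2|exact: S'lim].
pose P := partial_proj dot d l'.
have lP : linear P := partial_proj_linear dot d l'.
have P1 v : nrm (P v) <= nrm v.
  rewrite -(@ler_pXn2r _ 2) ?nnegrE ?nrm_ge0 // [leRHS](partial_proj_pyth dotN d l') lerDr.
  exact: sqr_ge0.
have bP : bounded_operator P.
  by apply: (@bounded_operatorI _ _ _ 1) => // v; rewrite mul1r.
have half : (2^-1%:C + 2^-1%:C : R[i]) = 1.
  by rewrite -rmorphD -(rmorph1 (real_complex R)); congr (_ %:C); lra.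
have hh (v : H) : v - 2^-1%:C *: v = 2^-1%:C *: v.
  by rewrite -[X in X - _]scale1r -half scalerDl addrK.
have bD : bounded_operator (fun v => S (z false) (S' (z true) v) -
    (2^-1%:C *: v + 2^-1%:C *: P v)).
  have [S1 _ _ _] := SB (z false); have [_ S2 _ _] := SB (z true).
  apply: (algB BU); first exact: (alg_comp BU S1 S2).
  by apply: (algD BU); apply: (algZ BU) => //; exact: (alg_id BU).
(* On [e n] with [n < l'] the two factors are inverse to each other; beyond [l'] the first is 1 and
   the second 1/2. *)
have DE v : S (z false) (S' (z true) v) = 2^-1%:C *: v + 2^-1%:C *: P v.
  move/bounded_operatorP: bD => [lD [M _ DM]]; apply/eqP; rewrite -subr_eq0; apply/eqP.
  apply: (gs_total dotN dd lD DM) => n.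
  have [lQ _ _ Qe] := QP (z false); have [_ _ _ Qe'] := QP (z true).
  rewrite /S' Qe' /P partial_proj_gs // /z.
  case: ltnP => nl'; last first.
    rewrite /S (linBf lQ) (linZf lQ) Qe /z ltnNge nl' /= scaler0 !subr0 !addr0.
    by rewrite hh subrr.
  rewrite -[X in X - (_ + _)](_ : e n = _) ; last first.
    case sn : (s0 n).
      rewrite /S (linBf lQ) (linZf lQ) Qe /z nl' sn.
      by rewrite hh -scalerDl half scale1r.
    by rewrite /S scaler0 subr0 Qe /z nl' sn addr0.
  by rewrite -scalerDl half scale1r subrr.
have h2 v : nrm (2^-1%:C *: v) = nrm v / 2.
  by rewrite nrmZ nrmC ger0_norm ?invr_ge0 // mulrC.
pose X := (W1' \o S (z false)) \o (S' (z true) \o W2).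
have XE v : X v = W1' (2^-1%:C *: W2 v + 2^-1%:C *: P (W2 v)) by rewrite /X /= DE.
have X1 : opbound X 1.
  move=> v; rewrite XE; apply: (le_trans (W1'1 _)).
  have := nrmD (2^-1%:C *: W2 v) (2^-1%:C *: P (W2 v)).
  have := P1 (W2 v); have := W21 v; rewrite !h2 !mul1r; lra.
exists X; split=> //.
- exact: (alg_comp Aalg).
- have near b W : wot_cvg dot F (fun k => U (sg (b, k))) W -> nrm (W x - y) <= q.
    move=> cW; apply: (@weak_nrm_le _ _ _ dotN _ _ FU (fun k => U (sg (b, k)) x - y)).
      by apply: (weak_cvgB FU); [exact: cW|exact: weak_cst].
    by apply: filterS filterT => k _; have [_ /ltW] := sgP (b, k).
  have := near _ _ cW1; have := near _ _ cW2 => n2 n1.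
  have y1 : 1 - q <= nrm y.
    have [_ h] := sgP (true, 0%N); have [_ _ Uiso _] := UU (sg (true, 0%N)).
    by have := nrmB y (y - U (sg (true, 0%N)) x); rewrite subKr Uiso x1 nrmBC; move: h; rewrite /=; lra.
  pose D v := 2^-1%:C *: v + 2^-1%:C *: P v.
  have Dn v : nrm (D v) <= nrm v.
    have := nrmD (2^-1%:C *: v) (2^-1%:C *: P v); have := P1 v; rewrite !h2 /D; lra.
  have Dy : nrm (D (W2 x) - y) <= 2 * q.
    have -> : D (W2 x) - y = D (W2 x - y) - 2^-1%:C *: (y - P y).
      rewrite /D (linBf lP) !scalerBr -[in LHS](scale1r y) -half scalerDl.
      rewrite [in RHS]opprB [RHS]addrA -[X in _ = X - _]addrA subrK opprD addrA.
      by congr (_ - _); rewrite addrAC.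
    have := nrmB (D (W2 x - y)) (2^-1%:C *: (y - P y)).
    have := Dn (W2 x - y); rewrite h2; lra.
  (* [dot (X x) x] equals [dot (D (W2 x)) (W1 x)], an inner product of two vectors that are within
     [3 q] of each other and have norm almost 1. *)
  have := contraction_fixed dotN x X1; rewrite x1 XE -/(D (W2 x)).
  rewrite dotC -W1a -dotC.
  have := nrmB2 dotN (D (W2 x)) (W1 x).
  have : nrm (D (W2 x) - W1 x) <= 3 * q.
    by have := nrm_triangle y (D (W2 x)) (W1 x); rewrite (nrmBC y); lra.
  have : 1 - 3 * q <= nrm (D (W2 x)).
    by have := nrmB (D (W2 x)) (D (W2 x) - y); rewrite subKr; lra.
  have : 1 - 2 * q <= nrm (W1 x).
    by have := nrmB (W1 x) (W1 x - y); rewrite subKr; lra.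
  have := nrm_ge0 (D (W2 x) - W1 x).
  set a := nrm (_ - W1 x); set b := nrm (D _); set c := nrm (W1 x); set g := complex.Re _.
  move=> a0 c1 b1 a3 Ea; rewrite expr1n => hX.
  rewrite -(@ler_pXn2r _ 2) ?nnegrE ?nrm_ge0 ?(ltW r0) //; apply: (le_trans hX).
  have c2 : (1 - 2 * q) ^+ 2 <= c ^+ 2 by rewrite ler_pXn2r ?nnegrE //; lra.
  have b2 : (1 - 3 * q) ^+ 2 <= b ^+ 2 by rewrite ler_pXn2r ?nnegrE //; lra.
  have a2 : a ^+ 2 <= (3 * q) ^+ 2 by rewrite ler_pXn2r ?nnegrE //; lra.
  move: c2 b2 a2; rewrite Ea; nra.
- exists (W1' \o (fun v => 2^-1%:C *: (P \o W2) v)); split.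
  - apply: lin_comp => // c u v /=.
    by rewrite (linDf lW2) (linZf lW2) (linDf lP) (linZf lP) scalerDr !scalerA mulrC.
  - apply: (compact_compl bW1'); apply: compact_scale; apply: (compact_compr dotN bW2).
    have := compact_sum (index_enum 'I_l') (fun=> 1) (fun i => compact_rank_one (dot := dot) (e i) (e i)).
    by congr compact_op; apply/funext => v; apply: eq_bigr => i _; rewrite scale1r.
  - move=> v; rewrite XE /= -(linBf lW1') addrK.
  by apply: (le_trans (W1'1 _)); rewrite mul1r h2 mulrC ler_pM2l ?invr_gt0 // -[leRHS]mul1r.
Qed.


End NearFixed.

(** * Infinite products of almost fixing contractions *)

Section CompactNearFixed.
Variables (R : realType) (H : completeNormedModType R[i]).
Variable dot : {dot H for Num.conj}.
Hypothesis dotN : induces_norm dot.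
Implicit Types (x y z : H) (X Y T K : H -> H).
Variable A : set (H -> H).
Hypothesis Aalg : unital_subalgebra A.
Hypothesis Acl : WOT_closed dot A.

Lemma half_pow_small (e : R) : 0 < e -> exists l, 2^-1 ^+ l < e.
Proof.
move=> e0; have [N NP] := archi_inv e0; exists N.
apply: le_lt_trans (NP N (leqnn _)).
by rewrite exprVn lef_pV2 ?posrE ?exprn_gt0 // -natrX ler_nat ltn_expl.
Qed.

Theorem compact_near_fixed x : (forall r : R, 0 < r -> exists X, [/\ A X, opbound X 1,
    nrm (X x - x) <= r & exists K, [/\ linear K, compact_op dot K & opbound (fun x => X x - K x) 2^-1]]) ->
  forall r : R, 0 < r -> exists Z,
    [/\ A Z, opbound Z 1, compact_op dot Z & nrm (Z x - x) <= r].
Proof.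
move=> near r r0.
have h0 l : 0 < (2^-1 : R) ^+ l by rewrite exprn_gt0 // invr_gt0.
(* The displacements [r * 2^-(l + 1)] add up to at most [r]. *)
have [X XP] := boolp.choice (fun l => near _ (mulr_gt0 r0 (h0 l.+1))).
have AX l : A (X l) by have [] := XP l.
(* [P l k] is the product of [k] factors starting with [X l]. New factors come on the right, so
   [P 0 l] stays a fixed left factor through which weak limits pass. *)
pose P := fix P l k := if k is k'.+1 then P l k' \o X (l + k')%N else idfun.
have PS l k : P l k.+1 = P l k \o X (l + k)%N by [].
have AP l k : A (P l k).
  by elim: k => [|k IH]; [exact: (alg_id Aalg)|exact: (alg_comp Aalg)].
have P1 l k : opbound (P l k) 1.
  elim: k => [|k IH] v; first by rewrite mul1r.
  have [_ X1 _ _] := XP (l + k)%N; rewrite PS /= mul1r.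
  by have := IH (X (l + k)%N v); have := X1 v; rewrite !mul1r => h1 /le_trans; apply.
have lP l k : linear (P l k) := alg_linear Aalg (AP l k).
have Pcat l k v : P 0%N (l + k)%N v = P 0%N l (P l k v).
  elim: k v => [|k IH] v; first by rewrite addn0.
  by rewrite addnS !PS /= add0n IH.
(* If [P = C + E] and [X l = K + E'] with [C], [K] compact, then [P K + C E'] is compact and differs
   from [P X l] by [E E']; the errors multiply. *)
have PC l : exists C, compact_op dot C /\ opbound (fun v => P 0%N l v - C v) (2^-1 ^+ l).
  elim: l => [|l [C [cC PC]]].
    exists (fun=> 0); split; first exact: compact_0.
    by move=> v; rewrite subr0 expr0 mul1r.
  have [_ X1 _ [K [lK cK XK]]] := XP l.
  exists (fun v => P 0%N l (K v) + C (X l v - K v)); split.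
    apply: compact_add.
      by apply: (compact_compl (T := P 0%N l)) => //; apply: (alg_bounded Aalg).
    apply: (compact_compr dotN (T := fun v => X l v - K v)) => //.
    apply: (@bounded_operatorI _ _ _ 2^-1) => // c u v.
    rewrite (linDf lK) (linZf lK) (linDf (alg_linear Aalg (AX l))) (linZf (alg_linear Aalg (AX l))).
    by rewrite scalerBr opprD addrACA.
  move=> v; rewrite PS /= add0n opprD addrA -(linBf (lP _ _)).
  apply: (le_trans (PC _)); rewrite exprSr -mulrA.
  by apply: ler_wpM2l; [exact: ltW|exact: XK].
have [C CP] := boolp.choice PC.
have [F [FU subF]] := @ultraFilterLemma nat \oo _.
have FP := @ultra_proper _ F FU.
have [Z [lZ Z1 cZ]] := ultra_wot dotN FU ler01 (lP 0%N) (P1 0%N).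
have [T TP] := boolp.choice (fun l => ultra_wot dotN FU ler01
  (fun k => lP l (k - l)%N) (fun k => P1 l (k - l)%N)).
have ZE l v : Z v = P 0%N l (T l v).
  have [lT T1 cT] := TP l.
  apply: (weak_unique dotN FU (u := fun k => P 0%N k v)); first exact: cZ.
  move=> w; have [P' [_ _ Pa]] := adjoint_exists dotN (lP 0%N l) ler01 (P1 0%N l).
  rewrite Pa; apply: cvg_trans (cT v (P' w)).
  apply: near_eq_cvg; apply: subF; exists l => // k /= lk.
  by rewrite -Pa -Pcat subnKC.
exists Z; split.
- by apply: (alg_wot_lim Aalg Acl FP (AP 0%N)) => //; apply: (@bounded_operatorI _ _ _ 1).
- exact: Z1.
- apply: (compact_approx dotN lZ) => e e0; have [l le] := half_pow_small e0.
  have [cC CPl] := CP l; have [lT T1 _] := TP l.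
  exists (C l \o T l); split.
    by apply: (compact_compr dotN) => //; apply: (@bounded_operatorI _ _ _ 1).
  move=> v /=; rewrite (ZE l); apply: (le_trans (CPl _)).
  apply: ler_pM; [exact: ltW|exact: nrm_ge0|exact: ltW|].
  by have := T1 v; rewrite mul1r.
have Px k : nrm (P 0%N k x - x) <= r * (1 - 2^-1 ^+ k).
  elim: k => [|k IH]; first by rewrite subrr nrm0 expr0 subrr mulr0.
  have [_ _ Xx _] := XP k.
  have := nrm_triangle (P 0%N k x) (P 0%N k (X k x)) x.
  rewrite PS /= add0n -(linBf (lP _ _)); have := P1 0%N k (X k x - x).
  by move: Xx IH; rewrite mul1r !exprS; lra.
apply: (@weak_nrm_le _ _ _ dotN _ _ FU (fun k => P 0%N k x - x)).
  by apply: (weak_cvgB FU); [exact: cZ|exact: weak_cst].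
apply: filterS filterT => k _ /=; apply: (le_trans (Px k)).
by rewrite ler_piMr // ?ltW // gerBl ltW.
Qed.

End CompactNearFixed.

(** * Lomonosov's lemma *)

(* Finite families in [U], directed by inclusion, index a net of counterexamples;
   an ultrafilter on them replaces any topology on [T]. *)
Lemma ultra_finite_cover (T U : Type) (P : T -> U -> Prop) :
  (forall (F : set_system {n & 'I_n -> U}) (y : {n & 'I_n -> U} -> T), UltraFilter F ->
     exists w, F [set s | P (y s) w]) ->
  exists n (f : 'I_n -> U), forall y, exists i, P y (f i).
Proof.
move=> Pu; apply: contrapT => no.
pose mem w (s : {n & 'I_n -> U}) := exists i, projT2 s i = w.
have ex s : exists y, forall w, mem w s -> ~ P y w.
  case: s => n f; apply: contrapT => ny; apply: no; exists n, f => y.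
  apply: contrapT => nP; apply: ny; exists y => w [j <-] Pw; apply: nP.
  by exists j.
have [y yP] := boolp.choice ex.
pose F0 : set_system {n & 'I_n -> U} :=
  [set Q | exists s0, forall s, (forall w, mem w s0 -> mem w s) -> Q s].
have F0P : ProperFilter F0.
  split; last split.
  - by case=> s /(_ s); apply.
  - by exists (existT _ 0%N (fun i : 'I_0 => match i with Ordinal _ j => False_rect U (notF j) end)).
  - move=> Q Q' [[n f] sQ] [[n' f'] sQ'].
    pose g (i : 'I_(n + n')) := match fintype.split i with inl j => f j | inr j => f' j end.
    exists (existT _ (n + n')%N g) => s ms; split; [apply: sQ|apply: sQ'] => w [j /= jw]; apply: ms.
      by exists (lshift n' j); rewrite /= /g (unsplitK (inl j)).
    by exists (rshift n j); rewrite /= /g (unsplitK (inr j)).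
  - by move=> Q Q' QQ' [s sQ]; exists s => t /sQ/QQ'.
have [F [FU subF]] := @ultraFilterLemma _ F0 F0P.
have FP := @ultra_proper _ F FU.
have [w Fw] := Pu F y FU.
have Fm : F [set s | mem w s].
  apply: subF; exists (existT _ 1%N (fun=> w)) => s; apply.
  by exists ord0.
have [s [Pw mw]] := @filter_ex _ F FP _ (@filterI _ F _ _ _ Fw Fm).
exact: yP Pw.
Qed.

Section Lomonosov.
Variables (R : realType) (H : completeNormedModType R[i]).
Variable dot : {dot H for Num.conj}.
Hypothesis dotN : induces_norm dot.
Implicit Types (x y z : H) (X Y T K : H -> H).
Variable A : set (H -> H).
Hypothesis Aalg : unital_subalgebra A.
Hypothesis Atr : transitive_algebra dot A.
Variables (x : H) (Z : H -> H).
Hypothesis x1 : nrm x = 1.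
Hypothesis AZ' : A Z.
Hypothesis Z1 : opbound Z 1.
Hypothesis Zc : compact_op dot Z.
Hypothesis Zx : nrm (Z x - x) <= 4^-1.

Let B y := nrm (y - x) <= 4^-1.

Let Bx : B x. Proof. by rewrite /B subrr nrm0 invr_ge0. Qed.

Let B2 y : B y -> nrm y <= 2.
Proof. by rewrite /B => By; have := nrmD (y - x) x; rewrite subrK x1; lra. Qed.

Let B0 y : B y -> y != 0.
Proof.
rewrite /B => By; rewrite -nrm_eq0; apply/eqP => y0.
by have := nrmB y (y - x); rewrite subKr x1; lra.
Qed.

(** For [y] in the ball, [Z y] is within 1/4 + 1/4 of the unit vector [x]. *)
Let ZB0 y : B y -> Z y != 0.
Proof.
rewrite /B => By; rewrite -nrm_eq0; apply/eqP => y0.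
have := Z1 (y - x); rewrite (linBf (alg_linear Aalg AZ')) mul1r => h1.
have h2 := nrm_triangle (Z x) (Z y) x.
have := nrmB (Z y) (Z y - x); rewrite subKr x1 y0 add0r => h3.
have := le_trans h3 (le_trans h2 (lerD (le_trans h1 By) Zx)); lra.
Qed.

Lemma ball_limit (I : Type) (F : set_system I) (u : I -> H) : UltraFilter F ->
  (forall k, B (u k)) -> exists y, [/\ B y, weak_cvg dot F u y &
    forall e : R, 0 < e -> F [set k | nrm (Z (u k) - Z y) < e]].
Proof.
move=> FU uB; have FP := @ultra_proper _ F FU.
have u2 k : nrm (u k) <= 2 by exact: B2.
have [y uy] := ultra_weak dotN FU u2.
exists y; split=> // [|e e0]; last exact: (Zc FU u2 uy e0).
apply: (@weak_nrm_le _ _ _ dotN _ _ FU (fun k => u k - x)).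
  by apply: (weak_cvgB FU); [exact: uy|exact: weak_cst].
by apply: filterS filterT => k _; exact: uB.
Qed.

(** The image of the ball under [Z] is relatively compact and its limit points are again images,
    hence nonzero. Each is moved close to [x] by some operator of [A], which then works nearby, so
    finitely many suffice. *)
Lemma orbit_cover : exists n (Y : 'I_n -> H -> H), (forall i, A (Y i)) /\
  forall y, B y -> exists i, nrm (Y i (Z y) - x) < 4^-1.
Proof.
have [F y FU|n [f fP]] := @ultra_finite_cover {y | B y} (H -> H)
    (fun p Y => A Y /\ nrm (Y (Z (sval p)) - x) < 4^-1).
  have FP := @ultra_proper _ F FU.
  have [y0 [By0 _ Zy0]] := ball_limit FU (fun s => svalP (y s)).
  have [|Y AY Yx] := orbit_dense dotN Aalg Atr (ZB0 By0) x (e := 4^-1); first by rewrite invr_gt0.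
  have [M M0 YM] := alg_opbound Aalg AY; have lY := alg_linear Aalg AY.
  exists Y.
  pose e := (4^-1 - nrm (Y (Z y0) - x)) / (M + 1).
  have M1 : 0 < M + 1 by rewrite ltr_wpDl.
  have e0 : 0 < e by rewrite divr_gt0 // subr_gt0.
  apply: filterS (Zy0 e e0) => s /=; rewrite ltr_pdivlMr // => h; split=> //.
  have := nrm_triangle (Y (Z y0)) (Y (Z (sval (y s)))) x.
  rewrite -(linBf lY); have := YM (Z (sval (y s)) - Z y0).
  by have := nrm_ge0 (Z (sval (y s)) - Z y0); nra.
pose Y i := if pselect (A (f i)) is left _ then f i else idfun.
exists n, Y; split=> [j|y By].
  by rewrite /Y; case: pselect => // _; exact: alg_id.
have [j [Af fy]] := fP (exist _ y By); exists j; rewrite /Y.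
by case: pselect.
Qed.

(** The net is taken inside the ball, so that convex combinations of its points stay there. *)
Lemma image_net (Y : H -> H) (r : R) : A Y -> 0 < r ->
  exists n (v : 'I_n -> H), (forall l, B (v l)) /\
    forall y, B y -> B (Y (Z y)) -> exists l, nrm (Y (Z y) - v l) < r.
Proof.
move=> AY r0.
have [F y FU|n [f fP]] := @ultra_finite_cover {y | B y /\ B (Y (Z y))} H
    (fun p v => B v /\ nrm (Y (Z (sval p)) - v) < r).
  have FP := @ultra_proper _ F FU.
  have [y0 [By0 _ Zy0]] := ball_limit FU (fun s => (svalP (y s)).1).
  have [M M0 YM] := alg_opbound Aalg AY; have lY := alg_linear Aalg AY.
  have M1 : 0 < M + 1 by rewrite ltr_wpDl.
  have Yy (e : R) : 0 < e -> F [set s | nrm (Y (Z (sval (y s))) - Y (Z y0)) < e].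
    move=> e0; apply: filterS (Zy0 _ (divr_gt0 e0 M1)) => s /=; rewrite ltr_pdivlMr // => h.
    rewrite -(linBf lY); have := YM (Z (sval (y s)) - Z y0).
    by have := nrm_ge0 (Z (sval (y s)) - Z y0); nra.
  exists (Y (Z y0)); apply: filterS (Yy r r0) => s /= h; split=> //.
  apply: (@le_eps R) => e e0; have /filter_ex[t /= ht] := Yy e e0.
  have := nrm_triangle (Y (Z (sval (y t)))) (Y (Z y0)) x.
  by have := (svalP (y t)).2; rewrite (nrmBC (Y (Z y0)) (Y (Z (sval (y t))))) /B; lra.
pose v i := if pselect (B (f i)) is left _ then f i else x.
exists n, v; split=> [j|y By BYy].
  by rewrite /v; case: pselect.
have [j [Bf fy]] := fP (exist _ y (conj By BYy)); exists j; rewrite /v.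
by case: pselect.
Qed.

Section Family.
Variables (n : nat) (Y : 'I_n -> H -> H).
Hypothesis AY : forall i, A (Y i).
Hypothesis Ycover : forall y, B y -> exists i, nrm (Y i (Z y) - x) < 4^-1.

(** Schauder's argument. An index [j] pairs an operator [Y i] with a net point [v j], and [beta j]
    is positive only if [Y i (Z y)] is within [r] of [v j]. At an equilibrium [b] is proportional to
    [beta], so [y = \sum_j b_j v_j] is within [r] of the same combination of the [Y i (Z y)]. *)
Lemma approx_fixed (r : R) : 0 < r -> exists (a : 'I_n -> R) y,
  [/\ simplex a, B y & nrm (y - \sum_i (a i)%:C *: Y i (Z y)) <= r].
Proof.
move=> r0.
have [m mP] := boolp.choice (fun i => image_net (AY i) r0).
pose vv i := sval (cid (mP i)); have vvP i := svalP (cid (mP i)).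
pose J : finType := {i : 'I_n & 'I_(m i)}.
pose v (j : J) := vv (tag j) (tagged j).
have vB j : B (v j) by have [h _] := vvP (tag j); exact: h.
pose yb (b : J -> R) := \sum_j (b j)%:C *: v j.
have ybB b : simplex b -> B (yb b).
  move=> [b0 b1]; have -> : yb b = \sum_j (b j)%:C *: (v j - x) + x.
    under eq_bigr do rewrite scalerBr.
    by rewrite big_split /= sumrN -scaler_suml -rmorph_sum b1 rmorph1 scale1r subrK.
  rewrite /B addrK (le_trans (nrm_sum _ _ _)) // -[leRHS]mul1r -[X in X * _]b1 mulr_suml.
  apply: ler_sum => j _; rewrite nrmZ nrmC (ger0_norm (b0 j)).
  by apply: ler_wpM2l; [exact: b0|exact: vB].
pose pos (t : R) := Num.max 0 t.
have posL s t : `|pos s - pos t| <= `|s - t|.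
  rewrite /pos; case: (leP 0 s) => hs; case: (leP 0 t) => ht; rewrite ?subrr ?normr0 //.
  - by rewrite subr0 !ger0_norm //; lra.
  - by rewrite sub0r normrN ger0_norm // distrC ger0_norm; lra.
have pos0 t : 0 <= pos t by rewrite le_max lexx.
have posg t : 0 < pos t -> 0 < t by rewrite lt_max ltxx.
have pos_gt t : 0 < t -> 0 < pos t by rewrite lt_max orbC => ->.
pose h1 i y := pos (4^-1 - nrm (Y i (Z y) - x)).
pose h2 i w y := pos (r - nrm (Y i (Z y) - w)).
pose beta (j : J) b := h1 (tag j) (yb b) * h2 (tag j) (v j) (yb b).
have hit y : B y -> exists j, 0 < h1 (tag j) y * h2 (tag j) (v j) y.
  move=> By; have [j jy] := Ycover By.
  have [_ /(_ y By (ltW jy))[l lw]] := vvP j.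
  by exists (existT (fun i => 'I_(m i)) j l); rewrite mulr_gt0 // pos_gt // subr_gt0.
have [j0 _] := hit x Bx.
have [|j b e _ e0|b [bS bE]] := @simplex_equilibrium R J j0 beta.
- by move=> j b _; apply: mulr_ge0; exact: pos0.
- have [M M0 YM] := alg_opbound Aalg (alg_comp Aalg (AY (tag j)) AZ').
  have lYZ := alg_linear Aalg (alg_comp Aalg (AY (tag j)) AZ').
  (* A Lipschitz constant of [beta j]: net points have norm at most 2, both factors vary at rate
     [M * (#|J| * 2)], and they are bounded by 1 and [r]. *)
  pose K := (r + 1) * (M * (#|J|%:R * 2)).
  have K0 : 0 <= K.
    apply: mulr_ge0; first exact: addr_ge0 (ltW r0) ler01.
    by apply: mulr_ge0 => //; exact: mulr_ge0.
  have K1 : 0 < K + 1 by rewrite ltr_wpDl.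
  exists (e / (K + 1)); first exact: divr_gt0.
  set c := e / (K + 1) => b' _ bb'.
  have Kc : K * c < e.
    by rewrite /c mulrA ltr_pdivrMr // mulrC ltr_pM2l // ltrDl.
  have yy : nrm (yb b' - yb b) <= #|J|%:R * 2 * c.
    rewrite /yb -sumrB (le_trans (nrm_sum _ _ _)) //.
    rewrite -mulrA mulr_natl -sumr_const; apply: ler_sum => l _.
    rewrite -scalerBl -rmorphB nrmZ nrmC mulrC; apply: ler_pM; rewrite ?nrm_ge0 //.
      exact: B2.
    exact: ltW.
  have Yw w : `|nrm (Y (tag j) (Z (yb b')) - w) - nrm (Y (tag j) (Z (yb b)) - w)| <=
      M * (#|J|%:R * 2 * c).
    have : nrm (Y (tag j) (Z (yb b')) - Y (tag j) (Z (yb b))) <= M * (#|J|%:R * 2 * c).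
      have := linBf lYZ (yb b') (yb b) => /= <-.
      by apply: (le_trans (YM _)); rewrite ler_wpM2l.
    have := nrm_triangle (Y (tag j) (Z (yb b))) (Y (tag j) (Z (yb b'))) w.
    have := nrm_triangle (Y (tag j) (Z (yb b'))) (Y (tag j) (Z (yb b))) w.
    rewrite (nrmBC (Y (tag j) (Z (yb b))) (Y (tag j) (Z (yb b')))).
    by set D := M * _; rewrite ler_norml => *; apply/andP; split; lra.
  have p1 : `|h1 (tag j) (yb b') - h1 (tag j) (yb b)| <= M * (#|J|%:R * 2 * c).
    by apply: le_trans (posL _ _) _; rewrite opprD addrACA subrr add0r opprK addrC distrC.
  have p2 : `|h2 (tag j) (v j) (yb b') - h2 (tag j) (v j) (yb b)| <= M * (#|J|%:R * 2 * c).
    by apply: le_trans (posL _ _) _; rewrite opprD addrACA subrr add0r opprK addrC distrC.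
  have p3 : h1 (tag j) (yb b) <= 1.
    by rewrite ge_max ler01 /=; have := nrm_ge0 (Y (tag j) (Z (yb b)) - x); lra.
  have p4 : h2 (tag j) (v j) (yb b') <= r.
    by rewrite ge_max ltW //=; have := nrm_ge0 (Y (tag j) (Z (yb b')) - v j); lra.
  apply: le_lt_trans Kc; rewrite /beta.
  move: p1 p2 p3 p4 (pos0 (4^-1 - nrm (Y (tag j) (Z (yb b)) - x))) (pos0 (r - nrm (Y (tag j) (Z (yb b')) - v j))).
  rewrite -/(h1 (tag j) (yb b)) -/(h2 (tag j) (v j) (yb b')).
  rewrite /K; set D := M * _; have -> : (r + 1) * (M * (#|J|%:R * 2)) * c = (r + 1) * D.
    by rewrite /D; ring.
  set p := h1 _ _; set q := h2 _ _ _; set p' := h1 _ _; set q' := h2 _ _ _.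
  move=> pp qq p'1 q1 p'0 q0.
  have -> : p * q - p' * q' = (p - p') * q + p' * (q - q') by ring.
  apply: (le_trans (ler_normD _ _)); rewrite !normrM (ger0_norm q0) (ger0_norm p'0).
  have := normr_ge0 (p - p'); have := normr_ge0 (q - q'); nra.
have yB := ybB b bS.
have S0 : 0 < \sum_j beta j b.
  have [j jy] := hit _ yB; rewrite (bigD1 j) //= ltr_pwDl // sumr_ge0 // => *.
  by apply: mulr_ge0; exact: pos0.
pose a i := \sum_(j | tag j == i) b j.
exists a, (yb b); split=> //.
  split=> [i|]; first by apply: sumr_ge0 => j _; exact: bS.1.
  by rewrite -[RHS]bS.2 (partition_big (fun j : J => tag j) xpredT).
have -> : \sum_i (a i)%:C *: Y i (Z (yb b)) = \sum_j (b j)%:C *: Y (tag j) (Z (yb b)).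
  rewrite [RHS](partition_big (fun j : J => tag j) xpredT) //=; apply: eq_bigr => i _.
  by rewrite /a rmorph_sum scaler_suml; apply: eq_bigr => j /eqP ->.
rewrite {1}/yb -sumrB (le_trans (nrm_sum _ _ _)) // -[leRHS]mul1r -[X in X * _]bS.2 mulr_suml.
apply: ler_sum => j _; rewrite -scalerBr nrmZ nrmC ger0_norm ?bS.1 //.
have [->|bj] := eqVneq (b j) 0; first by rewrite !mul0r.
rewrite ler_wpM2l ?bS.1 //.
have : 0 < beta j b by rewrite bE mulr_gt0 // lt_def bj bS.1.
rewrite /beta => hh; have : 0 < h2 (tag j) (v j) (yb b).
  rewrite lt_def pos0 andbT; apply: contraTneq hh => ->.
  by rewrite mulr0 ltxx.
by move/posg; rewrite subr_gt0 nrmBC => /ltW.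
Qed.

(** The coefficients of the approximate fixed points depend on the point. Freezing their limits [c]
    gives a linear operator of [A], and compactness makes the approximate fixed points converge in
    norm to a fixed vector. *)
Lemma family_fixed : exists T y, [/\ A T, compact_op dot T, y != 0 & T y = y].
Proof.
have r0 k : 0 < k.+1%:R^-1 :> R by rewrite invr_gt0 ltr0n.
have [a aP] := boolp.choice (fun k => approx_fixed (r0 k)).
have [u uP] := boolp.choice aP.
have [F [FU subF]] := @ultraFilterLemma nat \oo _.
have FP := @ultra_proper _ F FU.
have [y [By uy Zy]] := ball_limit FU (fun k => let: And3 _ h _ := uP k in h).
have exc i : exists l : R, forall e, 0 < e -> F [set k | `|a k i - l| < e].
  apply: (ultra_lim_real FU (M := 1)) => k; have [[a0 a1] _ _] := uP k.
  by rewrite ger0_norm // -a1 (bigD1 i) //= lerDl sumr_ge0.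
have [c cP] := boolp.choice exc.
pose T z := \sum_i (c i)%:C *: (Y i \o Z) z.
have AT : A T by apply: (alg_sum Aalg) => i; exact: (alg_comp Aalg (AY i) AZ').
have cT : compact_op dot T.
  apply: compact_sum => i; exact: (compact_compl (alg_bounded Aalg (AY i)) Zc).
exists T, y; split; [exact: AT|exact: cT|exact: B0|].
have uB k : nrm (u k) <= 2 by have [_ h _] := uP k; exact: B2.
have [N NP] := boolp.choice (fun i => let: ex_intro2 N N0 YN :=
  alg_opbound Aalg (alg_comp Aalg (AY i) AZ') in ex_intro _ N (conj N0 YN)).
apply: (weak_unique dotN FU _ uy).
apply: (cvg_weak dotN FU); apply/cvg_nrmP => e e0.
have e3 : 0 < e / 3 by rewrite divr_gt0.
have N1 i : 0 < n.+1%:R * (N i * 2 + 1).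
  by have [N0 _] := NP i; rewrite mulr_gt0 // ltr_wpDl // mulr_ge0.
have near : F [set k | forall i, `|a k i - c i| < e / 3 / (n.+1%:R * (N i * 2 + 1))].
  apply: (@filter_forall _ _ (fun i => [set k | `|a k i - c i| < _])) => i.
  by apply: cP; rewrite divr_gt0.
have small : F [set k | k.+1%:R^-1 < e / 3].
  by apply: subF; have [N' N'P] := archi_inv e3; exists N' => // k /N'P.
apply: (filterS _ (filterI (filterI near small) (cT _ _ _ _ _ FU uB uy _ e3))).
move=> k [[/= kc kn] kT].
have [aS _ ua] := uP k.
have h : nrm (\sum_i (a k i)%:C *: Y i (Z (u k)) - T (u k)) <= e / 3.
  rewrite /T -sumrB (le_trans (nrm_sum _ _ _)) //.
  have : \sum_(i < n) e / 3 / n.+1%:R <= e / 3.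
    rewrite sumr_const card_ord -[leLHS]mulr_natr -[leLHS]mulrA ler_piMr ?(ltW e3) // mulrC.
    by rewrite ler_pdivrMr // mul1r ler_nat.
  apply: le_trans; apply: ler_sum => i _; have [N0 YN] := NP i.
  rewrite /= -scalerBl -rmorphB nrmZ nrmC.
  have := kc i; rewrite invfM mulrA ltr_pdivlMr ?ltr_wpDl ?mulr_ge0 //.
  set t := e / 3 / _ => ht; have := YN (u k); rewrite /= => hY.
  have hY2 : nrm (Y i (Z (u k))) <= N i * 2 by rewrite (le_trans hY) // ler_wpM2l.
  have := normr_ge0 (a k i - c i); nra.
have := nrm_triangle (\sum_i (a k i)%:C *: Y i (Z (u k))) (u k) (T (u k)).
have := nrm_triangle (T (u k)) (u k) (T y).
have := le_lt_trans ua kn; move: kT h; rewrite /=; lra.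
Qed.

End Family.

Theorem lomonosov : exists T y, [/\ A T, compact_op dot T, y != 0 & T y = y].
Proof. by have [n [Y [AY Yc]]] := orbit_cover; exact: (family_fixed AY Yc). Qed.

End Lomonosov.

(** * Resolvents of compact operators *)

Section FixedSpace.
Variables (R : realType) (H : completeNormedModType R[i]).
Variable dot : {dot H for Num.conj}.
Hypothesis dotN : induces_norm dot.
Implicit Types (x y z : H) (X Y T K : H -> H).

(* Riesz: a unit vector of the fixed space orthogonal to a finite 1/2-net of its
   unit ball would be at distance at least 1 from the net. *)
Lemma compact_fixed_space K : linear K -> compact_op dot K ->
  exists n (e : 'I_n -> H), forall u, K u = u -> u = \sum_i dot u (e i) *: e i.
Proof.
move=> lK cK.
have [F y FU|n [f fP]] := @ultra_finite_cover {u | K u = u /\ nrm u <= 1} H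
    (fun p v => K v = v /\ nrm (sval p - v) < 1).
  have FP := @ultra_proper _ F FU.
  have y1 s : nrm (sval (y s)) <= 1 by have [] := svalP (y s).
  have [u yu] := ultra_weak dotN FU y1.
  have yKu (e : R) : 0 < e -> F [set s | nrm (sval (y s) - K u) < e].
    by move=> e0; apply: filterS (cK _ _ _ _ _ FU y1 yu e e0) => s /=; have [-> _] := svalP (y s).
  have Ku : K u = u.
    by apply: (weak_unique dotN FU _ yu); apply: (cvg_weak dotN FU); apply/cvg_nrmP.
  exists u; apply: filterS (yKu 1 ltr01) => s /= h; split=> //.
  by rewrite -Ku.
(* Net points, padded by 0, so that all Gram-Schmidt vectors are fixed by [K]. *)
pose d i := if insub i is Some j then (if K (f j) == f j then f j else 0) else 0.
have Kd i : K (d i) = d i.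
  rewrite /d; case: insub => [j|]; last exact: (lin0 lK).
  by case: eqP => // _; exact: (lin0 lK).
have Ke i : K (gs dot d i) = gs dot d i.
  elim/ltn_ind: i => i IH; rewrite gsE /unit_of (linZf lK) (linBf lK) Kd (linsumf _ _ _ lK).
  congr (_ *: (_ - _)); apply: eq_bigr => j _; by rewrite (linZf lK) IH.
exists n, (fun i => gs dot d i) => u Ku; apply/eqP; rewrite -subr_eq0; apply: contraT => w0.
pose w := u - partial_proj dot d n u.
have wd i : (i < n)%N -> dot w (d i) = 0.
  move=> i_n; rewrite (gs_expand dotN d i_n) dot_sumr big1 // => j _; rewrite dotZr.
  rewrite [dot w _](_ : _ = 0) ?mulr0 //.
  by apply: partial_proj_orth_gs => //; exact: leq_trans (ltn_ord j) i_n.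
have Kw : K w = w.
  rewrite /w (linBf lK) Ku; congr (_ - _); rewrite (linsumf _ _ _ lK).
  by apply: eq_bigr => j _; rewrite (linZf lK) Ke.
have nw : nrm w != 0 by rewrite nrm_eq0.
pose w1 := unit_of w.
have nw1 : nrm w1 = 1 by rewrite nrm_unit_of w0.
have Kw1 : K w1 = w1 by rewrite /w1 /unit_of (linZf lK) Kw.
have w1le : nrm w1 <= 1 by rewrite nw1.
have [j [Kf /= wf]] := fP (exist _ w1 (conj Kw1 w1le)).
have dj : d j = f j.
  by rewrite /d insubT // => jn; rewrite (_ : Sub _ _ = j) ?Kf ?eqxx //; exact/val_inj.
have w1d : dot w1 (f j) = 0 by rewrite -dj /w1 /unit_of dotZl wd ?mulr0.
have := nrmB2 dotN w1 (f j); rewrite w1d nw1 /= mul0rn subr0 expr1n.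
have := nrm_ge0 (w1 - f j); have := sqr_ge0 (nrm (f j)); move: wf; nra.
Qed.

End FixedSpace.

Section Resolvent.
Variables (R : realType) (H : completeNormedModType R[i]).
Variable dot : {dot H for Num.conj}.
Hypothesis dotN : induces_norm dot.
Implicit Types (x y z : H) (X Y T K : H -> H).
Variable A : set (H -> H).
Hypothesis Aalg : unital_subalgebra A.
Hypothesis Acl : WOT_closed dot A.

(** The partial sums are bounded, and a weak limit suffices because [A] is weakly closed; the
    telescoping sum survives the limit on both sides. *)
Lemma neumann X (h : R) : A X -> 0 <= h -> h < 1 -> opbound X h ->
  exists L, [/\ A L, forall v, L (v - X v) = v & forall v, L v - X (L v) = v].
Proof.
move=> AX h0 h1 Xh.
have lX := alg_linear Aalg AX.
have hp : 0 < 1 - h by rewrite subr_gt0.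
have AXk k : A (iter k (fun Y => X \o Y) idfun).
  by elim: k => [|k IH]; [exact: (alg_id Aalg)|exact: (alg_comp Aalg)].
have XkE k v : iter k (fun Y => X \o Y) idfun v = iter k X v.
  by elim: k => //= k ->.
pose S k v := \sum_(j < k) 1 *: iter j (fun Y => X \o Y) idfun v.
have SE k v : S k v = \sum_(j < k) iter j X v.
  by apply: eq_bigr => j _; rewrite scale1r XkE.
have AS k : A (S k) by apply: (alg_sum Aalg) => j; exact: AXk.
have Xk k v : nrm (iter k X v) <= h ^+ k * nrm v.
  elim: k => [|k IH]; first by rewrite expr0 mul1r.
  by rewrite iterS (le_trans (Xh _)) // exprS -mulrA ler_wpM2l.
have Sb k : opbound (S k) (1 - h)^-1.
  move=> v; rewrite SE (le_trans (nrm_sum _ _ _)) //.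
  apply: (le_trans (ler_sum _ (fun (j : 'I_k) _ => Xk j v))).
  rewrite -mulr_suml ler_wpM2r ?nrm_ge0 //.
  rewrite -[leRHS]mul1r ler_pdivlMr // -[1 - h]opprB mulrN mulrC -subrX1 opprB.
  by rewrite gerBl exprn_ge0.
have [F [FU subF]] := @ultraFilterLemma nat \oo _.
have FP := @ultra_proper _ F FU.
have hp' : 0 <= (1 - h)^-1 by rewrite invr_ge0 ltW.
have [L [lL L1 cL]] := ultra_wot dotN FU hp' (fun k => alg_linear Aalg (AS k)) Sb.
have AL : A L.
  by apply: (alg_wot_lim Aalg Acl FP AS) => //; exact: bounded_operatorI lL hp' L1.
have [X' [_ _ Xa]] := adjoint_exists dotN lX h0 Xh.
have cXk v : weak_cvg dot F (fun k => v - iter k X v) v.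
  apply: (cvg_weak dotN FU); apply/cvg_nrmP => e e0.
  have : (fun k => h ^+ k) @ \oo --> (0 : R).
    by apply: cvg_expr; rewrite ger0_norm.
  move=> /cvgrPdist_lt/(_ (e / (nrm v + 1))); rewrite divr_gt0 ?ltr_wpDl ?nrm_ge0 // => /(_ isT).
  move=> hk; apply: subF; apply: filterS hk => k.
  rewrite sub0r normrN ger0_norm ?exprn_ge0 // ltr_pdivlMr ?ltr_wpDl ?nrm_ge0 // => hk.
  rewrite /= addrC addKr nrmN (le_lt_trans (Xk k v)) //.
  have := exprn_ge0 k h0; have := nrm_ge0 v; nra.
have LX v : weak_cvg dot F (fun k => X (S k v)) (X (L v)).
  by move=> w; rewrite Xa; under eq_fun do rewrite Xa; exact: cL.
have telescope k v : S k v - S k (X v) = v - iter k X v.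
  rewrite !SE; elim: k => [|k IH]; first by rewrite !big_ord0 /= !subrr.
  by rewrite !big_ord_recr /= opprD addrACA IH -iterSr addrA subrK.
have SX k v : S k (X v) = X (S k v).
  by rewrite !SE (linsumf _ _ _ lX); apply: eq_bigr => j _; rewrite -iterSr.
exists L; split=> // v.
- rewrite (linBf lL); apply: (weak_unique dotN FU _ (cXk v)).
  have := weak_cvgB FU (cL v) (cL (X v)).
  by under eq_fun do rewrite telescope.
- apply: (weak_unique dotN FU _ (cXk v)).
  have := weak_cvgB FU (cL v) (LX v).
  by under eq_fun do rewrite -SX telescope.
Qed.

Lemma opnorm_exists T (M : R) v0 : linear T -> opbound T M -> T v0 != 0 ->
  exists c : R, [/\ 0 < c, opbound T c & exists2 x, nrm x <= 1 & c <= 2 * nrm (T x)].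
Proof.
move=> lT TM Tv0.
pose E : set R := [set nrm (T x) | x in [set x | nrm x <= 1]].
have unit1 (v : H) : v != 0 -> nrm (unit_of v) <= 1 by move=> v0'; rewrite nrm_unit_of v0'.
have TE v : nrm (T v) = nrm v * nrm (T (unit_of v)).
  rewrite -{1}(unit_ofK v) (linZf lT) nrmZ nrmC ger0_norm ?nrm_ge0 //.
have v00 : v0 != 0 by apply: contraNneq Tv0 => ->; rewrite (lin0 lT).
have Esup : has_sup E.
  split; first by exists (nrm (T 0)), 0 => //=; rewrite nrm0.
  exists `|M| => _ [x /= x1 <-]; apply: (le_trans (TM x)).
  have := ler_norm M; have := normr_ge0 M; have := nrm_ge0 x; nra.
have Eub x : nrm x <= 1 -> nrm (T x) <= sup E.
  by move=> x1; apply: (ub_le_sup (proj2 Esup)); exists x.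
have c0 : 0 < sup E.
  rewrite (lt_le_trans _ (Eub _ (unit1 v0 v00))) //.
  rewrite nrm_gt0; apply: contraNneq Tv0 => Tu; rewrite -nrm_eq0 TE Tu nrm0 mulr0 //.
exists (sup E); split=> // [v|].
  have [->|v0'] := eqVneq v 0; first by rewrite (lin0 lT) nrm0 mulr0.
  by rewrite TE mulrC ler_wpM2r ?nrm_ge0 // Eub // (unit1 v).
have [_ [x /= x1 <-] xc] := sup_adherent (divr_gt0 c0 (ltr0n R 2)) Esup.
by exists x => //; lra.
Qed.

Variable T : H -> H.
Hypothesis AT : A T.

Definition resolvent (s : R) L := [/\ A L, forall v, L (v - s%:C *: T v) = v &
  forall v, L v - s%:C *: T (L v) = v].

(** [1 - tT = (1 - sT) (1 - X)] with [X = (t - s) L T], and the Neumann series inverts [1 - X]. *)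
Lemma resolvent_step s t L (M N : R) : 0 <= M -> 0 <= N -> opbound L M -> opbound T N ->
  `|t - s| * (M * N) < 1 -> resolvent s L -> exists L', resolvent t L'.
Proof.
move=> M0 N0 LM TN h1 [AL L1 L2].
pose X v := (t - s)%:C *: (L \o T) v.
have lL := alg_linear Aalg AL; have lT := alg_linear Aalg AT.
have AX : A X by apply: (algZ Aalg); exact: (alg_comp Aalg).
have lX := alg_linear Aalg AX.
have Xb : opbound X (`|t - s| * (M * N)).
  move=> v; rewrite /X nrmZ nrmC -mulrA ler_wpM2l // -mulrA.
  by apply: (le_trans (LM _)); rewrite ler_wpM2l.
have [|W [AW W1 W2]] := neumann AX _ h1 Xb; first by rewrite !mulr_ge0.
have E v : v - t%:C *: T v = (v - X v) - s%:C *: T (v - X v).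
  have Xs : X v - s%:C *: T (X v) = (t - s)%:C *: T v.
    by rewrite /X (linZf lT) scalerA mulrC -scalerA -scalerBr L2.
  rewrite (linBf lT) scalerBr opprD opprK addrACA [- X v + _]addrC -[_ *: T (X v) - X v]opprB Xs.
  by rewrite rmorphB scalerBl opprB addrA subrK.
exists (W \o L); split=> [|v|v]; first exact: (alg_comp Aalg).
  by rewrite /= E L1 W1.
by rewrite /= E W2 L2.
Qed.

(** [s] is the supremum of the parameters in the unit interval that have a resolvent; 1 has none
    because [T y = y]. Were the resolvents near [s] bounded by [k + 1], a step of fixed length [d]
    from a parameter closer than [d] would pass beyond [s]. *)
Lemma resolvent_blowup y : y != 0 -> T y = y -> exists s : R, [/\ 0 <= s, s <= 1 &
  forall k : nat, exists t L, [/\ resolvent t L, `|t - s| < k.+1%:R^-1 & ~ opbound L k.+1%:R]].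
Proof.
move=> y0 Ty; have [N N0 TN] := alg_opbound Aalg AT.
pose E : set R := [set s | (0 <= s <= 1) /\ exists L, resolvent s L].
have E0 : E 0.
  split; first by rewrite lexx ler01.
  exists idfun; split; [exact: (alg_id Aalg)| |]; move=> v /=; by rewrite scale0r subr0.
have Esup : has_sup E by split; [exists 0|exists 1 => s [/andP[]]].
have E1 L : resolvent 1 L -> False.
  move=> [AL L1 _]; have := L1 y; rewrite rmorph1 scale1r Ty subrr (lin0 (alg_linear Aalg AL)).
  by move/esym/eqP; rewrite (negPf y0).
exists (sup E); split.
- exact: (ub_le_sup (proj2 Esup)).
- by apply: ge_sup => [|s [/andP[]]//]; exists 0.
move=> k; apply: contrapT => no.
have k1 : 0 < k.+1%:R :> R by rewrite ltr0n.
pose d : R := (2 * (k.+1%:R * (N + 1)))^-1.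
have N1 : 0 < N + 1 by rewrite ltr_wpDl.
have d0 : 0 < d by rewrite invr_gt0 !mulr_gt0.
have dk : d * (k.+1%:R * N) < 1.
  by rewrite mulrC ltr_pdivrMr ?mul1r ?mulr_gt0 //; nra.
have dk' : d < k.+1%:R^-1.
  rewrite ltf_pV2 ?posrE ?mulr_gt0 //; nra.
have [s Es sd] := sup_adherent d0 Esup.
have sE := ub_le_sup (proj2 Esup) Es.
have [/andP[s0 s1] [L rL]] := Es.
have Lk : opbound L k.+1%:R.
  apply: contrapT => nL; apply: no; exists s, L; split=> //.
  by rewrite distrC ger0_norm ?subr_ge0 // (lt_trans _ dk') // ltrBlDr -ltrBlDl.
have step t : s <= t -> t <= s + d -> exists L', resolvent t L'.
  move=> st td; apply: (resolvent_step _ N0 Lk TN _ rL) => //.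
  apply: le_lt_trans dk; rewrite ler_wpM2r ?mulr_ge0 // ger0_norm ?subr_ge0 //; lra.
have [h|h] := leP (s + d) 1; last by have [L' /E1] := step 1 s1 (ltW h).
have [L' rL'] := step (s + d) (ltW (ltr_pwDr d0 (lexx s))) (lexx _).
have : E (s + d).
  by split; [rewrite h andbT addr_ge0 // ltW|exists L'].
move/(ub_le_sup (proj2 Esup)); lra.
Qed.

Theorem finite_rank_exists y : y != 0 -> T y = y -> compact_op dot T ->
  exists s L v, [/\ A L, L v != 0 & forall w, L w = s%:C *: T (L w)].
Proof.
move=> y0 Ty cT.
have [s [s0 s1 sP]] := resolvent_blowup y0 Ty.
have [t tP] := boolp.choice sP; have [L LP] := boolp.choice tP.
have exc k : exists c : R, [/\ k.+1%:R < c, opbound (L k) c &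
    exists2 x, nrm x <= 1 & c <= 2 * nrm (L k x)].
  have [[AL L1 _] _ nL] := LP k; have [M _ LM] := alg_opbound Aalg AL.
  have lL := alg_linear Aalg AL.
  have [|c [c0 Lc cx]] := opnorm_exists (v0 := y - (t k)%:C *: T y) lL LM.
    by rewrite L1.
  exists c; split=> //; rewrite ltNge; apply/negP => ck; apply: nL => v.
  by apply: (le_trans (Lc v)); rewrite ler_wpM2r ?nrm_ge0.
have [c cP] := boolp.choice exc.
have exx k : exists x, nrm x <= 1 /\ c k <= 2 * nrm (L k x).
  by have [_ _ [x x1 xc]] := cP k; exists x.
have [x xP] := boolp.choice exx.
have c0 k : 0 < c k by have [h _ _] := cP k; apply: le_lt_trans h; rewrite ler0n.
have [Lh LhD] : exists Lh, forall k, Lh k = (fun v => (c k)^-1%:C *: L k v) by eexists.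
have ALh k : A (Lh k) by have [[AL _ _] _ _] := LP k; rewrite LhD; exact: (algZ Aalg).
have lLh k := alg_linear Aalg (ALh k).
have Lh1 k : opbound (Lh k) 1.
  move=> v; rewrite LhD nrmZ nrmC ger0_norm ?invr_ge0 ?(ltW (c0 k)) // mul1r.
  by rewrite mulrC ler_pdivrMr // mulrC; have [_ h _] := cP k; exact: h.
have LhE k v : Lh k v = (t k)%:C *: T (Lh k v) + (c k)^-1%:C *: v.
  have [[_ _ L2] _ _] := LP k; rewrite -{3}(L2 v) scalerBr addrC.
  by rewrite LhD (linZf (alg_linear Aalg AT)) !scalerA [_^-1%:C * _]mulrC subrK.
have LhE' k v : Lh k v = (t k)%:C *: Lh k (T v) + (c k)^-1%:C *: v.
  have [[AL L1 _] _ _] := LP k; rewrite -{3}(L1 v) (linBf (alg_linear Aalg AL)) scalerBr addrC.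
  by rewrite LhD (linZf (alg_linear Aalg AL)) !scalerA [_^-1%:C * _]mulrC subrK.
have [F [FU subF]] := @ultraFilterLemma nat \oo _.
have FP := @ultra_proper _ F FU.
have [L0 [lL0 L01 cL0]] := ultra_wot dotN FU ler01 lLh Lh1.
have AL0 : A L0 by apply: (alg_wot_lim Aalg Acl FP ALh) => //; exact: (bounded_operatorI lL0 ler01 L01).
have t2 k : `|t k| <= 2.
  have [_ h _] := LP k; have i1 : k.+1%:R^-1 <= 1 :> R by rewrite invf_le1 ?ltr0n // ler1n.
  have := lt_le_trans h i1; have := ler_normD (t k - s) s; rewrite subrK (ger0_norm s0); lra.
have small (e b : R) : 0 < e -> 0 <= b -> F [set k | k.+1%:R^-1 * b < e].
  move=> e0 b0; apply: subF; have b1 : 0 < b + 1 by rewrite ltr_wpDl.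
  have [N NP] := archi_inv (divr_gt0 e0 b1); exists N => // k /NP.
  rewrite /= ltr_pdivlMr // mulrDr mulr1; apply: le_lt_trans.
  by rewrite lerDl invr_ge0 ler0n.
have cinv k : (c k)^-1 <= k.+1%:R^-1.
  by rewrite lef_pV2 ?posrE ?ltr0n // ltW //; have [] := cP k.
(* In [LhE] the last term tends to 0 and [T] turns the weak convergence of [Lh k v] into norm
   convergence. *)
have norm_lim v (e : R) : 0 < e -> F [set k | nrm (Lh k v - s%:C *: T (L0 v)) < e].
  move=> e0; have e3 : 0 < e / 3 by rewrite divr_gt0.
  have e6 : 0 < e / 6 by rewrite divr_gt0.
  have Lhv k : nrm (Lh k v) <= nrm v by have := Lh1 k v; rewrite mul1r.
  apply: (filterS _ (filterI (filterI (small _ _ e3 (nrm_ge0 (T (L0 v)))) (small _ _ e3 (nrm_ge0 v)))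
    (cT _ _ _ _ _ FU Lhv (cL0 v) _ e6))) => k [[/= h1 h2]] h3.
  have -> : Lh k v - s%:C *: T (L0 v) = (t k)%:C *: (T (Lh k v) - T (L0 v)) +
      (t k - s)%:C *: T (L0 v) + (c k)^-1%:C *: v.
    rewrite {1}LhE scalerBr rmorphB scalerBl addrA addrNK.
    by rewrite addrAC.
  have := nrmD ((t k)%:C *: (T (Lh k v) - T (L0 v)) + (t k - s)%:C *: T (L0 v)) ((c k)^-1%:C *: v).
  have := nrmD ((t k)%:C *: (T (Lh k v) - T (L0 v))) ((t k - s)%:C *: T (L0 v)).
  rewrite !nrmZ !nrmC (ger0_norm (ltW (_ : 0 < (c k)^-1))) ?invr_gt0 //.
  have : `|t k| * nrm (T (Lh k v) - T (L0 v)) <= 2 * (e / 6).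
    by apply: ler_pM; [by []|exact: nrm_ge0|exact: t2|exact: ltW].
  have : `|t k - s| * nrm (T (L0 v)) <= k.+1%:R^-1 * nrm (T (L0 v)).
    by rewrite ler_wpM2r ?nrm_ge0 // ltW //; have [] := LP k.
  have : (c k)^-1 * nrm v <= k.+1%:R^-1 * nrm v by rewrite ler_wpM2r ?nrm_ge0.
  move=> g1 g2; have := le_lt_trans g1 h2; have := le_lt_trans g2 h1; lra.
have L0E w : L0 w = s%:C *: T (L0 w).
  apply: (weak_unique dotN FU (cL0 w)).
  by apply: (cvg_weak dotN FU); apply/cvg_nrmP => e; exact: norm_lim.
have [[v v0]|no] := pselect (exists v, L0 v != 0); first by exists s, L0, v.
(* If the limit were 0, [Lh k] would tend to 0 in norm at each vector. As [T (x k)] tends to [T z]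
   in norm, [LhE'] makes the norm of [Lh k (x k)] less than [2 * (1/10 + 1/10) + 1/10 = 1/2], while
   the choice of [x k] makes it at least 1/2. *)
have L00 v : L0 v = 0 by apply/eqP; apply: contrapT => /negP h; apply: no; exists v.
have x1 k : nrm (x k) <= 1 by have [] := xP k.
have [z xz] := ultra_weak dotN FU x1.
have e0 : 0 < 10^-1 :> R by rewrite invr_gt0.
have [k [[/= h1 h2] h3]] := @filter_ex _ F FP _ (@filterI _ F _ _ _
  (@filterI _ F _ _ _ (norm_lim (T z) _ e0) (cT _ _ _ _ _ FU x1 xz _ e0)) (small _ 1 e0 ler01)).
exfalso.
have : nrm (Lh k (x k)) <= 2 * (nrm (Lh k (T z)) + nrm (Lh k (T (x k) - T z))) + k.+1%:R^-1.
  rewrite LhE'; apply: (le_trans (nrmD _ _)); rewrite !nrmZ !nrmC.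
  rewrite (ger0_norm (ltW (_ : 0 < (c k)^-1))) ?invr_gt0 // lerD //.
    apply: ler_pM; [by []|exact: nrm_ge0|exact: t2|].
    by rewrite (linBf (lLh k)) addrC (le_trans _ (nrmD _ _)) // subrK.
  by rewrite -[leRHS]mulr1; apply: ler_pM; rewrite ?nrm_ge0 ?invr_ge0 ?(ltW (c0 k)) ?cinv ?x1.
have := Lh1 k (T (x k) - T z).
have : 2^-1 <= nrm (Lh k (x k)).
  rewrite LhD nrmZ nrmC ger0_norm ?invr_ge0 ?(ltW (c0 k)) // mulrC ler_pdivlMr //.
  by have [_ h] := xP k; lra.
move: h1 h2 h3; rewrite L00 (lin0 (alg_linear Aalg AT)) scaler0 subr0 mulr1 mul1r; move: (k.+1%:R^-1) => r; lra.
Qed.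

End Resolvent.

(** * Left factorization *)

Section Left.
Variables (R : realType) (H : completeNormedModType R[i]).
Variable dot : {dot H for Num.conj}.
Hypothesis dotN : induces_norm dot.
Implicit Types (y z : H) (X Y T K : H -> H).
Variable A : set (H -> H).
Hypothesis Aalg : unital_subalgebra A.
Hypothesis Atr : transitive_algebra dot A.
Hypothesis Acl : WOT_closed dot A.

Section FiniteRank.
Variables (n : nat) (x k : 'I_n.+1 -> H).
Hypothesis xk : minimal_pair dot A x k.
Variables (F : H -> H) (m : nat) (e : 'I_m -> H).
Hypothesis AF : A F.
Hypothesis Fe : forall w, F w = \sum_i dot (F w) (e i) *: e i.

Let x00 : x ord0 != 0.
Proof.
have [x1 _ _ _] := xk; apply/eqP => x0; have := x1 ord0 ord0.
by rewrite x0 dot0l eqxx => /esym/eqP; rewrite oner_eq0.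
Qed.

(** The image under [F] of the dense orbit of [x ord0] is dense in the finite-dimensional range of
    [F], hence all of it. In terms of coordinates, a separating functional would be orthogonal to
    the orbit. *)
Lemma finite_rank_orbit z : exists2 Y, A Y & F (Y (x ord0)) = F z.
Proof.
have [M M0 FM] := alg_opbound Aalg AF; have lF := alg_linear Aalg AF.
have [F' [_ _ Fa]] := adjoint_exists dotN lF M0 FM.
pose g w : 'rV[R[i]]_m := \row_i dot (F w) (e i).
have gE w w' : g w = g w' -> F w = F w'.
  move=> gw; rewrite (Fe w) (Fe w'); apply: eq_bigr => i _.
  by have := congr1 (fun u : 'rV_m => u 0 i) gw; rewrite !mxE => ->.
pose L : set 'rV[R[i]]_m := [set g (Y (x ord0)) | Y in A].
have [[Y AY YE]|nL] := pselect (L (g z)); first by exists Y => //; apply: gE.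
have [||c cL] := @row_space_separation _ _ L (g z) _ _ nL.
- exists (fun=> 0); first exact: alg0.
  by apply/rowP => i; rewrite !mxE (lin0 lF) dot0l.
- move=> c _ _ [X AX <-] [Y AY <-].
  exists (fun w => c *: X w + Y w); first exact: alg_lin.
  by apply/rowP => i; rewrite !mxE (linDf lF) (linZf lF) dotDl dotZl.
have gc w : (g w *m c) 0 0 = dot w (F' (\sum_i Num.conj (c i 0) *: e i)).
  rewrite -Fa mxE dot_sumr; apply: eq_bigr => i _.
  by rewrite !mxE dotZr conjCK mulrC.
case/eqP; apply/matrixP => a b; rewrite !ord1 gc mxE.
rewrite [F' _](orbit_orth0 dotN Aalg Atr x00) ?dot0r // => X AX.
by rewrite -gc (cL (g (X (x ord0)))) ?mxE //; exists X.
Qed.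

(** The map [F X x_0 |-> F X x_max] acts on a finite-dimensional range. An eigenvector [F X x_0]
    would make the tuple of the [F X x_i] dependent, so minimality makes it vanish. Iterates from
    one starting point, with chosen lifts [f], avoid having to check that the map is well
    defined. *)
Lemma finite_rank_zero : F = (fun=> 0).
Proof.
have [x1 _ _ xmin] := xk; have n0 := minimal_pair_gt0 dotN Aalg Atr xk.
have lF := alg_linear Aalg AF.
have orb X : exists Y, A Y /\ F (Y (x ord0)) = F (X (x ord_max)).
  by have [Y] := finite_rank_orbit (X (x ord_max)); exists Y.
have [f fP] := boolp.choice orb.
apply/funext => w; have [X0 AX0 <-] := finite_rank_orbit w.
pose Xs j := iter j f X0.
have AXs j : A (Xs j) by case: j => //= j; have [] := fP (Xs j).
pose v j := F (Xs j (x ord0)).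
have vS j : F (Xs j (x ord_max)) = v j.+1 by rewrite /v /=; have [_ ->] := fP (Xs j).
pose comb (p : {poly R[i]}) u := \sum_(j < m.+1) p`_j *: Xs j u.
have Acomb p : A (comb p) by exact: (alg_sum Aalg).
pose ev p := F (comb p (x ord0)).
have evE p : ev p = \sum_(j < m.+1) p`_j *: v j.
  by rewrite /ev (linsumf _ _ _ lF); apply: eq_bigr => j _; rewrite (linZf lF).
(* A root [lam] of the annihilating polynomial is split off, [p = q * ('X - lam)]. The relation
   [z_max = lam z_0] makes the tuple [z] dependent, hence zero, so [q] annihilates as well; at
   degree 0 this gives [v 0 = 0]. *)
have reduce s (p : {poly R[i]}) : (size p <= s)%N -> (s <= m.+1)%N -> p != 0 -> ev p = 0 -> v 0%N = 0.
  elim: s p => [|s IH] p; first by rewrite size_poly_leq0 => ->.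
  move=> ps sm p0 evp.
  have [p1|p1] := boolP (size p == 1%N).
    move: evp; rewrite evE big_ord_recl big1 ?addr0 => [|j _]; last first.
      by rewrite nth_default ?scale0r // (eqP p1).
    move/eqP; rewrite scaler_eq0 => /orP[/eqP pc|/eqP //].
    case/eqP: p0; apply/eqP; rewrite -lead_coef_eq0 lead_coefE (eqP p1) /= pc //.
  have /closed_rootP[lam /factor_theorem[q pq]] := p1.
  have q0 : q != 0 by apply: contraNneq p0 => q0; rewrite pq q0 mul0r.
  have qs : (size q <= s)%N.
    by rewrite -ltnS (leq_trans _ ps) // pq size_Mmonic ?monicXsubC // size_XsubC addn2.
  apply: (IH q) => //; first exact: ltnW.
  have qm : q`_m = 0 by rewrite nth_default // (leq_trans qs).
  pose z i := F (comb q (x i)).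
  have z1 : z ord_max = \sum_(j < m.+1) q`_j *: v j.+1.
    by rewrite /z (linsumf _ _ _ lF); apply: eq_bigr => j _; rewrite (linZf lF) vS.
  have zp : z ord_max - lam *: z ord0 = 0.
    rewrite -[RHS]evp z1 -[z ord0]/(ev q) !evE scaler_sumr pq.
    rewrite big_ord_recr /= qm scale0r addr0.
    under [X in _ = X]eq_bigr do rewrite mulrBr coefB coefMX coefMC scalerBl.
    rewrite [RHS]big_split /= sumrN; congr (_ - _).
      by rewrite big_ord_recl /= scale0r add0r.
    by apply: eq_bigr => j _; rewrite scalerA mulrC.
  pose c (i : 'I_n.+1) : R[i] := if i == ord0 then - lam else if i == ord_max then 1 else 0.
  have m0 : ord_max != ord0 :> 'I_n.+1 by rewrite -(inj_eq val_inj) /= -lt0n.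
  apply: (xmin z c ord_max) => [||X AX].
  - by rewrite /c (negPf m0) eqxx oner_eq0.
  - rewrite (bigD1 ord0) //= (bigD1 ord_max) //= big1 => [|i /andP[i0 i1]].
      by rewrite /c eqxx (negPf m0) eqxx scale1r addr0 scaleNr addrC.
    by rewrite /c (negPf i0) (negPf i1) scale0r.
  have [_ kA _ _] := xk.
  exact: (kA (X \o (F \o comb q)) (alg_comp Aalg AX (alg_comp Aalg AF (Acomb q)))).
(* The [m + 1] vectors [v j] have only [m] coordinates, so a nonzero polynomial of size at most
   [m + 1] annihilates them. *)
pose M : 'M[R[i]]_(m.+1, m) := \matrix_(j, i) dot (v j) (e i).
have : kermx M != 0.
  by rewrite -mxrank_eq0 mxrank_ker -lt0n subn_gt0 ltnS rank_leq_col.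
case/rowV0Pn => u /sub_kermxP uM u0.
apply: (reduce m.+1 (rVpoly u)) => //.
- exact: size_poly.
- by apply: contraNneq u0 => u0; rewrite -(rVpolyK u) u0 linear0.
rewrite evE; under eq_bigr => j _.
  rewrite coef_rVpoly_ord /v Fe scaler_sumr.
  over.
rewrite exchange_big big1 //= => i _.
have := congr1 (fun u : 'rV_m => u 0 i) uM; rewrite !mxE => uMi.
under eq_bigr do rewrite scalerA.
rewrite -scaler_suml [X in X *: _](_ : _ = 0) ?scale0r // -[RHS]uMi.
by apply: eq_bigr => j _; rewrite mxE.
Qed.

End FiniteRank.

Theorem left_case : separable_space H -> left_partial_factorization dot A ->
  A = @bounded_operator R H.
Proof.
move=> Hsep Aleft; apply: contrapT => algB.
have [n [x [k xk]]] := minimal_pair_exists dotN Aalg Acl algB.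
have x1 : nrm (x ord0) = 1.
  have [x1 _ _ _] := xk; apply/eqP; rewrite -(@eqrXn2 _ 2) ?nrm_ge0 // expr1n.
  by rewrite -(inj_eq (@complexI R)) -(dotxx dotN) x1 eqxx.
have [d dd] := dense_sequence Hsep.
have [Q QP] := boolp.choice (diag_proj_exists dotN d).
have near r := near_fixed dotN Aalg Acl Aleft dd QP (r := r) x1.
have q0 : 0 < 4^-1 :> R by rewrite invr_gt0.
have [Z [ZA Z1 Zc Zx]] := compact_near_fixed dotN Aalg Acl near q0.
have [T [y [AT cT y0 Ty]]] := lomonosov dotN Aalg Atr x1 ZA Z1 Zc Zx.
have [s [L [v [AL Lv LE]]]] := finite_rank_exists dotN Aalg Acl AT y0 Ty cT.
have [|m [e eE]] := @compact_fixed_space _ _ _ dotN (fun w => s%:C *: T w) _ (compact_scale s%:C cT).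
  exact: (alg_linear Aalg (algZ Aalg s%:C AT)).
have := @finite_rank_zero n x k xk L m e AL (fun w => eE (L w) (esym (LE w))).
by move=> L0; move: Lv; rewrite L0 eqxx.
Qed.

End Left.

Theorem corollary2p1 (R : realType) (H : completeNormedModType R[i])
    (dot : {dot H for Num.conj}) (A : set (H -> H)) :
  induces_norm dot ->
  separable_space H ->
  ~ finite_dimensional H ->
  unital_subalgebra A ->
  transitive_algebra dot A ->
  WOT_closed dot A ->
  left_partial_factorization dot A \/ right_partial_factorization dot A ->
  A = @bounded_operator R H.
Proof.
move=> dotN Hsep _ Aalg Atr Acl [Aleft|Aright].
  exact: (left_case dotN Aalg Atr Acl Hsep Aleft).
exact: (right_case dotN Aalg Atr Acl Hsep Aright).
Qed.
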